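(* Let $r \geq 3$ and $n \geq 5 + r$ be integers, and let $M$ be an oriented paving matroid of rank $r$ on a ground set of $n$ elements. Then $M$ has at least \[ f(n,r) = \frac{12}{13(r-1)} \binom{n}{r-2} \] independent hyperplanes.
   Context: A matroid $M$ of rank $r$ is called paving if every circuit of $M$ has size $r$ or $r+1$. An oriented paving matroid is an oriented matroid whose underlying matroid is paving. A hyperplane of a matroid of rank $r$ is a flat of rank $r-1$; a hyperplane $H$ is called independent if it has exactly $r-1$ elements (equivalently, $H$ is an independent set). *)

(* Defs.v *)
(* MathComp world. *)
From HB Require Import structures.
From mathcomp Require Import all_boot all_order all_algebra.

Set Implicit Arguments.
Unset Strict Implicit.
Unset Printing Implicit Defensive.

Import Order.TTheory GRing.Theory Num.Theory.

Record matroid (E : finType) : Type := Matroid {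
  circuits : {set {set E}};
  circuit_neq0 : set0 \notin circuits;
  circuit_incomparable : forall C D : {set E},
    C \in circuits -> D \in circuits -> C \subset D -> C = D;
  circuit_elimination : forall (C D : {set E}) (e : E),
    C \in circuits -> D \in circuits -> C <> D -> e \in C :&: D ->
    exists2 Z : {set E}, Z \in circuits & Z \subset (C :|: D) :\ e
}.

Section MatroidNotions.
Variables (E : finType) (M : matroid E).

Definition indep (I : {set E}) : bool :=
  [forall C in circuits M, ~~ (C \subset I)].

Definition rk (A : {set E}) : nat :=
  \max_(I : {set E} | (I \subset A) && indep I) #|I|.

Definition mrank : nat := rk [set: E].

Definition flat (F : {set E}) : bool :=
  [forall e, (e \notin F) ==> (rk F < rk (e |: F))].

(* The rank condition is written as rk H + 1 = mrank, so that no set is a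
   hyperplane when mrank = 0. *)
Definition hyperplane (H : {set E}) : bool :=
  flat H && ((rk H).+1 == mrank).

Definition independent_hyperplanes : {set {set E}} :=
  [set H | hyperplane H && (#|H|.+1 == mrank)].

Definition paving : Prop :=
  forall C : {set E}, C \in circuits M -> #|C| = mrank \/ #|C| = mrank.+1.

End MatroidNotions.

(* A signed subset X of E is encoded by the pair (X^+, X^-) of its positive
   and negative parts; their disjointness is the field scircuit_disjoint of
   oriented_matroid. *)
Definition signed_set (E : finType) : Type := ({set E} * {set E})%type.

Definition sopp (E : finType) (X : signed_set E) : signed_set E := (X.2, X.1).

Definition support (E : finType) (X : signed_set E) : {set E} := X.1 :|: X.2.

Record oriented_matroid (E : finType) : Type := OrientedMatroid {
  scircuits : {set {set E} * {set E}};
  scircuit_disjoint : forall X : signed_set E,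
    X \in scircuits -> [disjoint X.1 & X.2];
  scircuit_neq0 : (set0, set0) \notin scircuits;
  scircuit_sym : forall X : signed_set E,
    X \in scircuits -> sopp X \in scircuits;
  scircuit_incomparable : forall X Y : signed_set E,
    X \in scircuits -> Y \in scircuits ->
    support X \subset support Y -> X = Y \/ X = sopp Y;
  scircuit_elimination : forall (X Y : signed_set E) (e : E),
    X \in scircuits -> Y \in scircuits -> X <> sopp Y ->
    e \in X.1 :&: Y.2 ->
    exists2 Z : signed_set E, Z \in scircuits &
      (Z.1 \subset (X.1 :|: Y.1) :\ e) && (Z.2 \subset (X.2 :|: Y.2) :\ e)
}.

Section Underlying.
Variables (E : finType) (M : oriented_matroid E).

Definition underlying_circuits : {set {set E}} :=
  [set support X | X in scircuits M].

Lemma support_sopp (X : signed_set E) : support (sopp X) = support X.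
Proof. by rewrite /support setUC. Qed.

Lemma underlying_neq0 : set0 \notin underlying_circuits.
Proof.
apply/imsetP=> -[[P N] XM] /esym/eqP; rewrite setU_eq0 => /andP[/= /eqP P0 /eqP N0].
by move: XM; rewrite P0 N0 (negPf (scircuit_neq0 M)).
Qed.

Lemma underlying_incomparable (C D : {set E}) :
  C \in underlying_circuits -> D \in underlying_circuits ->
  C \subset D -> C = D.
Proof.
move=> /imsetP[X XM ->] /imsetP[Y YM ->] sXY.
by case: (scircuit_incomparable XM YM sXY) => ->; rewrite ?support_sopp.
Qed.

Lemma underlying_elimination (C D : {set E}) (e : E) :
  C \in underlying_circuits -> D \in underlying_circuits -> C <> D ->
  e \in C :&: D ->
  exists2 Z : {set E}, Z \in underlying_circuits & Z \subset (C :|: D) :\ e.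
Proof.
move=> CM DM neqCD /setIP[eC eD].
have [X [XM sX eX]] :
    exists X : signed_set E, [/\ X \in scircuits M, support X = C & e \in X.1].
  case/imsetP: CM eC => X XM ->; case/setUP=> eX; first by exists X.
  by exists (sopp X); rewrite ?support_sopp // scircuit_sym.
have [Y [YM sY eY]] :
    exists Y : signed_set E, [/\ Y \in scircuits M, support Y = D & e \in Y.2].
  case/imsetP: DM eD => Y YM ->; case/setUP=> eY; last by exists Y.
  by exists (sopp Y); rewrite ?support_sopp // scircuit_sym.
have neqXY : X <> sopp Y.
  by move=> eqXY; apply: neqCD; rewrite -sX -sY eqXY support_sopp.
have eXY : e \in X.1 :&: Y.2 by rewrite inE eX.
have [Z ZM /andP[sZ1 sZ2]] := scircuit_elimination XM YM neqXY eXY.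
exists (support Z); first exact: imset_f.
rewrite subUset -sX -sY; apply/andP; split.
  by apply: subset_trans sZ1 _; apply: setSD; apply: setUSS; apply: subsetUl.
by apply: subset_trans sZ2 _; apply: setSD; apply: setUSS; apply: subsetUr.
Qed.

Definition underlying : matroid E :=
  Matroid underlying_neq0 underlying_incomparable underlying_elimination.

End Underlying.

Local Open Scope ring_scope.

Definition f (n r : nat) : rat :=
  12%:R / (13%:R * (r%:R - 1)) * 'C(n, r - 2)%:R.

(* Main.v *)
(* A set A of r - 3 elements is independent, and the contraction M/A is a simple
   oriented matroid of rank 3 on n - r + 3 >= 8 elements. If {a, b} is an
   ordinary pair of M/A (a two-element flat of rank 2) then A + a + b is an
   independent hyperplane, and each independent hyperplane arises from at most
   C(r-1, 2) sets A. So the bound follows by double counting from the inequality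
   of Csima and Sawyer: a simple oriented matroid of rank 3 on N > 7 elements,
   i.e. an arrangement of pseudolines, has at least 6N/13 ordinary pairs.

   For that inequality, send a line l to infinity and let mu(l) be the number of
   ordinary points on l and nu(l) the number of ordinary points attached to l:
   those extreme for the affine arrangement of the other lines. If mu(l) = 0 then
   nu(l) >= 3, and if mu(l) = 1 then nu(l) >= 2. An ordinary point is attached to
   at most four lines, one for each of its sectors. Two lines with mu = 2 and
   nu = 0 never meet in an ordinary point when N > 7, so there are at most m/2
   of them, m being the number of ordinary points; hence
   3N <= 2m + 4m + m/2. Statements about a few lines are consequences of the
   Grassmann-Plucker relations, found by exhausting the possible signs. *)

From HB Require Import structures.
From mathcomp Require Import all_boot all_order all_algebra zify.
Require Import Defs.

Set Implicit Arguments.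
Unset Strict Implicit.
Unset Printing Implicit Defensive.

(** * A decision procedure for signs *)

(** An arrangement is known only through the signs of its triples, so each geometric argument is cut
    in two: existence of a vertex, obtained as a maximum or by descent over a finite set, and a
    claim about at most six named lines, which is a finite sign problem. Extreme vertices arise by
    walking to the last vertex of a line and repeating, while fewer and fewer lines cut the sector.
    The hard point is a pair [l], [x] of lines with mu = 2 and nu = 0 that meet in an ordinary
    point. Seen from [l], every extreme vertex has inside it exactly one of the two ordinary
    partners [x], [y] of [l]. This forces four lines forming a complete quadrilateral with diagonals
    [l] and [x]; with its third diagonal it is the configuration of seven lines that must be
    excluded. Each of its four corners, two seen from [l] and two from [x], forbids one position of
    the remaining lines with respect to the other two vertices; together they put all remaining
    lines through one vertex, and an eighth line contradicts this. An oriented matroid is given by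
    signed circuits, so the sign function itself has to be built: it is obtained by Laplace
    expansion, contracting one element at a time. *)

Inductive sg := Neg | Zer | Pos.

Definition sg_eqb (x y : sg) : bool :=
  match x, y with Neg, Neg | Zer, Zer | Pos, Pos => true | _, _ => false end.

Lemma sg_eqP : Equality.axiom sg_eqb.
Proof. by case; case; constructor. Qed.

HB.instance Definition _ := hasDecEq.Build sg sg_eqP.

Definition sgopp (x : sg) : sg :=
  match x with Neg => Pos | Zer => Zer | Pos => Neg end.

Definition sgmul (x y : sg) : sg :=
  match x with Neg => sgopp y | Zer => Zer | Pos => y end.

Lemma sgmulC x y : sgmul x y = sgmul y x. Proof. by case: x; case: y. Qed.
Lemma sgmulA x y z : sgmul x (sgmul y z) = sgmul (sgmul x y) z.
Proof. by case: x; case: y; case: z. Qed.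
Lemma sgopp_mull x y : sgmul (sgopp x) y = sgopp (sgmul x y).
Proof. by case: x; case: y. Qed.
Lemma sgopp_mulr x y : sgmul x (sgopp y) = sgopp (sgmul x y).
Proof. by case: x; case: y. Qed.
Lemma sgoppK x : sgopp (sgopp x) = x. Proof. by case: x. Qed.

(* Whether real numbers with these signs, some already seen to be positive
   ([p]) or negative ([n]), can add up to zero. *)
Fixpoint balanced (p n : bool) (xs : seq sg) : bool :=
  match xs with
  | [::] => p == n
  | Pos :: xs => balanced true n xs
  | Neg :: xs => balanced p true xs
  | Zer :: xs => balanced p n xs
  end.

Inductive trm :=
| Tri of nat & nat & nat
| Cst of sg
| Mul of trm & trm
| Opp of trm.

Inductive fml :=
| Eqt of trm & trm
| Bal of seq trm
| And of fml & fml
| Or of fml & fml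
| Imp of fml & fml
| Not of fml
| Tru.

Section Semantics.
Variable v : nat -> nat -> nat -> sg.

Fixpoint tval (t : trm) : sg :=
  match t with
  | Tri i j k => v i j k
  | Cst x => x
  | Mul a b => sgmul (tval a) (tval b)
  | Opp a => sgopp (tval a)
  end.

Fixpoint fval (f : fml) : bool :=
  match f with
  | Eqt a b => tval a == tval b
  | Bal ts => balanced false false (map tval ts)
  | And f g => fval f && fval g
  | Or f g => fval f || fval g
  | Imp f g => fval f ==> fval g
  | Not f => ~~ fval f
  | Tru => true
  end.
End Semantics.

(* After compilation [Tri i j k] only occurs as [Tri n 0 0], the [n]-th
   decision variable. *)
Section Search.

Fixpoint look (s : seq sg) (n : nat) : option sg :=
  match s, n with
  | [::], _ => None
  | x :: _, 0 => Some x
  | _ :: s, n.+1 => look s n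
  end.

Variable s : seq sg.

Fixpoint ptval (t : trm) : option sg :=
  match t with
  | Tri n _ _ => look s n
  | Cst x => Some x
  | Mul a b =>
      match ptval a, ptval b with
      | Some Zer, _ => Some Zer
      | _, Some Zer => Some Zer
      | Some x, Some y => Some (sgmul x y)
      | _, _ => None
      end
  | Opp a => omap sgopp (ptval a)
  end.

Fixpoint pbal (p n : bool) (xs : seq (option sg)) : option bool :=
  match xs with
  | [::] => Some (p == n)
  | Some Pos :: xs => pbal true n xs
  | Some Neg :: xs => pbal p true xs
  | Some Zer :: xs => pbal p n xs
  | None :: _ => None
  end.

Fixpoint pfval (f : fml) : option bool :=
  match f with
  | Eqt a b =>
      match ptval a, ptval b with
      | Some x, Some y => Some (sg_eqb x y)
      | _, _ => None
      end
  | Bal ts => pbal false false (map ptval ts)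
  | And f g =>
      match pfval f, pfval g with
      | Some false, _ => Some false
      | _, Some false => Some false
      | Some true, Some true => Some true
      | _, _ => None
      end
  | Or f g =>
      match pfval f, pfval g with
      | Some true, _ => Some true
      | _, Some true => Some true
      | Some false, Some false => Some false
      | _, _ => None
      end
  | Imp f g =>
      match pfval f, pfval g with
      | Some false, _ => Some true
      | _, Some true => Some true
      | Some true, Some false => Some false
      | _, _ => None
      end
  | Not f => omap negb (pfval f)
  | Tru => Some true
  end.

Definition fails (fs : seq fml) : bool :=
  has (fun f => if pfval f is Some false then true else false) fs.
End Search.

(** Depth-first search over the signs of the variables. The [n]-th list holds the formulas tested as
    soon as the [n]-th variable is fixed; success means that every branch meets a false one. *)
Fixpoint refute (fss : seq (seq fml)) (s : seq sg) : bool :=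
  match fss with
  | [::] => false
  | fs :: fss =>
      let try x := let s' := rcons s x in
        if fails s' fs then true else refute fss s' in
      (* Conditionals rather than [&&]: call-by-value evaluation would explore all three
         subtrees. *)
      if try Zer then (if try Pos then try Neg else false) else false
  end.

Section SearchSound.
Variable e : nat -> sg.
Let v := fun n (_ _ : nat) => e n.

Definition agrees (s : seq sg) := forall n x, look s n = Some x -> e n = x.

Lemma ptval_sound s t x : agrees s -> ptval s t = Some x -> tval v t = x.
Proof.
move=> es; elim: t x => [n i j|y|a IHa b IHb|a IHa] x /=.
- exact: es.
- by case.
- case Ea: (ptval s a) IHa => [xa|] IHa; case Eb: (ptval s b) IHb => [xb|] IHb;
    try rewrite (IHa _ erefl); try rewrite (IHb _ erefl).
  + by case: xa {Ea IHa}; case: xb {Eb IHb}; case.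
  + by case: xa {Ea IHa} => //; case.
  + by case: xb {Eb IHb} => //; case; rewrite sgmulC.
  + by [].
- by case Ea: (ptval s a) IHa => [xa|] IHa //=; case=> <-; rewrite (IHa _ erefl).
Qed.

Lemma pbal_sound s p n ts b : agrees s ->
  pbal p n (map (ptval s) ts) = Some b -> balanced p n (map (tval v) ts) = b.
Proof.
move=> es; elim: ts p n => [|t ts IH] p n /=; first by case.
by case Et: (ptval s t) => [x|] //; rewrite (ptval_sound es Et); case: x {Et} => /IH.
Qed.

Lemma pfval_sound s f b : agrees s -> pfval s f = Some b -> fval v f = b.
Proof.
move=> es; elim: f b => [t u|ts|f IHf g IHg|f IHf g IHg|f IHf g IHg|f IHf|] b /=.
- case Et: (ptval s t) => [x|] //; case Eu: (ptval s u) => [y|] // [<-].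
  by rewrite (ptval_sound es Et) (ptval_sound es Eu).
- exact: pbal_sound.
- case Ef: (pfval s f) IHf => [[]|] IHf; case Eg: (pfval s g) IHg => [[]|] IHg;
    rewrite ?(IHf _ erefl) ?(IHg _ erefl) //; case=> <- //; by rewrite andbF.
- case Ef: (pfval s f) IHf => [[]|] IHf; case Eg: (pfval s g) IHg => [[]|] IHg;
    rewrite ?(IHf _ erefl) ?(IHg _ erefl) //; case=> <- //; by rewrite orbT.
- case Ef: (pfval s f) IHf => [[]|] IHf; case Eg: (pfval s g) IHg => [[]|] IHg;
    rewrite ?(IHf _ erefl) ?(IHg _ erefl) //; case=> <- //; by rewrite implybT.
- by case Ef: (pfval s f) IHf => [c|] IHf //= -[<-]; rewrite (IHf _ erefl).
- by case.
Qed.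

Lemma agrees_rcons s : agrees s -> agrees (rcons s (e (size s))).
Proof.
move=> es n x.
(* The offset [k] lets the induction drop the head of the list. *)
have H : forall s' k, (forall n x, look s' n = Some x -> e (k + n)%N = x) ->
    look (rcons s' (e (k + size s')%N)) n = Some x -> e (k + n)%N = x.
  elim: n {es} => [|n IH] [|y s'] k es' //=.
  - by rewrite addn0 => -[].
  - by case=> <-; apply: (es' 0%N).
  rewrite !addnS -!addSn; apply: IH => m z Hm.
  by rewrite addSnnS; apply: es'.
by move/(H s 0%N); apply=> m z; rewrite add0n; apply: es.
Qed.

(** The branch that follows the actual values [e] never meets a false formula. *)
Lemma refute_sound fss s : agrees s ->
  all (all (fval v)) fss -> refute fss s = false.
Proof.
elim: fss s => [|fs fss IH] s es //= /andP[Hfs Hfss].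
have es' := agrees_rcons es.
have nf : fails (rcons s (e (size s))) fs = false.
  elim: fs Hfs => //= f fs IHfs /andP[Hf /IHfs] ->; rewrite orbF.
  case Ef: (pfval _ f) => [[]|] //.
  by rewrite (pfval_sound es' Ef) in Hf.
have nr := IH _ es' Hfss.
move: nf nr; case: (e (size s)) => nf nr; rewrite nf nr ?if_same //.
Qed.
End SearchSound.

Section Compile.
Variable ord : seq (nat * nat * nat).

Definition slot (i j k : nat) : trm := Tri (index (i, j, k) ord) 0 0.

Definition sorted_slot (i j k : nat) : trm :=
  if [|| i == j, j == k | i == k] then Cst Zer
  else if i < j then
    (if j < k then slot i j k
     else if i < k then Opp (slot i k j) else slot k i j)
  else
    (if i < k then Opp (slot j i k)
     else if j < k then slot j k i else Opp (slot k j i)).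

Fixpoint tcomp (t : trm) : trm :=
  match t with
  | Tri i j k => sorted_slot i j k
  | Cst x => Cst x
  | Mul a b => Mul (tcomp a) (tcomp b)
  | Opp a => Opp (tcomp a)
  end.

Fixpoint fcomp (f : fml) : fml :=
  match f with
  | Eqt a b => Eqt (tcomp a) (tcomp b)
  | Bal ts => Bal (map tcomp ts)
  | And f g => And (fcomp f) (fcomp g)
  | Or f g => Or (fcomp f) (fcomp g)
  | Imp f g => Imp (fcomp f) (fcomp g)
  | Not f => Not (fcomp f)
  | Tru => Tru
  end.

Fixpoint tslots (t : trm) : seq nat :=
  match t with
  | Tri n _ _ => [:: n]
  | Cst _ => [::]
  | Mul a b => tslots a ++ tslots b
  | Opp a => tslots a
  end.

Fixpoint fslots (f : fml) : seq nat :=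
  match f with
  | Eqt a b => tslots a ++ tslots b
  | Bal ts => flatten (map tslots ts)
  | And f g | Or f g | Imp f g => fslots f ++ fslots g
  | Not f => fslots f
  | Tru => [::]
  end.

(** A formula is tested whenever one of its variables gets fixed. One that mentions a triple missing
    from [ord] is dropped, which is sound: fewer constraints are only harder to refute. *)
Definition buckets (fs : seq fml) : seq (seq fml) :=
  let fs' := [seq (fslots f, f) | f <- [seq f <- map fcomp fs | all (fun n => n < size ord) (fslots f)]] in
  [seq [seq p.2 | p <- fs' & (n \in p.1) || nilp p.1] | n <- iota 0 (size ord)].

End Compile.

Section CompileSound.
Variables (v : nat -> nat -> nat -> sg) (ord : seq (nat * nat * nat)).
Hypothesis v12 : forall i j k, v j i k = sgopp (v i j k).
Hypothesis v23 : forall i j k, v i k j = sgopp (v i j k).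
Hypothesis v0 : forall i j, v i i j = Zer.

Let e n := let t := nth (0, 0, 0)%N ord n in v t.1.1 t.1.2 t.2.
Let ve := fun n (_ _ : nat) => e n.
Let ok (ns : seq nat) := all (fun n => n < size ord) ns.

Lemma tcomp_sound t : ok (tslots (tcomp ord t)) -> tval ve (tcomp ord t) = tval v t.
Proof.
have slotP i j k : ok (tslots (slot ord i j k)) -> tval ve (slot ord i j k) = v i j k.
  by rewrite /ok /slot /= andbT /ve /e index_mem => /(nth_index (0,0,0)%N) ->.
elim: t => [i j k|x|a IHa b IHb|a IHa] //=.
- rewrite /sorted_slot; case: ifP => [/or3P[] /eqP-> _ /=|_].
  + by rewrite v0.
  + by rewrite -[RHS]sgoppK -v12 v23 v12 sgoppK v0.
  + by rewrite v23 v0.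
  case: ifP => _; do ?[case: ifP => _]; move/slotP => //=; try move=> ->.
  + by rewrite (v23 i j k) sgoppK.
  + by rewrite (v12 i k j) (v23 i j k) sgoppK.
  + by rewrite (v12 i j k) sgoppK.
  + by rewrite (v23 j i k) (v12 i j k) sgoppK.
  + by rewrite (v12 j k i) (v23 j i k) (v12 i j k) !sgoppK.
- by rewrite /ok all_cat => /andP[/IHa-> /IHb->].
- by move/IHa->.
Qed.

Lemma fcomp_sound f : ok (fslots (fcomp ord f)) -> fval ve (fcomp ord f) = fval v f.
Proof.
elim: f => [a b|ts|f IHf g IHg|f IHf g IHg|f IHf g IHg|f IHf|] //=.
- by rewrite /ok all_cat => /andP[/tcomp_sound-> /tcomp_sound->].
- move=> H; congr balanced; elim: ts H => //= t ts IH.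
  by rewrite /ok all_cat => /andP[/tcomp_sound-> /IH->].
- by rewrite /ok all_cat => /andP[/IHf-> /IHg->].
- by rewrite /ok all_cat => /andP[/IHf-> /IHg->].
- by rewrite /ok all_cat => /andP[/IHf-> /IHg->].
- by move/IHf->.
Qed.

Lemma buckets_sound fs : all (fval v) fs -> all (all (fval ve)) (buckets ord fs).
Proof.
move=> Hfs; rewrite /buckets; set ps := [seq (fslots f, f) | f <- _].
have Hps : all (fun p => fval ve p.2) ps.
  rewrite /ps {ps} all_map; elim: fs Hfs => //= f fs IH /andP[Hf /IH] {}IH.
  by case: ifP => // /fcomp_sound; rewrite /= Hf => ->.
elim: (iota _ _) => //= n ns ->; rewrite andbT all_map.
by elim: ps Hps => //= p ps IH /andP[Hp /IH] {}IH; case: ifP => //= _; rewrite Hp.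
Qed.

Lemma refute_buckets fs : refute (buckets ord fs) [::] -> ~~ all (fval v) fs.
Proof.
move=> H; apply/negP => /buckets_sound Hfs.
by move: (@refute_sound e _ [::] (fun n x => ltac:(by case: n)) Hfs); rewrite H.
Qed.
End CompileSound.

Fixpoint tvars (t : trm) : seq (nat * nat * nat) :=
  match t with
  | Tri i j k =>
      let: s := sort leq [:: i; j; k] in
      [:: (nth 0 s 0, nth 0 s 1, nth 0 s 2)]
  | Cst _ => [::]
  | Mul a b => tvars a ++ tvars b
  | Opp a => tvars a
  end.

Fixpoint fvars (f : fml) : seq (nat * nat * nat) :=
  match f with
  | Eqt a b => tvars a ++ tvars b
  | Bal ts => flatten (map tvars ts)
  | And f g | Or f g | Imp f g => fvars f ++ fvars g
  | Not f => fvars f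
  | Tru => [::]
  end.

(* The Grassmann-Plucker relation pairing the dependency of the vectors
   a, b, c, d with the linear form det(p, q, _). *)
Definition GP (p q a b c d : nat) : fml :=
  Bal [:: Mul (Tri b c d) (Tri p q a); Opp (Mul (Tri a c d) (Tri p q b));
          Mul (Tri a b d) (Tri p q c); Opp (Mul (Tri a b c) (Tri p q d))].

Fixpoint comb (k : nat) (s : seq nat) : seq (seq nat) :=
  match k, s with
  | 0, _ => [:: [::]]
  | _, [::] => [::]
  | k'.+1, x :: s' => map (cons x) (comb k' s') ++ comb k s'
  end.

(** Repeating [a] kills the first product of [GP] and leaves a three-term relation. *)
Definition GP3s (n : nat) : seq fml :=
  flatten [seq (let o := [seq j <- iota 0 n | j != a] in
           [seq GP a (nth 0 s 0) a (nth 0 s 1) (nth 0 s 2) (nth 0 s 3) | s <- comb 4 o])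
          | a <- iota 0 n].

Definition GP4s (n : nat) : seq fml :=
  flatten [seq (let o := [seq j <- iota 0 n | j \notin s] in
           [seq GP (nth 0 s 0) (nth 0 s 1) (nth 0 t 0) (nth 0 t 1) (nth 0 t 2) (nth 0 t 3) | t <- comb 4 o])
          | s <- comb 2 (iota 0 n)].

Definition all_vars n : seq (nat * nat * nat) :=
  [seq (nth 0 s 0, nth 0 s 1, nth 0 s 2) | s <- comb 3 (iota 0 n)].

Definition dedup (T : eqType) (s : seq T) := rev (undup (rev s)).

(* The variables are decided in their order of appearance in the statement. *)
Definition decide (axs hs : seq fml) (c : fml) (n : nat) : bool :=
  let fs := rcons hs (Not c) in
  let ord := [seq t <- dedup (flatten (map fvars fs)) | t.1.1 < t.1.2 < t.2] in
  let ord := ord ++ [seq t <- all_vars n | t \notin ord] in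
  refute (buckets ord (fs ++ axs)) [::].

(** The fold turns the hypotheses into a chain of implications, the shape of the goals to be
    solved. *)
Lemma decide_sound v axs hs c n :
  (forall i j k, v j i k = sgopp (v i j k)) ->
  (forall i j k, v i k j = sgopp (v i j k)) ->
  (forall i j, v i i j = Zer) ->
  decide axs hs c n -> all (fval v) axs ->
  foldr (fun h P => fval v h -> P) (is_true (fval v c)) hs.
Proof.
move=> v12 v23 v0 D Haxs; suff: all (fval v) hs -> fval v c.
  elim: hs {D} => [|h hs IH] /=; first by apply.
  by move=> H Hh; apply: IH => Hhs; apply: H; rewrite Hh.
move=> Hhs; apply: contraTT D => Hc.
apply/negP => /(refute_buckets v12 v23 v0).
by rewrite all_cat all_rcons Hhs Haxs /= Hc.
Qed.

(** * Chirotopes of rank three *)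

(** Only the three-term relations are required; [chi_gp4] recovers the four-term ones. *)
Record chirotope (T : finType) (chi : T -> T -> T -> sg) : Prop := Chirotope {
  chi12 : forall a b c, chi b a c = sgopp (chi a b c);
  chi23 : forall a b c, chi a c b = sgopp (chi a b c);
  chi_gp : forall a q b c d,
    balanced false false [:: sgmul (chi a c d) (chi q a b);
      sgmul (chi a b d) (chi a q c); sgmul (chi a b c) (chi q a d)];
  chi_simple : forall a b, a != b -> exists c, chi a b c != Zer
}.

Section Chirotope.
Variables (T : finType) (chi : T -> T -> T -> sg).
Hypothesis chiP : chirotope chi.

Let v12 := chi12 chiP.
Let v23 := chi23 chiP.

Lemma chi_rr a b : chi a a b = Zer.
Proof. by have := v12 a a b; case: (chi a a b). Qed.

(** For [e] with [chi a b e] nonzero, two products of the three-term relation at [a] vanish, and the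
    third is [chi a x y] times a nonzero sign. *)
Lemma chi_flat a b x y : a != b ->
  chi a b x = Zer -> chi a b y = Zer -> chi a x y = Zer.
Proof.
move=> /(chi_simple chiP)[e ne] Hx Hy; have := chi_gp chiP a e b x y.
rewrite Hx Hy (v12 a e b) (v23 a b e).
by case: (chi a b e) ne; case: (chi a x y).
Qed.

Definition vanishes t := Eqt t (Cst Zer).

Definition flats_ax n : seq fml :=
  flatten [seq flatten [seq if [&& i != j, i < n & j < n] then
      [seq Imp (And (vanishes (Tri i j (nth 0 t 0))) (vanishes (Tri i j (nth 0 t 1))))
               (vanishes (Tri i (nth 0 t 0) (nth 0 t 1)))
      | t <- comb 2 [seq k <- iota 0 n | (k != i) && (k != j)]] else [::]
    | j <- iota 0 n] | i <- iota 0 n].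

Lemma all_flatten_map (A B : Type) (p : pred B) (f : A -> seq B) s :
  (forall x, all p (f x)) -> all p (flatten (map f s)).
Proof. by move=> H; elim: s => //= x s IH; rewrite all_cat H. Qed.

Lemma all_mapT (A B : Type) (p : pred B) (f : A -> B) s :
  (forall x, p (f x)) -> all p (map f s).
Proof. by move=> H; elim: s => //= x s ->; rewrite H. Qed.

Lemma GP3_holds (x : nat -> T) n :
  all (fval (fun i j k => chi (x i) (x j) (x k))) (GP3s n).
Proof.
apply: all_flatten_map => a; apply: all_mapT => s /=.
set b := x (nth 0 s 1); set c := x (nth 0 s 2); set d := x (nth 0 s 3).
set q := x (nth 0 s 0); have := chi_gp chiP (x a) q b c d.
rewrite (v23 (x a) (x a) q) (v12 (x a) q b) (v12 (x a) q d) chi_rr.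
by case: (chi b c d); rewrite !sgopp_mulr.
Qed.

Lemma flats_hold (x : nat -> T) n : (forall i j, i < n -> j < n -> i != j -> x i != x j) ->
  all (fval (fun i j k => chi (x i) (x j) (x k))) (flats_ax n).
Proof.
move=> xinj; apply: all_flatten_map => i; apply: all_flatten_map => j.
case: ifP => // /and3P[ij li lj]; apply: all_mapT => t /=.
by apply/implyP => /andP[/eqP h0 /eqP h1]; apply/eqP; apply: chi_flat h0 h1; apply: xinj.
Qed.

(** For six distinct elements the search uses flatness, which needs distinctness. Each of the
    fifteen possible coincidences is searched apart, by repeating an index, and there the three-term
    relations suffice. The outcome holds for all elements, so later sign problems may ignore
    coincidences. *)
Lemma chi_gp4 p q a b c d :
  balanced false false [:: sgmul (chi b c d) (chi p q a); sgopp (sgmul (chi a c d) (chi p q b));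
          sgmul (chi a b d) (chi p q c); sgopp (sgmul (chi a b c) (chi p q d))].
Proof.
pose x := nth p [:: p; q; a; b; c; d].
have solve axs i j k l m n : decide axs [::] (GP i j k l m n) 6 ->
    all (fval (fun i j k => chi (x i) (x j) (x k))) axs ->
    fval (fun i j k => chi (x i) (x j) (x k)) (GP i j k l m n).
  by apply: decide_sound => // e f; apply: chi_rr.
 case: (boolP (uniq [:: p; q; a; b; c; d])) => [U|].
  apply: (solve (GP3s 6 ++ flats_ax 6) 0 1 2 3 4 5); first by vm_compute.
  rewrite all_cat GP3_holds flats_hold // => i j li lj.
  by rewrite nth_uniq.
have solve3 i j k l m n (D : decide (GP3s 6) [::] (GP i j k l m n) 6) :=
  solve _ _ _ _ _ _ _ D (GP3_holds x 6).
move=> nU; have : (p == q) || (p == a) || (p == b) || (p == c) || (p == d) || (q == a) || (q == b) || (q == c) || (q == d) || (a == b) || (a == c) || (a == d) || (b == c) || (b == d) || (c == d).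
  by move: nU; rewrite /= !inE !negb_and !negbK orbF -!orbA.
move=> {nU}; rewrite -!orbA.
case/orP=> [/eqP E|]; first by have := solve3 0 0 2 3 4 5 ltac:(vm_cast_no_check (erefl true)); rewrite /x /nth -E.
case/orP=> [/eqP E|]; first by have := solve3 0 1 0 3 4 5 ltac:(vm_cast_no_check (erefl true)); rewrite /x /nth -E.
case/orP=> [/eqP E|]; first by have := solve3 0 1 2 0 4 5 ltac:(vm_cast_no_check (erefl true)); rewrite /x /nth -E.
case/orP=> [/eqP E|]; first by have := solve3 0 1 2 3 0 5 ltac:(vm_cast_no_check (erefl true)); rewrite /x /nth -E.
case/orP=> [/eqP E|]; first by have := solve3 0 1 2 3 4 0 ltac:(vm_cast_no_check (erefl true)); rewrite /x /nth -E.
case/orP=> [/eqP E|]; first by have := solve3 0 1 1 3 4 5 ltac:(vm_cast_no_check (erefl true)); rewrite /x /nth -E.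
case/orP=> [/eqP E|]; first by have := solve3 0 1 2 1 4 5 ltac:(vm_cast_no_check (erefl true)); rewrite /x /nth -E.
case/orP=> [/eqP E|]; first by have := solve3 0 1 2 3 1 5 ltac:(vm_cast_no_check (erefl true)); rewrite /x /nth -E.
case/orP=> [/eqP E|]; first by have := solve3 0 1 2 3 4 1 ltac:(vm_cast_no_check (erefl true)); rewrite /x /nth -E.
case/orP=> [/eqP E|]; first by have := solve3 0 1 2 2 4 5 ltac:(vm_cast_no_check (erefl true)); rewrite /x /nth -E.
case/orP=> [/eqP E|]; first by have := solve3 0 1 2 3 2 5 ltac:(vm_cast_no_check (erefl true)); rewrite /x /nth -E.
case/orP=> [/eqP E|]; first by have := solve3 0 1 2 3 4 2 ltac:(vm_cast_no_check (erefl true)); rewrite /x /nth -E.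
case/orP=> [/eqP E|]; first by have := solve3 0 1 2 3 3 5 ltac:(vm_cast_no_check (erefl true)); rewrite /x /nth -E.
case/orP=> [/eqP E|]; first by have := solve3 0 1 2 3 4 3 ltac:(vm_cast_no_check (erefl true)); rewrite /x /nth -E.
by move/eqP=> E; have := solve3 0 1 2 3 4 4 ltac:(vm_cast_no_check (erefl true)); rewrite /x /nth -E.
Qed.
End Chirotope.

(** * Oriented lines and the signs of their triples *)

Section Oriented.
Variables (T : finType) (chi : T -> T -> T -> sg).

(* The boolean chooses which side of the line is positive. *)
Definition oline : Type := (T * bool)%type.
HB.instance Definition _ := Finite.on oline.

Definition flip (a : oline) : oline := (a.1, ~~ a.2).

Definition orient (b : bool) (x : sg) : sg := if b then x else sgopp x.

Definition osign (a b c : oline) : sg :=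
  orient a.2 (orient b.2 (orient c.2 (chi a.1 b.1 c.1))).

Lemma flipK : involutive flip. Proof. by case=> a []. Qed.

Lemma Xf1 a b c : osign (flip a) b c = sgopp (osign a b c).
Proof. by case: a => a []; rewrite /osign /= ?sgoppK. Qed.

Lemma Xf2 a b c : osign a (flip b) c = sgopp (osign a b c).
Proof. by case: a => a []; case: b => b []; rewrite /osign /= ?sgoppK. Qed.

Lemma Xf3 a b c : osign a b (flip c) = sgopp (osign a b c).
Proof. by case: a => a []; case: b => b []; case: c => c []; rewrite /osign /= ?sgoppK. Qed.

Hypothesis chiP : chirotope chi.

Lemma X12 a b c : osign b a c = sgopp (osign a b c).
Proof.
by case: a => a []; case: b => b []; case: c => c []; rewrite /osign /= (chi12 chiP) ?sgoppK.
Qed.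

Lemma X23 a b c : osign a c b = sgopp (osign a b c).
Proof.
by case: a => a []; case: b => b []; case: c => c []; rewrite /osign /= (chi23 chiP) ?sgoppK.
Qed.

Lemma Xrr a b : osign a a b = Zer.
Proof. by have := X12 a a b; case: (osign a a b). Qed.

(** Each product contains every one of the six lines once, so a choice of orientations multiplies
    all four terms by the same sign [K]. *)
Lemma X_gp4 p q a b c d :
  balanced false false [:: sgmul (osign b c d) (osign p q a); sgopp (sgmul (osign a c d) (osign p q b));
          sgmul (osign a b d) (osign p q c); sgopp (sgmul (osign a b c) (osign p q d))].
Proof.
pose o (u : oline) := if u.2 then Pos else Neg.
pose K := sgmul (o p) (sgmul (o q) (sgmul (o a) (sgmul (o b) (sgmul (o c) (o d))))).
have XE e f g : osign e f g = sgmul (o e) (sgmul (o f) (sgmul (o g) (chi e.1 f.1 g.1))).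
  by rewrite /osign /o; case: (e.2); case: (f.2); case: (g.2).
have prodX e f g h i j : sgmul (osign e f g) (osign h i j) =
    sgmul (sgmul (o h) (sgmul (o i) (sgmul (o j) (sgmul (o e) (sgmul (o f) (o g))))))
         (sgmul (chi e.1 f.1 g.1) (chi h.1 i.1 j.1)).
  rewrite !XE; move: (o e) (o f) (o g) (o h) (o i) (o j) (chi _ _ _) (chi _ _ _).
  move=> e' f' g' h' i' j' x y.
  have CA u v w t : sgmul u (sgmul v (sgmul w t)) = sgmul (sgmul u (sgmul v w)) t by rewrite !sgmulA.
  rewrite (CA e' f' g' y) (CA h' i' j' x) (CA h' i' j' (sgmul e' _)).
  move: (sgmul e' _) (sgmul h' _) => m n.
  by case: m; case: n; case: x; case: y.
have CA x y z : sgmul x (sgmul y z) = sgmul y (sgmul x z).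
  by rewrite !sgmulA [sgmul x y]sgmulC.
have scale t1 t2 t3 t4 : balanced false false [:: t1; sgopp t2; t3; sgopp t4] ->
    balanced false false [:: sgmul K t1; sgopp (sgmul K t2); sgmul K t3; sgopp (sgmul K t4)].
  by case: K => //; case: t1; case: t2; case: t3; case: t4.
have := scale _ _ _ _ (chi_gp4 chiP p.1 q.1 a.1 b.1 c.1 d.1).
rewrite !prodX (CA (o b) (o a)) (CA (o c) (o a)) (CA (o c) (o b)).
rewrite (CA (o d) (o a)) (CA (o d) (o b)) (sgmulC (o d) (o c)) -!/K; exact.
Qed.

(** [Not Tru] stands for the goal [False], which is not a boolean. *)
Definition holds (v : nat -> nat -> nat -> sg) (c : fml) : Prop :=
  if c is Not Tru then False else fval v c.

Lemma X_solve (x : nat -> oline) n hs c :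
  decide (GP3s n ++ GP4s n) hs c n ->
  let v i j k := osign (x i) (x j) (x k) in
  foldr (fun h P => fval v h -> P) (holds v c) hs.
Proof.
move=> D v; suff: foldr (fun h P => fval v h -> P) (is_true (fval v c)) hs.
  elim: {D} hs => [|h hs IH] /=; last by move=> H /H.
  by rewrite /holds; case: c => // -[].
apply: (decide_sound _ _ _ D) => [i j k|i j k|i j|].
- exact: X12.
- exact: X23.
- exact: Xrr.
rewrite all_cat; apply/andP; split; apply: all_flatten_map => s; apply: all_mapT => t;
  exact: X_gp4.
Qed.

(** Distinctness of two lines cannot be expressed in a sign problem; where an argument needs it,
    this lemma is added to the hypotheses by hand. *)
Lemma X_flat a b x y : a.1 != b.1 ->
  (osign a b x == Zer) && (osign a b y == Zer) -> osign a x y == Zer.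
Proof.
have o0 u z : (orient u z == Zer) = (z == Zer) by case: u; case: z.
by rewrite /osign !o0 => ab /andP[/eqP abx /eqP aby]; apply/eqP; apply: (chi_flat chiP ab).
Qed.

End Oriented.

(** * Reification of sign problems *)

Ltac ix es a :=
  lazymatch es with
  | cons ?b ?r =>
      lazymatch b with a => constr:(0) | _ => let n := ix r a in constr:(S n) end
  end.

Ltac reify_t es t :=
  lazymatch t with
  | osign _ ?a ?b ?c =>
      let i := ix es a in let j := ix es b in let k := ix es c in
      constr:(Tri i j k)
  | sgmul ?a ?b => let a := reify_t es a in let b := reify_t es b in constr:(Mul a b)
  | sgopp ?a => let a := reify_t es a in constr:(Opp a)
  | ?x => constr:(Cst x)
  end.

Ltac reify_f es t :=
  lazymatch t with
  | @eq_op _ ?a ?b => let a := reify_t es a in let b := reify_t es b in constr:(Eqt a b)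
  | false => constr:(Eqt (Cst Pos) (Cst Zer))
  | negb ?f => let f := reify_f es f in constr:(Not f)
  | andb ?f ?g => let f := reify_f es f in let g := reify_f es g in constr:(And f g)
  | orb ?f ?g => let f := reify_f es f in let g := reify_f es g in constr:(Or f g)
  | implb ?f ?g => let f := reify_f es f in let g := reify_f es g in constr:(Imp f g)
  end.

Ltac reify_goal es g :=
  lazymatch g with
  | is_true ?h -> ?g =>
      let h := reify_f es h in
      lazymatch reify_goal es g with (?hs, ?c) => constr:((cons h hs, c)) end
  | False => constr:((@nil fml, Not Tru))
  | is_true ?c => let c := reify_f es c in constr:((@nil fml, c))
  end.

(* Decides a goal [h1 -> ... -> hk -> c] about the signs of the triples of the
   oriented lines listed in [es]. *)
Ltac signs es :=
  rewrite ?(Xf1, Xf2, Xf3);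
  lazymatch goal with
  | chiP : chirotope ?chi |- ?g =>
      lazymatch reify_goal es g with
      | (?hs, ?c) =>
          let n := eval compute in (size es) in
          lazymatch es with
          | cons ?e _ => refine (@X_solve _ chi chiP (nth e es) n hs c _);
             vm_compute; exact (erefl true)
          end
      end
  end.

(** * Extreme vertices of an affine arrangement *)

Lemma exists_max (I : finType) (P : pred I) (r : rel I) :
  {in P &, total r} -> {in P & &, transitive r} -> (exists i, P i) ->
  exists2 i, P i & forall j, P j -> r i j.
Proof.
move=> tot tr [i0 Pi0].
suff [i Pi Hi] : exists2 i, P i & forall j, j \in enum P -> r i j.
  by exists i => // j Pj; apply: Hi; rewrite mem_enum.
have : {subset enum P <= P} by move=> j; rewrite mem_enum.
elim: (enum P) => [|j s IH] sP; first by exists i0.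
have [k sk|i Pi Hi] := IH; first by apply: sP; rewrite inE sk orbT.
have Pj : P j by apply: sP; rewrite inE eqxx.
have rjj : r j j by have := tot j j Pj Pj; rewrite orbb.
case/orP: (tot i j Pi Pj) => Hij.
  by exists i => // k; rewrite inE => /predU1P[->//|]; apply: Hi.
exists j => // k; rewrite inE => /predU1P[->//|sk].
by apply: tr Hij (Hi _ sk) => //; apply: sP; rewrite inE sk orbT.
Qed.

Section View.
Variables (T : finType) (chi : T -> T -> T -> sg).
Hypothesis chiP : chirotope chi.
Local Notation O := (oline T).
Local Notation X := (osign chi).

Variable l : O.

(* The side of [c] on which the point [p /\ q] lies, in the affine plane
   where [l] is the line at infinity (and is positive). *)
Definition vsign (p q c : O) : sg := sgmul (X p q c) (X p q l).

Variable F : {set T}.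

(* On the line [s], beyond [a /\ s] on the side where [a] is positive, there
   is no crossing with a line of [F]. *)
Definition ray (a s : O) : bool :=
  [forall c : O, (c.1 \in F) ==> (sgmul (X c s l) (X a s c) != Neg)].

(* The lines through [a /\ s] enter the sector where [a] and [s] are positive. *)
Definition fan (a s : O) : bool :=
  [forall c : O, (c.1 \in F) ==> (X a s c == Zer) ==> (sgmul (X c s l) (X a c l) != Pos)].

Definition good (a s : O) : bool :=
  [&& a.1 \in F, s.1 \in F, X a s l != Zer, ray a s & fan a s].

(* [a /\ s] is extreme among the vertices of [F]: the closed sector where [a]
   and [s] are positive contains no other vertex and is met by no line missing
   [a /\ s], and every line through [a /\ s] enters it. *)
Definition extreme (a s : O) : bool := good a s && ray s a.

(* [m] is nonnegative on the sector where [a], [s] are positive, and positive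
   at its apex. *)
Definition nnp (m a s : O) : bool :=
  [&& sgmul (X m s l) (X a s l) != Neg, sgmul (X a m l) (X a s l) != Neg &
      vsign a s m == Pos].

(** By Cramer's rule [x], [y], [z] are the signs of the coefficients of [c] along [a], [s], [l].
    Both signs occur exactly when [c] enters the open sector where [a] and [s] are positive. *)
Definition cuts (a s c : O) : bool :=
  let x := sgmul (X c s l) (X a s l) in
  let y := sgmul (X a c l) (X a s l) in
  let z := vsign a s c in
  ((x == Pos) || (y == Pos) || (z == Pos)) && ((x == Neg) || (y == Neg) || (z == Neg)).

Lemma rayP a s c : ray a s -> c.1 \in F -> sgmul (X c s l) (X a s c) != Neg.
Proof. by move=> /forallP/(_ c)/implyP. Qed.

Lemma fanP a s c : fan a s -> c.1 \in F -> X a s c == Zer -> sgmul (X c s l) (X a c l) != Pos.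
Proof. by move=> /forallP/(_ c)/implyP H /H/implyP. Qed.

(* [beyond a c d]: on the line [a], whose positive ends are those where [c] and
   [d] are positive, [c] crosses after [d], or at the same point and then [c]
   is farther from [a] at infinity. *)
Definition beyond (a c d : O) : bool :=
  let x := sgmul (X c a d) (X c a l) in
  (x == Pos) || ((x == Zer) && (sgmul (X c d l) (X c a l) != Pos)).

(** A common sign of [X c s l] means that all these lines are positive towards the same end of [s];
    this makes [beyond s] total and transitive. *)
Lemma exists_last (P : pred O) (s : O) (e : sg) : e != Zer ->
  (exists c, P c) -> (forall c, P c -> X c s l = e) ->
  exists2 k, P k & forall c, P c -> beyond s k c.
Proof.
move=> ne exP Pe; apply: exists_max => //.
- move=> c d Pc Pd; have /eqP := Pe c Pc; have /eqP := Pe d Pd.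
  rewrite /beyond; case: e ne {Pe} => // _; signs [:: c; d; s; l].
- move=> d c b Pd Pc Pb; have /eqP := Pe c Pc; have /eqP := Pe d Pd.
  have /eqP := Pe b Pb; rewrite /beyond; case: e ne {Pe} => // _.
  + signs [:: b; c; d; s; l].
  + signs [:: b; c; d; s; l].
Qed.

(** A line of [F] that violates [ray] or [fan] at [k /\ s] belongs to [P] once it is oriented like
    [k] at infinity, and contradicts the maximality of [k]. *)
Lemma last_good (P : pred O) (s k : O) : X k s l != Zer ->
    s.1 \in F -> k.1 \in F ->
    (forall c, P c -> beyond s k c) ->
    (forall c, c.1 \in F -> X c s l == X k s l -> sgmul (X c s l) (X k s c) != Pos -> P c) ->
  good k s.
Proof.
move=> nks Fs Fk kmax HP; rewrite /good Fs Fk nks /=.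
have HB c : c.1 \in F -> X c s l == X k s l -> sgmul (X c s l) (X k s c) != Pos ->
    beyond s k c by move=> *; apply: kmax; apply: HP.
apply/andP; split; apply/forallP => c; apply/implyP => Fc.
(* Which orientation of [c] agrees with [k] at infinity is unknown, so both are tried. *)
- have := HB c Fc; have := HB (flip c) Fc; rewrite /beyond.
  move: (nks) => {}nks H1 H2.
  have {}H1 : (X (flip c) s l == X k s l) ==> (sgmul (X (flip c) s l) (X k s (flip c)) != Pos) ==> beyond s k (flip c).
    by apply/implyP => h; apply/implyP; apply: H1.
  have {}H2 : (X c s l == X k s l) ==> (sgmul (X c s l) (X k s c) != Pos) ==> beyond s k c.
    by apply/implyP => h; apply/implyP; apply: H2.
  move: nks H1 H2; rewrite /beyond; signs [:: k; s; c; l].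
- have H1 : (X (flip c) s l == X k s l) ==> (sgmul (X (flip c) s l) (X k s (flip c)) != Pos) ==> beyond s k (flip c).
    by apply/implyP => h; apply/implyP; apply: HB.
  have H2 : (X c s l == X k s l) ==> (sgmul (X c s l) (X k s c) != Pos) ==> beyond s k c.
    by apply/implyP => h; apply/implyP; apply: HB.
  apply/implyP; move: nks H1 H2; rewrite /beyond; signs [:: k; s; c; l].
Qed.

(** Walk along [s] towards the end where [d] is positive, up to the last vertex. *)
Lemma start (s d : O) : s.1 \in F -> d.1 \in F -> X d s l != Zer ->
  exists2 k, good k s & (X k s l == X d s l) && (vsign k s d != Neg).
Proof.
move=> Fs Fd nds.
have [|c /andP[_ /eqP] //|k /andP[Fk /eqP Ek] kmax] :=
  @exists_last (fun c => (c.1 \in F) && (X c s l == X d s l)) s (X d s l) nds.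
  by exists d; rewrite Fd eqxx.
have gks : good k s.
  apply: (last_good _ Fs Fk kmax); first by rewrite Ek.
  by move=> c Fc /eqP Ec _; rewrite Fc Ec Ek eqxx.
exists k => //; rewrite Ek eqxx /=.
have := rayP (proj1 (andP (proj2 (andP (proj2 (andP (proj2 (andP gks)))))))) Fd.
move: nds; have /eqP := Ek; rewrite /vsign; signs [:: k; s; d; l].
Qed.

(** Some line crosses [a] beyond [a /\ s], where [s] is positive. The sector at the last such
    crossing [k /\ a] lies inside the old one, and fewer lines cut it, since [k] no longer does. *)
Lemma step (a s : O) : good a s -> ~~ ray s a ->
  exists k, [/\ good k a,
    forall c, cuts k a c -> cuts a s c, cuts a s k && ~~ cuts k a k &
    [/\ nnp s k a & forall m, nnp m a s -> nnp m k a]].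
Proof.
move=> gas; have /and5P[Fa Fs nas ras fas] := gas.
pose P (c : O) := [&& c.1 \in F, X a c l == X a s l & sgmul (X c a l) (X s a c) == Neg].
rewrite negb_forall => /existsP[c0]; rewrite negb_imply negbK => /andP[Fc0 nc0].
have [||c|k /and3P[Fk Ek nk] kmax] := @exists_last P a (sgopp (X a s l)).
- by case: (X a s l) nas.
- have : (X a c0 l == X a s l) || (X a (flip c0) l == X a s l).
    by move: nas nc0; signs [:: a; s; c0; l].
  case/orP=> E; first by exists c0; rewrite /P Fc0 E nc0.
  by exists (flip c0); rewrite /P Fc0 E Xf1 Xf3 sgopp_mull sgopp_mulr sgoppK nc0.
- by case/and3P=> _ /eqP <- _; rewrite X12 // sgoppK.
have nka : X k a l != Zer by move: nas Ek; signs [:: a; s; k; l].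
have gka : good k a.
  apply: (last_good nka Fa Fk kmax) => c Fc Ec; rewrite /P Fc /=.
  have := rayP ras Fc; have := rayP ras Fk.
  move: nas Ek nk Ec; signs [:: a; s; k; c; l].
exists k; split=> //.
- move=> c; have := rayP ras Fk; move: nas Ek nk; rewrite /cuts /vsign.
  signs [:: a; s; k; c; l].
- have := rayP ras Fk; move: nas Ek nk; rewrite /cuts /vsign; signs [:: a; s; k; l].
- split.
    have := rayP ras Fk; move: nas Ek nk; rewrite /nnp /vsign; signs [:: a; s; k; l].
  move=> m; have := rayP ras Fk; move: nas Ek nk; rewrite /nnp /vsign.
  signs [:: a; s; k; m; l].
Qed.

(** Iterates [step]; the number of cutting lines decreases. As the sectors are nested, a line that
    is nonnegative on the initial sector stays so, which locates the extreme vertex found. *)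
Lemma ext_in (a s : O) : good a s ->
  exists p q, [/\ extreme p q, (p, q) = (a, s) \/ nnp s p q &
    forall m, nnp m a s -> nnp m p q].
Proof.
move: {2}#|_| (leqnn #|[set c | cuts a s c]|) => n.
elim: n a s => [|n IH] a s Hn gas; have [ras|nras] := boolP (ray s a).
- by exists a, s; rewrite /extreme gas ras; split; auto.
- have [k [_ _ /andP[ck _] _]] := step gas nras.
  by move: Hn; rewrite leqn0 cards_eq0 => /eqP/setP/(_ k); rewrite !inE ck.
- by exists a, s; rewrite /extreme gas ras; split; auto.
have [k [gka ck /andP[ck1 ck2] [sk mk]]] := step gas nras.
have {}Hn : #|[set c | cuts k a c]| <= n.
  rewrite -ltnS (leq_trans _ Hn) //; apply: proper_card; apply/properP; split.
    by apply/subsetP => c; rewrite !inE; apply: ck.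
  by exists k; rewrite inE.
have [p [q [epq Hpq mpq]]] := IH _ _ Hn gka.
exists p, q; split=> // [|m /mk /mpq //].
by case: Hpq => [[-> ->]|_]; right => //; apply: mpq.
Qed.

Lemma extC p q : extreme p q = extreme q p.
Proof.
suff H a b : extreme a b -> extreme b a by apply/idP/idP; apply: H.
rewrite /extreme /good => /andP[/and5P[Fa Fb nab rab fab] rba].
rewrite Fa Fb rab rba; have -> : X b a l != Zer by move: nab; signs [:: a; b; l].
rewrite /= andbT; apply/forallP => c; apply/implyP => Fc.
have := fanP fab Fc; move/implyP; signs [:: a; b; c; l].
Qed.

Lemma extE p q : extreme p q ->
  [/\ p.1 \in F, q.1 \in F, X p q l != Zer, ray p q & ray q p /\ fan p q].
Proof. by case/andP=> /and5P[]. Qed.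

(* An extreme sector contains no other vertex. *)
Lemma ext_sector a b p q : extreme a b -> p.1 \in F -> q.1 \in F -> X p q l != Zer ->
  vsign p q a != Neg -> vsign p q b != Neg -> (vsign p q a == Zer) && (vsign p q b == Zer).
Proof.
move=> /extE[Fa Fb nab rab [rba fab]] Fp Fq.
have := rayP rab Fp; have := rayP rab Fq; have := rayP rba Fp; have := rayP rba Fq.
have := fanP fab Fp; have := fanP fab Fq; move=> /implyP + /implyP.
move: nab; rewrite /vsign; signs [:: a; b; p; q; l].
Qed.

(** Walk along [b] to its other end, where [a] is negative because [d] crosses [b] away from
    [a /\ b], and descend from there with [ext_in]. The vertex reached keeps [b] nonnegative, and
    [ext_sector] keeps it out of the sector of [a /\ b]. *)
Lemma two_more a b d : extreme a b -> d.1 \in F -> X a b d != Zer -> X d b l != Zer ->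
  exists p q, [/\ extreme p q, vsign p q b != Neg & vsign p q a == Neg].
Proof.
move=> eab Fd nd ndb; have [Fa Fb nab rab [rba fab]] := extE eab.
have [|k gkb /andP[Ek]] := @start b (flip a) Fb Fa.
  by move: nab; signs [:: a; b; l].
have rkb : ray k b by case/and5P: gkb.
move=> Hk.
have kb_a : (vsign k b a == Neg) && (vsign k b b == Zer).
  have := rayP rkb Fd; have := rayP rab Fd; move: nd ndb Ek nab Hk.
  rewrite /vsign; signs [:: a; b; k; d; l].
have [p [q [epq Hpq _]]] := ext_in gkb.
case: Hpq => [[Ep Eq]|/and3P[_ _ Hb]].
  by exists k, b; rewrite -{1}Ep -{1}Eq; case/andP: kb_a => -> /eqP ->.
exists p, q; split=> //; first by rewrite (eqP Hb).
have [Fp Fq npq _ _] := extE epq.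
have := ext_sector eab Fp Fq npq.
by rewrite (eqP Hb) andbF; case: (vsign p q a) => // /(_ isT isT).
Qed.

Hypothesis lF : l.1 \notin F.

(* The inner lines of an extreme point have no parallel. *)
Lemma ext_middle a b c d : extreme a b -> c.1 \in F -> d.1 \in F ->
  X a b c = Zer -> c.1 != a.1 -> c.1 != b.1 -> X c d l = Zer -> d.1 = c.1.
Proof.
move=> /extE[Fa Fb nab rab [rba fab]] Fc Fd /eqP abc ca cb /eqP cdl.
apply: contraTeq nab => dc; rewrite negbK.
have := rayP rab Fd; have := rayP rba Fd; have := fanP fab Fc abc.
have ac : a.1 != c.1 by rewrite eq_sym.
have ld : l.1 != d.1 by apply: contraNneq lF => ->.
have := X_flat chiP (x := a) (y := b) ld.
have cd : c.1 != d.1 by rewrite eq_sym.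
have bc : b.1 != c.1 by rewrite eq_sym.
have := X_flat chiP (x := a) (y := l) bc.
have := X_flat chiP (x := b) (y := l) ac; have := X_flat chiP (x := l) (y := a) cd.
by move: abc cdl => + + /implyP + /implyP + /implyP + /implyP; signs [:: a; b; c; d; l].
Qed.

End View.

(** * Ordinary extreme vertices: two or three of them when mu is small *)

Section View2.
Variables (T : finType) (chi : T -> T -> T -> sg).
Hypothesis chiP : chirotope chi.
Local Notation O := (oline T).
Local Notation X := (osign chi).
Variable l : O.
Local Notation at_ := (vsign chi l).
Variable F : {set T}.
Local Notation ext := (extreme chi l F).
Hypothesis lF : l.1 \notin F.

Lemma same_line (a b : O) : a.1 = b.1 -> a = b \/ a = flip b.
Proof. by case: a b => [a s] [b t] /= ->; case: s; case: t; auto. Qed.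

(** Swapping or flipping the lines of a point changes the sign of both factors of [vsign]. *)
Lemma at_pair p q p' q' c : [set p.1; q.1] = [set p'.1; q'.1] -> at_ p q c = at_ p' q' c.
Proof.
have fl := same_line.
have E (a b a' b' : O) : a.1 = a'.1 -> b.1 = b'.1 -> at_ a b c = at_ a' b' c.
  by move=> /fl[]-> /fl[]->; rewrite /vsign ?(Xf1, Xf2) ?(sgopp_mull, sgopp_mulr, sgoppK).
have sw a b : at_ a b c = at_ b a c.
  by rewrite /vsign (X12 chiP b a) (X12 chiP b a l) sgopp_mull sgopp_mulr sgoppK.
move=> Es.
have Hp : p.1 \in [set p'.1; q'.1] by rewrite -Es set21.
have Hq : q.1 \in [set p'.1; q'.1] by rewrite -Es set22.
have Hp' : p'.1 \in [set p.1; q.1] by rewrite Es set21.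
have Hq' : q'.1 \in [set p.1; q.1] by rewrite Es set22.
move: Hp Hq Hp' Hq'; rewrite !inE.
do 4![case/orP=> /eqP ?]; by [apply: E; congruence | rewrite sw; apply: E; congruence].
Qed.

(** When [F] consists of all lines but [l], this means that [c] meets [l] in an ordinary point. *)
Definition lone (c : O) : bool :=
  [forall d : O, (d.1 \in F) ==> (X c d l == Zer) ==> (d.1 == c.1)].

Definition oextreme (a b : O) : bool :=
  ext a b && [forall c : O, (c.1 \in F) ==> (X a b c == Zer) ==> (c.1 == a.1) || (c.1 == b.1)].

Lemma ext_alone (a b c : O) : ext a b -> c.1 \in F -> X a b c == Zer ->
  c.1 != a.1 -> c.1 != b.1 -> lone c.
Proof.
move=> eab Fc /eqP abc ca cb; apply/forallP => d; apply/implyP => Fd; apply/implyP => /eqP cdl.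
by apply/eqP; apply: (ext_middle chiP lF eab Fc Fd abc ca cb cdl).
Qed.

Lemma alone1 (c d : O) : c.1 = d.1 -> lone c = lone d.
Proof.
case/same_line=> -> //; apply: eq_forallb => e /=.
by rewrite Xf1; case: (X d e l).
Qed.

Lemma neqF (a : O) : a.1 \in F -> l.1 != a.1.
Proof. by apply: contraTneq => <-. Qed.

(** A parallel of [a] misses [a /\ b] and is not parallel to [b], so it can serve as the line [d] of
    [two_more]. *)
Lemma two_more_alone (a b : O) : ext a b -> ~~ lone a ->
  exists p q, [/\ ext p q, at_ p q b != Neg & at_ p q a == Neg].
Proof.
move=> eab; rewrite negb_forall => /existsP[d].
rewrite !negb_imply => /and3P[Fd adl da].
have [Fa Fb nab _ _] := extE eab.
have ld := neqF Fd; have ad : a.1 != d.1 by rewrite eq_sym.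
have := X_flat chiP (x := b) (y := l) ad; have := X_flat chiP (x := a) (y := b) ld.
move=> /implyP H1 /implyP H2.
by apply: (two_more chiP eab Fd); move: H1 H2 adl nab; signs [:: a; b; d; l].
Qed.

(* Oppositely placed extreme points on either side of an inside line. *)
Lemma middle_sides (a b c p q : O) : ext a b -> c.1 \in F -> X a b c == Zer ->
  c.1 != a.1 -> c.1 != b.1 -> X p q l != Zer ->
  at_ p q b != Neg -> at_ p q a == Neg ->
  at_ p q c == sgmul Neg (sgmul (X c b l) (X a b l)).
Proof.
move=> eab Fc abc ca cb; have [Fa Fb nab _ [_ fab]] := extE eab.
have := fanP fab Fc; move=> /implyP.
have ac : a.1 != c.1 by rewrite eq_sym.
have bc : b.1 != c.1 by rewrite eq_sym.
have := X_flat chiP (x := a) (y := l) bc; have := X_flat chiP (x := b) (y := l) ac.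
move=> /implyP + /implyP.
by move: nab abc; rewrite /vsign; signs [:: a; b; c; l; p; q].
Qed.

Definition inside (a b c : O) : bool :=
  [&& c.1 \in F, X a b c == Zer, c.1 != a.1 & c.1 != b.1].

Lemma oextN (a b : O) : ext a b -> ~~ oextreme a b -> exists c, inside a b c.
Proof.
move=> eab; rewrite /oextreme eab /= negb_forall => /existsP[c].
by rewrite !negb_imply negb_or => H; exists c.
Qed.

Lemma inner_alone (a b c : O) : ext a b -> inside a b c -> lone c.
Proof. by move=> eab /and4P[? ? ? ?]; apply: ext_alone eab _ _ _ _. Qed.

Lemma extC' (a b : O) : ext a b -> ext b a.
Proof. by rewrite (extC chiP). Qed.

Lemma ext_at (a b c : O) : ext a b -> (at_ a b c == Zer) = (X a b c == Zer).
Proof.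
move=> /extE[_ _ nab _ _]; apply/idP/idP; rewrite /vsign.
all: by move: nab; case: (X a b l); case: (X a b c).
Qed.

(** By [fan], the inner line [c] is a combination of [a] and [b] with coefficients of opposite
    signs, both nonzero; hence it has a definite nonzero sign where [a] is negative and [b]
    nonnegative. *)
Lemma inner_side (a b c p q : O) : ext a b -> inside a b c -> X p q l != Zer ->
  at_ p q b != Neg -> at_ p q a == Neg ->
  (at_ p q c == sgmul Neg (sgmul (X c b l) (X a b l))) && (at_ p q c != Zer).
Proof.
move=> eab /and4P[Fc abc ca cb] npq Hb Ha.
rewrite (middle_sides eab Fc abc ca cb npq Hb Ha) /=.
have := middle_sides eab Fc abc ca cb npq Hb Ha.
have bc : b.1 != c.1 by rewrite eq_sym.
have [_ _ nab _ _] := extE eab.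
have := X_flat chiP (x := a) (y := l) bc => /implyP.
by move: nab abc; rewrite /vsign; signs [:: a; b; c; l; p; q].
Qed.

Lemma pair_neq (p q p' q' a : O) : at_ p q a == Neg -> at_ p' q' a != Neg ->
  [set p.1; q.1] != [set p'.1; q'.1].
Proof. by move=> Ha Ha'; apply: contraNneq Ha' => /at_pair <-. Qed.

(** An inner line is lone, hence equal to [x], so [a] and [b] are not lone and both have extreme
    vertices on their negative sides. These lie off [x]; an inner line there would again be [x], so
    they are ordinary. *)
Lemma inner_two_oext x (a b c : O) :
  (forall d : O, d.1 \in F -> lone d -> d.1 = x) -> ext a b -> inside a b c ->
  exists p q p' q', [/\ oextreme p q, oextreme p' q' & [set p.1; q.1] != [set p'.1; q'.1]].
Proof.
move=> Hx eab iabc; have [Fa Fb nab _ _] := extE eab.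
have /and4P[Fc abc ca cb] := iabc.
have cx : c.1 = x by apply: Hx => //; apply: inner_alone eab _.
have na : ~~ lone a by apply/negP => /(Hx _ Fa) ax; rewrite cx ax eqxx in ca.
have nb : ~~ lone b by apply/negP => /(Hx _ Fb) bx; rewrite cx bx eqxx in cb.
have ibac : inside b a c.
  by rewrite /inside Fc ca cb !andbT /=; have := abc; signs [:: a; b; c].
have [p [q [epq Hb Ha]]] := two_more_alone eab na.
have [p' [q' [epq' Ha' Hb']]] := two_more_alone (extC' eab) nb.
have [Fp Fq npq _ _] := extE epq; have [Fp' Fq' npq' _ _] := extE epq'.
have ord u v : ext u v -> at_ u v c != Zer -> oextreme u v.
  move=> euv nc; apply: contraNT nc => /(oextN euv)[d iuvd].
  have /and4P[Fd uvd _ _] := iuvd.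
  have dx := Hx _ Fd (inner_alone euv iuvd).
  rewrite ext_at //; have [->|->] := same_line (etrans cx (esym dx)) => //.
  by move: uvd; signs [:: u; v; d].
exists p, q, p', q'; split.
- by apply: ord => //; have /andP[] := inner_side eab iabc npq Hb Ha.
- by apply: ord => //; have /andP[] := inner_side (extC' eab) ibac npq' Ha' Hb'.
- exact: pair_neq Ha Ha'.
Qed.

(** If [a /\ b] is ordinary, one of its lines is not lone and leads to a second extreme vertex. Any
    extreme vertex met on the way that is not ordinary yields two ordinary ones by
    [inner_two_oext]. *)
Lemma two_oext x (a b : O) :
  (forall d : O, d.1 \in F -> lone d -> d.1 = x) -> ext a b ->
  exists p q p' q', [/\ oextreme p q, oextreme p' q' & [set p.1; q.1] != [set p'.1; q'.1]].
Proof.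
move=> Hx eab; have [oab|/(oextN eab)[c]] := boolP (oextreme a b); last exact: inner_two_oext Hx eab.
suff H u v : oextreme u v -> ~~ lone u ->
    exists p q p' q', [/\ oextreme p q, oextreme p' q' & [set p.1; q.1] != [set p'.1; q'.1]].
  have [Fa Fb nab _ _] := extE eab.
  have [/(Hx _ Fa) ax|] := boolP (lone a); last exact: H oab.
  have [/(Hx _ Fb) bx|] := boolP (lone b).
    by move: nab; case: (same_line (etrans ax (esym bx))) => ->; rewrite ?Xf1 (Xrr chiP).
  apply: (H b a); rewrite /oextreme (extC' eab) /=; apply/forallP => c; apply/implyP => Fc.
  apply/implyP => bac; move/andP: oab => [_ /forallP/(_ c)].
  rewrite Fc orbC /= => /implyP; apply.
  by move: bac; signs [:: a; b; c].
move=> ouv nu; have /andP[euv _] := ouv.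
have [p [q [epq Hb Ha]]] := two_more_alone euv nu.
have [opq|/(oextN epq)[c]] := boolP (oextreme p q); last exact: inner_two_oext Hx epq.
exists p, q, u, v; split=> //; apply: pair_neq Ha _.
by rewrite /vsign; signs [:: u; v; l].
Qed.

(** Without lone lines there are no inner lines, so every extreme vertex is ordinary. The three
    vertices differ in the signs of [a] and [b]. *)
Lemma three_oext (a b : O) : (forall d : O, d.1 \in F -> ~~ lone d) -> ext a b ->
  exists p q p' q', [/\ oextreme a b, oextreme p q, oextreme p' q' &
    [/\ [set a.1; b.1] != [set p.1; q.1], [set a.1; b.1] != [set p'.1; q'.1] &
     [set p.1; q.1] != [set p'.1; q'.1]]].
Proof.
move=> Hx eab.
have ord u v : ext u v -> oextreme u v.
  move=> euv; apply/negPn/negP => /(oextN euv)[d iuvd].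
  by have /and4P[Fd _ _ _] := iuvd; have := Hx _ Fd; rewrite (inner_alone euv iuvd).
have [Fa Fb nab _ _] := extE eab.
have [p [q [epq Hb Ha]]] := two_more_alone eab (Hx _ Fa).
have [p' [q' [epq' Ha' Hb']]] := two_more_alone (extC' eab) (Hx _ Fb).
exists p, q, p', q'; split; try exact: ord.
split; last exact: pair_neq Ha Ha'.
- by rewrite eq_sym; apply: pair_neq Ha _; rewrite /vsign; signs [:: a; b; l].
- by rewrite eq_sym; apply: pair_neq Hb' _; rewrite /vsign; signs [:: a; b; l].
Qed.

Lemma ext_exists (a b : O) : a.1 \in F -> b.1 \in F -> X a b l != Zer ->
  exists p q, ext p q.
Proof.
move=> Fa Fb nab; have [k gkb _] := start chiP Fb Fa nab.
by have [p [q [? _ _]]] := ext_in chiP gkb; exists p, q.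
Qed.

End View2.

(** * Lines with exactly two ordinary points *)

Section TwoZero.
Variables (T : finType) (chi : T -> T -> T -> sg).
Hypothesis chiP : chirotope chi.
Local Notation O := (oline T).
Local Notation X := (osign chi).
Variable l : O.
Local Notation at_ := (vsign chi l).
Variable F : {set T}.
Local Notation ext := (extreme chi l F).
Local Notation oext := (oextreme chi l F).
Local Notation inner := (inside chi F).
Local Notation alone := (lone chi l F).
Hypothesis lF : l.1 \notin F.

Lemma inner1 (a b c d : O) : c.1 = d.1 -> inner a b c = inner a b d.
Proof.
by move=> E; rewrite /inside E; case: (same_line E) => ->//; rewrite Xf3; case: (X a b d).
Qed.

Lemma at1 (a b c d : O) : c.1 = d.1 -> (at_ a b c == Zer) = (at_ a b d == Zer).
Proof.
case/same_line=> -> //; rewrite /vsign Xf3.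
by case: (X a b d); case: (X a b l).
Qed.

Lemma innerC (a b c : O) : inner a b c -> inner b a c.
Proof.
case/and4P=> Fc abc ca cb; rewrite /inside Fc ca cb !andbT /=.
by move: abc; signs [:: a; b; c].
Qed.

Lemma inner_at (a b c : O) : inner a b c -> at_ a b c == Zer.
Proof. by case/and4P=> _ /eqP E _ _; rewrite /vsign E. Qed.

(** The vertices obtained by leaving [a /\ b] along [b] and along [a] lie on opposite sides of the
    inner line [c]. *)
Lemma sides (a b c : O) (e : sg) : ext a b -> inner a b c -> ~~ alone a -> ~~ alone b ->
  e != Zer -> exists p q, ext p q /\ at_ p q c == e.
Proof.
move=> eab iabc na nb ne.
have [p [q [epq Hb Ha]]] := two_more_alone chiP lF eab na.
have [p' [q' [epq' Ha' Hb']]] := two_more_alone chiP lF (extC' chiP eab) nb.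
have [Fp Fq npq _ _] := extE epq; have [Fp' Fq' npq' _ _] := extE epq'.
have [Fa Fb nab _ [_ fab]] := extE eab.
have [Fc abc _ _] := and4P iabc.
have /andP[E1 N1] := inner_side chiP eab iabc npq Hb Ha.
have /andP[E2 N2] := inner_side chiP (extC' chiP eab) (innerC iabc) npq' Ha' Hb'.
have : sgmul (X c b l) (X a c l) != Pos := fanP fab Fc abc.
have -> : X a c l = sgopp (X c a l) by rewrite (X12 chiP).
move: ne E1 N1 E2 N2; rewrite (X12 chiP a b) => ne E1 N1 E2 N2 Hf.
case: (boolP (at_ p q c == e)) => [|Ne]; first by exists p, q.
exists p', q'; split=> //; move: ne E1 N1 E2 N2 Hf Ne nab.
by case: e; case: (at_ p q c); case: (at_ p' q' c); case: (X c b l); case: (X c a l); case: (X a b l).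
Qed.

Variables x y : O.
Hypotheses (Fx : x.1 \in F) (Fy : y.1 \in F) (ax : alone x) (ay : alone y) (xy : x.1 != y.1).
Hypothesis only : forall d : O, d.1 \in F -> alone d -> (d.1 == x.1) || (d.1 == y.1).
Hypothesis none : forall a b : O, ~~ oext a b.

Lemma has_inner (a b : O) : ext a b -> inner a b x || inner a b y.
Proof.
move=> eab; have [c iabc] := oextN eab (none a b).
have /and4P[Fc _ _ _] := iabc.
case/orP: (only Fc (inner_alone chiP lF eab iabc)) => /eqP E.
  by rewrite -(inner1 a b E) iabc.
by rewrite -(inner1 a b E) iabc orbT.
Qed.

(** Otherwise [two_more_alone] gives an extreme vertex off both [x] and [y], against [has_inner]. *)
Lemma not_both (a b : O) : ext a b -> inner a b x -> inner a b y -> False.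
Proof.
move=> eab ix iy; have [Fa Fb nab _ _] := extE eab.
have na : ~~ alone a.
  apply/negP => /(only Fa); case/and4P: ix => _ _ xa _; case/and4P: iy => _ _ yb _.
  by rewrite ![a.1 == _]eq_sym (negPf xa) (negPf yb).
have [p [q [epq Hb Ha]]] := two_more_alone chiP lF eab na.
have [_ _ npq _ _] := extE epq.
have /andP[_ Nx] := inner_side chiP eab ix npq Hb Ha.
have /andP[_ Ny] := inner_side chiP eab iy npq Hb Ha.
by case/orP: (has_inner epq) => /inner_at; rewrite ?(negPf Nx) ?(negPf Ny).
Qed.
End TwoZero.

Section TwoZero2.
Variables (T : finType) (chi : T -> T -> T -> sg).
Hypothesis chiP : chirotope chi.
Local Notation O := (oline T).
Local Notation X := (osign chi).
Variable l : O.
Local Notation at_ := (vsign chi l).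
Variable F : {set T}.

(* [l] meets exactly two lines [x], [y] in ordinary points, and no ordinary
   point is attached to [l]. *)
Definition two_zero (x y : O) : Prop :=
  [/\ l.1 \notin F, [/\ x.1 \in F, y.1 \in F & x.1 != y.1],
   lone chi l F x /\ lone chi l F y,
   forall d : O, d.1 \in F -> lone chi l F d -> (d.1 == x.1) || (d.1 == y.1) &
   forall a b : O, ~~ oextreme chi l F a b].

Local Notation ext := (extreme chi l F).
Local Notation oext := (oextreme chi l F).
Local Notation inner := (inside chi F).
Local Notation alone := (lone chi l F).

Lemma two_zeroC x y : two_zero x y -> two_zero y x.
Proof.
case=> lF [Fx Fy xy] [ax ay] only none; split=> //; first by rewrite eq_sym.
by move=> d Fd ad; rewrite orbC; apply: only.
Qed.

Lemma tz_inner x y a b : two_zero x y -> ext a b -> inner a b x || inner a b y.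
Proof. by case=> lF [Fx Fy xy] [ax ay] only none; apply: has_inner. Qed.

(** Suppose [a] were [y]. The extreme vertex on the negative side of [b] is off [x], so [y] is inner
    there, and there is an extreme vertex with [y] positive, which must lie on [x]. *)
Lemma outer_neq x y a b : two_zero x y -> ext a b -> inner a b x -> a.1 != y.1.
Proof.
move=> tz eab ix; apply/negP => /eqP Ea.
have [lF [Fx Fy xy] [ax ay] only none] := tz.
have /and4P[_ abx xa xb] := ix.
have [Fa Fb nab _ [_ fab]] := extE eab.
have nb : ~~ alone b.
  apply/negP => /(only _ Fb); rewrite eq_sym (negPf xb) /= -Ea => /eqP E.
  by move: nab; case: (same_line E) => ->; rewrite ?Xf2 (Xrr chiP).
have [p [q [epq Ha Hb]]] := two_more_alone chiP lF (extC' chiP eab) nb.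
have [Fp Fq npq _ _] := extE epq.
have /andP[_ Nx] := inner_side chiP (extC' chiP eab) (innerC chiP ix) npq Ha Hb.
have iy : inner p q y.
  by case/orP: (tz_inner tz epq) => // /(inner_at l); rewrite (negPf Nx).
have xpq : (x.1 != p.1) && (x.1 != q.1).
  apply/andP; split; apply: contraNneq Nx => E; rewrite (at1 chi l p q E) /vsign;
    signs [:: p; q; l].
have /andP[xp xq] := xpq.
have /and4P[_ _ yp yq] := iy.
have np : ~~ alone p by apply/negP => /(only _ Fp); rewrite ![p.1 == _]eq_sym (negPf xp) (negPf yp).
have nq : ~~ alone q by apply/negP => /(only _ Fq); rewrite ![q.1 == _]eq_sym (negPf xq) (negPf yq).
have iap : inner p q a by rewrite (inner1 chi F p q Ea).
have [u [v [euv Hu]]] := sides chiP lF epq iap np nq (isT : Pos != Zer).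
have [Fu Fv nuv _ _] := extE euv.
have Hx : at_ u v x == Zer.
  case/orP: (tz_inner tz euv) => /(inner_at l) // Hy.
  by move: Hu; rewrite (at1 chi l u v (esym Ea)) in Hy; rewrite (eqP Hy).

(* As [x] combines [a] and [b] with opposite signs and vanishes at [u /\ v], [b] is positive there
   together with [a]: the vertex lies in the sector of [a /\ b]. *)
have Hbu := ext_sector chiP eab Fu Fv nuv.
have ax' : a.1 != x.1 by rewrite eq_sym.
have bx' : b.1 != x.1 by rewrite eq_sym.
have := X_flat chiP (x := a) (y := l) bx'; have := X_flat chiP (x := b) (y := l) ax'.
have := fanP fab Fx.
have {}Hbu : (at_ u v a != Neg) ==> (at_ u v b != Neg) ==> (at_ u v a == Zer) && (at_ u v b == Zer).
  by apply/implyP => h1; apply/implyP => h2; apply: Hbu.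
move=> /implyP + /implyP + /implyP; move: Hbu abx nab nuv Hx Hu; rewrite /vsign; signs [:: a; b; x; l; u; v].
Qed.

Lemma inner_unique x y a b c : two_zero x y -> ext a b -> inner a b x -> inner a b c -> c.1 = x.1.
Proof.
move=> tz eab ix ic; have [lF [Fx Fy xy] [ax ay] only none] := tz.
have /and4P[Fc _ _ _] := ic.
case/orP: (only _ Fc (inner_alone chiP lF eab ic)) => /eqP // E.
case: (not_both chiP lF only none eab ix).
by rewrite -(inner1 chi F a b E).
Qed.

Lemma outer_alone x y a b : two_zero x y -> ext a b -> inner a b x -> ~~ alone a.
Proof.
move=> tz eab ix; have [lF _ _ only _] := tz; have [Fa Fb nab _ _] := extE eab.
apply/negP => /(only _ Fa); rewrite (negPf (outer_neq tz eab ix)) orbF.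
by have /and4P[_ _ xa _] := ix; rewrite eq_sym (negPf xa).
Qed.

(** An extreme vertex off one of [x], [y] has the other inside. From a vertex on [y], [sides]
    reaches either side of [y], hence a vertex on [x]; a vertex on [x] leads to one on [y] in the
    same way. *)
Lemma two_zero_end x y e : two_zero x y -> e != Zer ->
  exists a b, [/\ ext a b, inner a b x & at_ a b y == e].
Proof.
move=> tz ne.
have step x' y' a b : two_zero x' y' -> ext a b -> inner a b y' ->
    exists a b, [/\ ext a b, inner a b x' & at_ a b y' == e].
  move=> tz' eab iy; have [lF _ _ _ _] := tz'.
  have na := outer_alone (two_zeroC tz') eab iy.
  have nb := outer_alone (two_zeroC tz') (extC' chiP eab) (innerC chiP iy).
  have [p [q [epq Hpq]]] := sides chiP lF eab iy na nb ne.
  exists p, q; split=> //.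
  case/orP: (tz_inner tz' epq) => // /(inner_at l).
  by rewrite (eqP Hpq) (negPf ne).
have [lF [Fx Fy xy] [ax ay] only none] := tz.
have nxy : X x y l != Zer.
  apply: contraNneq xy => E; rewrite eq_sym.
  by have /forallP/(_ y) := ax; rewrite Fy E eqxx.
have [a [b eab]] := ext_exists chiP Fx Fy nxy.
case/orP: (tz_inner tz eab) => [ix|iy]; last exact: step tz eab iy.
have [p [q [epq iy Hpq]]] : exists p q, [/\ ext p q, inner p q y & at_ p q x == e].
  have tz' := two_zeroC tz.
  have na := outer_alone tz eab ix.
  have nb := outer_alone tz (extC' chiP eab) (innerC chiP ix).
  have [p [q [epq Hpq]]] := sides chiP lF eab ix na nb ne.
  exists p, q; split=> //.
  case/orP: (tz_inner tz epq) => // /(inner_at l).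
  by rewrite (eqP Hpq) (negPf ne).
exact: step tz epq iy.
Qed.

End TwoZero2.

(** * The quadrilateral around a line with mu = 2 and nu = 0 *)

Section Corner.
Variables (T : finType) (chi : T -> T -> T -> sg).
Hypothesis chiP : chirotope chi.
Local Notation O := (oline T).
Local Notation X := (osign chi).

(** By Cramer's rule, [a1 + a2 + l] and [c1 + c2 + l] vanish up to positive factors: with [l] at
    infinity the four lines bound a parallelogram with opposite vertices [a1 /\ c1] and [a2 /\ c2].
    In [framex] the diagonal [x] is [a1 - c1] in the same sense. *)
Definition frame (l a1 c1 a2 c2 : O) : bool :=
  [&& X a1 c1 l != Zer, X a1 a2 l == Zer, X c1 c2 l == Zer,
   sgmul (X c1 a2 l) (X a1 c1 l) == Pos, sgmul (X a1 c2 l) (X a1 c1 l) == Neg,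
   sgmul (X a1 c1 a2) (X a1 c1 l) == Neg & sgmul (X a1 c1 c2) (X a1 c1 l) == Neg].

Definition framex (l x a1 c1 : O) : bool :=
  [&& X a1 c1 x == Zer, sgmul (X x c1 l) (X a1 c1 l) == Pos &
   sgmul (X a1 x l) (X a1 c1 l) == Neg].

(* The lines [l] and [x] meet in an ordinary point next to which the points
   [a1 /\ c1], [a2 /\ c2] of [x] and [a1 /\ a2], [c1 /\ c2] of [l] are triple.
   As linear forms, a1 + a2 + l = c1 + c2 + l = 0 and x = a1 - c1. *)
Record corner (l x y a1 c1 a2 c2 : O) : Prop := Corner {
  co_tz : two_zero chi l (~: [set l.1]) x y;
  co_ext1 : extreme chi l (~: [set l.1]) a1 c1;
  co_ext2 : extreme chi l (~: [set l.1]) a2 c2;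
  co_frame : frame l a1 c1 a2 c2;
  co_framex : framex l x a1 c1;
  co_x22 : X a2 c2 x == Zer;
  co_x1 : forall g, X a1 c1 g == Zer -> g.1 \in [set a1.1; c1.1; x.1];
  co_x2 : forall g, X a2 c2 g == Zer -> g.1 \in [set a2.1; c2.1; x.1];
  co_la : forall g, X a1 a2 g == Zer -> g.1 \in [set a1.1; a2.1; l.1];
  co_lc : forall g, X c1 c2 g == Zer -> g.1 \in [set c1.1; c2.1; l.1];
  co_y : vsign chi l a1 c1 y == Pos
}.

Definition others (l x a1 c1 a2 c2 g : O) : bool :=
  [&& g.1 != l.1, g.1 != x.1, g.1 != a1.1, g.1 != c1.1, g.1 != a2.1 & g.1 != c2.1].

Lemma two_zero_flip l F x y : two_zero chi l F x y -> two_zero chi l F (flip x) y.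
Proof. by case=> lF Fxy [ax ay]; split=> //; split=> //; rewrite (@alone1 _ chi l F _ x). Qed.

Lemma frame_swap l a1 c1 a2 c2 : frame l a1 c1 a2 c2 -> frame l c1 a1 c2 a2.
Proof. rewrite /frame; signs [:: a1; c1; a2; c2; l]. Qed.

Lemma framex_swap l x a1 c1 : framex l x a1 c1 -> framex l (flip x) c1 a1.
Proof. rewrite /framex; signs [:: a1; c1; x; l]. Qed.

Lemma corner_swap l x y a1 c1 a2 c2 : corner l x y a1 c1 a2 c2 -> corner l (flip x) y c1 a1 c2 a2.
Proof.
case=> tz e1 e2 b bx x22 x1 x2 la lc hy; split.
- exact: two_zero_flip.
- exact: extC'.
- exact: extC'.
- exact: frame_swap.
- exact: framex_swap.
- by move: x22; signs [:: a2; c2; x].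
- move=> g; rewrite (X12 chiP) => H; rewrite [[set c1.1; a1.1]]setUC; apply: x1.
  by move: H; case: (X a1 c1 g).
- move=> g; rewrite (X12 chiP) => H; rewrite [[set c2.1; a2.1]]setUC; apply: x2.
  by move: H; case: (X a2 c2 g).
- exact: lc.
- exact: la.
- by move: hy; rewrite /vsign; signs [:: a1; c1; y; l].
Qed.

Section OneCorner.
Variables l x y a1 c1 a2 c2 : O.
Hypothesis co : corner l x y a1 c1 a2 c2.
Local Notation at_ := (vsign chi l).
Local Notation F := (~: [set l.1]).
Local Notation ext := (extreme chi l F).
Local Notation inner := (inside chi F).
Local Notation S := (others l x a1 c1 a2 c2).

Lemma inF (g : O) : g.1 != l.1 -> g.1 \in F.
Proof. by rewrite !inE. Qed.

(* The direction of every line but [x] lies between those of [a1] and [c1]. *)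
Lemma dirs g : g.1 != l.1 -> g.1 != x.1 -> sgmul (X g c1 l) (X a1 g l) != Neg.
Proof.
move=> gl gx; have Fg := inF gl.
have /extE[Fa Fc nac rac [rca fac]] := co_ext1 co.
have [z|nz] := boolP (X a1 c1 g == Zer).
  have := co_x1 co z; rewrite !inE (negPf gx) orbF => /orP[] /eqP E.
    by case: (same_line E) => ->; signs [:: a1; c1; l].
  by case: (same_line E) => ->; signs [:: a1; c1; l].
have := rayP rac Fg; have := rayP rca Fg; move: nac nz; signs [:: a1; c1; g; l].
Qed.

(** The lines through [a1 /\ a2] and [c1 /\ c2] are known, so [g] is parallel to no side. The rays
    at both ends of the diagonal then make [g] separate these ends. *)
Lemma S_dirs g : S g -> at_ a1 c1 g == Pos ->
  [&& sgmul (X g c1 l) (X a1 c1 l) == Pos, sgmul (X a1 g l) (X a1 c1 l) == Pos &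
      at_ a2 c2 g == Neg].
Proof.
case/and5P=> gl gx ga1 gc1 /andP[ga2 gc2] Hg.
have Fg := inF gl.
have /extE[Fa Fc nac rac [rca fac]] := co_ext1 co.
have /extE[Fa' Fc' nac' rac' [rca' fac']] := co_ext2 co.
have na : X a1 a2 g != Zer by apply/negP => /(co_la co); rewrite !inE (negPf ga1) (negPf ga2) (negPf gl).
have nc : X c1 c2 g != Zer by apply/negP => /(co_lc co); rewrite !inE (negPf gc1) (negPf gc2) (negPf gl).
have nv : X a2 c2 g != Zer by apply/negP => /(co_x2 co); rewrite !inE (negPf ga2) (negPf gc2) (negPf gx).
have := rayP rac Fg; have := rayP rca Fg; have := rayP rac' Fg; have := rayP rca' Fg.
move: Hg (co_frame co) na nc nv; rewrite /vsign /frame; signs [:: a1; c1; a2; c2; g; l].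
Qed.

Lemma co_inner1 : inner a1 c1 x.
Proof.
have [_ [Fx _ _] _ _ _] := co_tz co.
have := co_framex co; rewrite /inside Fx /framex /= => b.
apply/and3P; split; first by case/and3P: b.
  by apply: contraTneq b => E; case: (same_line E) => ->; signs [:: a1; c1; l].
by apply: contraTneq b => E; case: (same_line E) => ->; signs [:: a1; c1; l].
Qed.

Lemma x_par2 : (X a2 x l != Zer) && (X c2 x l != Zer).
Proof.
have [Fa Fc n _ _] := extE (co_ext2 co).
move: (co_framex co) (co_frame co) (co_x22 co) n.
by rewrite /frame /framex; signs [:: a1; c1; x; l; a2; c2].
Qed.

Lemma co_inner2 : inner a2 c2 x.
Proof.
have [_ [Fx _ _] _ _ _] := co_tz co; have := x_par2.
rewrite /inside Fx (co_x22 co) /= => b.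
by apply/andP; split; apply: contraTneq b => E; case: (same_line E) => ->;
  signs [:: a2; c2; l].
Qed.

Lemma S_y : S y.
Proof.
have tz := co_tz co; have [lF [Fx Fy xy] _ _ _] := tz.
rewrite /others [y.1 == x.1]eq_sym xy; move: Fy; rewrite !inE => -> /=.
rewrite ![y.1 == _]eq_sym (outer_neq chiP tz (co_ext1 co) co_inner1).
rewrite (outer_neq chiP tz (extC' chiP (co_ext1 co)) (innerC chiP co_inner1)).
rewrite (outer_neq chiP tz (co_ext2 co) co_inner2).
by rewrite (outer_neq chiP tz (extC' chiP (co_ext2 co)) (innerC chiP co_inner2)).
Qed.

(** Extreme vertices of [F] all lie on [x] or [y]. With the diagonal and the two far sides removed,
    an extreme vertex may lie off both. *)
Definition F' : {set T} := ~: [set l.1; x.1; a2.1; c2.1].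
Local Notation ext' := (extreme chi l F').

Lemma ext_sub (A B : {set T}) (p q : O) : A \subset B -> p.1 \in A -> q.1 \in A ->
  extreme chi l B p q -> extreme chi l A p q.
Proof.
move=> /subsetP AB Ap Aq /extE[_ _ npq rpq [rqp fpq]].
rewrite /extreme /good Ap Aq npq /=; apply/andP; split; [apply/andP; split|];
  apply/forallP => c; apply/implyP => Ac.
- exact: rayP (AB _ Ac).
- by apply/implyP; apply: fanP (AB _ Ac).
- exact: rayP (AB _ Ac).
Qed.

Lemma F'_F : F' \subset F.
Proof. by apply/subsetP => g; rewrite !inE !negb_or -!andbA => /and4P[]. Qed.

Lemma a1F' : a1.1 \in F'.
Proof.
have [Fa Fc nac _ _] := extE (co_ext1 co).
have := co_frame co; have := co_framex co; move: Fa; rewrite !inE !negb_or => -> /= bx b.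
apply/andP; split; first by apply/andP; split=> //;
  [apply: contraTneq bx => E; case: (same_line E) => ->; rewrite /framex; signs [:: x; c1; l]
  |apply: contraTneq b => E; case: (same_line E) => ->; rewrite /frame; signs [:: a2; c1; c2; l]].
apply: contraTneq b => E; case: (same_line E) => ->; rewrite /frame; signs [:: a2; c1; c2; l].
Qed.

(** An extreme vertex [p /\ q] of [F] on [y], on the negative side of [x], stays extreme for [F'].
    Walking along [p] to its other end, where [q] is negative, then makes [y] negative as well. *)
Lemma right_ext_N s0 : S s0 -> at_ a1 c1 s0 == Pos ->
  sgmul (X s0 y l) (X a1 c1 l) == Pos -> exists s t, ext' s t /\ at_ s t y == Neg.
Proof.
move=> S0 n0 s0y; have tz := co_tz co; have [lF [Fx Fy xy] _ _ _] := tz.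
have D0 : X a1 c1 l != Zer by have [] := extE (co_ext1 co).
have [p [q [epq iy Hx Epq]]] : exists p q, [/\ ext p q, inner p q y, at_ p q x == Neg
    & sgmul (X p q l) (X a1 c1 l) == Neg].
  have [p [q [epq iy Hx]]] := two_zero_end chiP (two_zeroC tz) (isT : Neg != Zer).
  have [Fp Fq npq _ _] := extE epq.
  case E : (sgmul (X p q l) (X a1 c1 l) == Neg); first by exists p, q.
  exists q, p; split; [exact: extC'|exact: innerC|by move: Hx; rewrite /vsign; signs [:: p; q; x; l]|].
  by move: npq D0 (negbT E); signs [:: p; q; a1; c1; l].
have tzC := two_zeroC tz.
have [Fp Fq npq rpq [rqp fpq]] := extE epq.
have px := outer_neq chiP tzC epq iy.
have qx := outer_neq chiP tzC (extC' chiP epq) (innerC chiP iy).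
have [pl ql] : p.1 != l.1 /\ q.1 != l.1 by move: Fp Fq; rewrite !inE.
have sg1 : [&& sgmul (X p c1 l) (X a1 c1 l) != Pos, sgmul (X a1 p l) (X a1 c1 l) != Pos,
    sgmul (X q c1 l) (X a1 c1 l) != Neg & sgmul (X a1 q l) (X a1 c1 l) != Neg].
  move: (rayP rpq Fx) (rayP rqp Fx) npq Hx Epq (dirs pl px) (dirs ql qx) (co_framex co).
  rewrite /vsign /framex; signs [:: a1; c1; x; l; p; q].
have yd := S_dirs S_y (co_y co); have s0d := S_dirs S0 n0.
have yd' : (sgmul (X y c1 l) (X a1 c1 l) == Pos) && (sgmul (X a1 y l) (X a1 c1 l) == Pos) by case/and3P: yd => -> ->.
have s0d' : (sgmul (X s0 c1 l) (X a1 c1 l) == Pos) && (sgmul (X a1 s0 l) (X a1 c1 l) == Pos) by case/and3P: s0d => -> ->.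
have [/and4P[_ ypq yp yq]] := iy.
have py : (sgmul (X p y l) (X a1 c1 l) == Neg) && (sgmul (X y q l) (X a1 c1 l) == Pos).
  have /implyP := fanP fpq Fy.
  have py' : p.1 != y.1 by rewrite eq_sym.
  have := X_flat chiP (x := q) (y := l) py'; move=> /implyP.
  have qy' : q.1 != y.1 by rewrite eq_sym.
  have := X_flat chiP (x := p) (y := l) qy'; move=> /implyP.
  move: ypq npq Epq sg1 yd'; signs [:: a1; c1; l; p; q; y].
have s0q : sgmul (X s0 q l) (X a1 c1 l) == Pos.
  by case/andP: py => _; move: s0y s0d' yd' sg1 D0; move=> + + + /and4P[_ _ + +]; signs [:: a1; c1; l; s0; y; q].
have Fs0 : s0.1 \in F by apply: inF; case/andP: S0.
(* The eighth line is needed here: [s0] misses [p /\ q], because [y] is the only inner line, and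
   this prevents [p] from being parallel to [a1]. *)
have bp : X a1 p l != Zer.
  have [/same_line[]E|s0p] := eqVneq s0.1 p.1.
  - by move: s0d' D0; rewrite E; signs [:: a1; c1; l; p].
  - by move: s0d' D0; rewrite E; signs [:: a1; c1; l; p].
  have z : X p q s0 != Zer.
    apply/negP => z; have /(inner_unique chiP tzC epq iy)/same_line E : inner p q s0.
      rewrite /inside Fs0 z s0p /=; apply: contraTneq s0q => /same_line[]->;
      by signs [:: q; a1; c1; l].
    by move: s0y; case: E => ->; signs [:: y; a1; c1; l].
  move: (rayP rpq Fs0) (rayP rqp Fs0) z s0q s0d' sg1 D0 npq.
  by signs [:: a1; c1; l; p; q; s0].
have cp : X p c1 l != Zer by move: py sg1 yd' D0 npq; signs [:: a1; c1; l; p; y; q].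
have bq : X a1 q l != Zer by move: py sg1 yd' D0 npq; signs [:: a1; c1; l; p; y; q].
have b := co_frame co.
have b' : [&& X c1 c2 l == Zer, sgmul (X a1 c1 c2) (X a1 c1 l) == Neg & sgmul (X a1 c2 l) (X a1 c1 l) == Neg].
  by case/and5P: b => _ _ -> _ /and3P[-> _ ->].
have pF' : p.1 \in F'.
  rewrite !inE !negb_or pl px /=; apply/andP; split.
    by apply: contraNneq bp => /same_line[]->; move: b; rewrite /frame; signs [:: a1; c1; l; a2; c2].
  by apply: contraNneq cp => /same_line[]->; move: b; rewrite /frame; signs [:: a1; c1; l; a2; c2].
have a1F := a1F'; have c1F : c1.1 \in F by have [] := extE (co_ext1 co).
have qF' : q.1 \in F'.
  rewrite !inE !negb_or ql qx /=; apply/andP; split.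
    by apply: contraNneq bq => /same_line[]->; move: b; rewrite /frame; signs [:: a1; c1; l; a2; c2].
  apply/negP => /eqP /same_line E; move: (rayP rpq c1F) (rayP rqp c1F) b' npq sg1 bp cp Epq.
  by case: E => ->; signs [:: a1; c1; l; c2; p].
have epq' := ext_sub F'_F pF' qF' epq.
have a1pq : X q p a1 != Zer.
  apply/negP => z; have iya : inner p q a1.
    rewrite /inside (subsetP F'_F _ a1F) /=; apply/and3P; split.
    - by move: z; signs [:: p; q; a1].
    - by apply: contraNneq bp => /same_line[]->; signs [:: p; l; q].
    - by apply: contraNneq bq => /same_line[]->; signs [:: p; l; q].
  have /and5P[_ _ ya1 _ _] := S_y.
  by move: ya1; rewrite (inner_unique chiP tzC epq iy iya) eqxx.
have [u [v [euv Hp Hq]]] := two_more chiP (extC' chiP epq') a1F a1pq bp.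
have [_ _ nuv _ _] := extE euv.
exists u, v; split=> //.
have yF' : y.1 \in F'.
  by case/and5P: S_y => yl yx _ _ /andP[ya2 yc2]; rewrite !inE !negb_or yl yx ya2.
have iy' : inside chi F' q p y.
  by rewrite /inside yF' yp yq !andbT /=; move: ypq; signs [:: p; q; y].
have lF' : l.1 \notin F' by rewrite !inE eqxx.
have /andP[/eqP -> _] := inner_side chiP (extC' chiP epq') iy' nuv Hp Hq.
by move: py Epq D0; signs [:: p; q; y; l; a1; c1].
Qed.

Lemma baseA : [&& X a1 a2 l == Zer, sgmul (X c1 a2 l) (X a1 c1 l) == Pos &
  sgmul (X a1 c1 a2) (X a1 c1 l) == Neg].
Proof. by have := co_frame co; case/and5P=> _ -> _ -> /and3P[_ -> _]. Qed.

Lemma baseC : [&& X c1 c2 l == Zer, sgmul (X a1 c1 c2) (X a1 c1 l) == Neg &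
  sgmul (X a1 c2 l) (X a1 c1 l) == Neg].
Proof. by have := co_frame co; case/and5P=> _ _ -> _ /and3P[-> _ ->]. Qed.

Lemma not_F' (c : O) : c.1 \in F -> c.1 \notin F' ->
  [\/ c.1 = x.1, c.1 = a2.1 | c.1 = c2.1].
Proof.
rewrite !inE negbK => /negPf-> /=; rewrite -orbA => /or3P[] /eqP; by [left|right; left|right; right|constructor 1|constructor 2|constructor 3].
Qed.

Lemma c1F' : c1.1 \in F'.
Proof.
have [Fa Fc nac _ _] := extE (co_ext1 co).
have := co_frame co; have := co_framex co; move: Fc; rewrite !inE !negb_or => -> /= bx b.
apply/andP; split; first by apply/andP; split=> //;
  [apply: contraTneq bx => /same_line[]->; rewrite /framex; signs [:: x; a1; l]
  |apply: contraTneq b => /same_line[]->; rewrite /frame; signs [:: a2; a1; c2; l]].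
by apply: contraTneq b => /same_line[]->; rewrite /frame; signs [:: a2; a1; c2; l].
Qed.

(** The first four entries are coefficients along [a1] and [c1]: negative for [s], nonnegative for
    [t]. [semidirs] keeps only these. *)
Definition topdirs s t :=
  [&& sgmul (X s c1 l) (X a1 c1 l) == Neg, sgmul (X a1 s l) (X a1 c1 l) == Neg,
      sgmul (X t c1 l) (X a1 c1 l) != Neg, sgmul (X a1 t l) (X a1 c1 l) != Neg,
      sgmul (X s t l) (X a1 c1 l) == Neg & at_ a1 c1 s == Neg].

(** If [a2] were positive at [s /\ t], the removed lines [x], [a2], [c2] would not spoil
    extremality, and [s /\ t] would be extreme for [F] although [x] and [y] are both negative
    there. *)
Lemma a2_below s t : ext' s t -> at_ s t y == Neg ->
  topdirs s t ->
  at_ s t a2 != Pos.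
Proof.
move=> est Hy dst; apply/negP => Ha2; have [Fs Ft nst rst [rts fst]] := extE est.
pose ok c := [&& sgmul (X c t l) (X s t c) != Neg, sgmul (X c s l) (X t s c) != Neg &
  (X s t c == Zer) ==> (sgmul (X c t l) (X s c l) != Pos)].
have okx : ok x && (at_ s t x == Neg).
  move: (rayP rst a1F') (rayP rst c1F') (rayP rts a1F') (rayP rts c1F') (co_framex co) nst dst.
  by rewrite /ok /framex /topdirs /vsign; signs [:: a1; c1; l; s; t; x].
have oka : ok a2.
  move: Ha2 (rayP rst a1F') (rayP rst c1F') (rayP rts a1F') (rayP rts c1F') baseA nst dst.
  by rewrite /ok /framex /topdirs /vsign; signs [:: a1; c1; l; s; t; a2].
have okc : ok c2.
  move: (rayP rst a1F') (rayP rst c1F') (rayP rts a1F') (rayP rts c1F') baseC nst dst.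
  by rewrite /ok /framex /topdirs /vsign; signs [:: a1; c1; l; s; t; c2].
have okF c : c.1 \in F -> ok c.
  move=> Fc; have [F'c|] := boolP (c.1 \in F').
    by rewrite /ok (rayP rst F'c) (rayP rts F'c); apply/implyP; apply: fanP fst F'c.
  have okf d e : d.1 = e.1 -> ok e -> ok d.
    by case/same_line=> -> //; rewrite /ok; signs [:: s; t; e; l].
  by case/(not_F' Fc) => /okf; apply=> //; case/andP: okx.
have FF := subsetP F'_F.
have eF : ext s t.
  rewrite /extreme /good (FF _ Fs) (FF _ Ft) nst /=.
  apply/andP; split; [apply/andP; split|]; apply/forallP => c; apply/implyP => /okF /and3P[] //.
have tz := co_tz co.
case/orP: (tz_inner chiP tz eF) => /(inner_at l); first by case/andP: okx => _ /eqP->.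
by rewrite (eqP Hy).
Qed.

(** Such a [g] crosses [c1] beyond [a2], so the last vertex [k /\ c1] of [c1] lies beyond [a2] too.
    There [x] and [y] are negative and nonpositive on the whole sector, and descent gives an extreme
    vertex of [F] off both. *)
Lemma no_top s t g : ext' s t -> at_ s t y == Neg ->
  topdirs s t ->
  S g -> at_ a1 c1 g == Pos -> at_ c1 a2 g == Pos -> False.
Proof.
move=> est Hy dst Sg Hg gR; have [Fs Ft nst rst [rts fst]] := extE est.
have Ha2 := a2_below est Hy dst.
have [Fa Fc nac _ _] := extE (co_ext1 co).
have D0 : X a1 c1 l != Zer by [].
have [|k gk /andP[Ek Hk]] := @start _ _ chiP l F c1 (flip a1) Fc Fa.
  by move: nac; signs [:: a1; c1; l].
have [Fk _ nk rk _] := and5P gk.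
have Fg : g.1 \in F by apply: inF; case/andP: Sg.
have gd := S_dirs Sg Hg.
have gd' : (sgmul (X g c1 l) (X a1 c1 l) == Pos) && (sgmul (X a1 g l) (X a1 c1 l) == Pos) by case/and3P: gd => -> ->.
have k1 : at_ k c1 a2 == Pos.
  move: (rayP rk Fg) gd' gR Ek baseA D0; rewrite /vsign; signs [:: a1; c1; a2; l; k; g].
have kl : k.1 != l.1 by move: Fk; rewrite !inE.
have kx : k.1 != x.1.
  apply: contraTneq k1 => /same_line[]->; move: baseA (co_framex co) D0; rewrite /framex /vsign; signs [:: a1; c1; a2; l; x].
have dk : sgmul (X a1 k l) (X a1 c1 l) != Pos.
  by move: (dirs kl kx) Ek D0; signs [:: a1; c1; k; l].
have k0 : at_ a1 c1 k == Neg.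
  by move: baseA Ek k1 dk D0; rewrite /vsign; signs [:: a1; c1; a2; k; l].
have nx : nnp chi l (flip x) k c1.
  by move: (co_framex co) Ek dk k0 D0; rewrite /nnp /framex /vsign; signs [:: a1; c1; x; k; l].
have kF' : k.1 \in F'.
  rewrite !inE !negb_or kl kx /=; apply/andP; split.
    by apply: contraTneq k1 => /same_line[]->; rewrite /vsign; signs [:: a2; c1; l].
  by apply: contraTneq nk => /same_line[]->; move: baseC; signs [:: a1; c1; c2; l].
have yS := S_dirs S_y (co_y co).
have yd : (sgmul (X y c1 l) (X a1 c1 l) == Pos) && (sgmul (X a1 y l) (X a1 c1 l) == Pos) by case/and3P: yS => -> ->.
have yF' : y.1 \in F'.
  by case/and5P: S_y => yl yx _ _ /andP[ya2 yc2]; rewrite !inE !negb_or yl yx ya2.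
have c1E : at_ s t c1 != Neg.
  by move: (rayP rst c1F') (rayP rts c1F') dst nst; rewrite /topdirs /vsign; signs [:: a1; c1; l; s; t].
have relk : (sgmul (X c1 a2 l) (X k c1 l) == Neg) && (sgmul (X a2 k l) (X k c1 l) != Pos).
  by move: baseA Ek dk D0; signs [:: a1; c1; a2; k; l].
have rely : (sgmul (X c1 a2 l) (X y c1 l) == Pos) && (sgmul (X a2 y l) (X y c1 l) == Neg).
  by move: baseA yd D0; signs [:: a1; c1; a2; y; l].
have kE : at_ s t k == Neg.
  by move: c1E Ha2 k1 relk nst; rewrite /vsign; signs [:: c1; a2; l; s; t; k].
have yR : at_ c1 a2 y == Neg.
  by move: c1E Ha2 rely Hy nst; rewrite /vsign; signs [:: c1; a2; l; s; t; y].
have yU : at_ k c1 y == Neg.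
  by move: yR rely relk k1; rewrite /vsign; signs [:: c1; a2; l; k; y].
have dst' : [&& sgmul (X s c1 l) (X y c1 l) == Neg, sgmul (X t c1 l) (X y c1 l) != Neg,
    sgmul (X s t l) (X y c1 l) == Neg & sgmul (X k c1 l) (X y c1 l) == Neg].
  case/and5P: dst => h1 _ h2 _ /andP[h3 _]; move: h1 h2 h3 yd Ek D0.
  by case: (X s c1 l); case: (X t c1 l); case: (X s t l); case: (X y c1 l); rewrite ?Xf1; case: (X k c1 l); case: (X a1 c1 l).
have ky : sgmul (X k (flip y) l) (X k c1 l) != Neg.
  move: (rayP rst kF') (rayP rts kF') (rayP rst yF') (rayP rts yF') kE Hy dst' nst.
  by rewrite /vsign; signs [:: s; t; y; k; c1; l].
have ny : nnp chi l (flip y) k c1.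
  by move: dst' ky yU; rewrite /nnp /vsign => /and4P[_ _ _]; signs [:: k; c1; y; l].
have [p [q [epq _ Hpq]]] := ext_in chiP gk.
have /and3P[_ _ Hx'] := Hpq _ nx; have /and3P[_ _ Hy'] := Hpq _ ny.
case/orP: (tz_inner chiP (co_tz co) epq) => /and4P[_ /eqP z _ _].
  by move: Hx'; rewrite /vsign Xf3 z.
by move: Hy'; rewrite /vsign Xf3 z.
Qed.

Definition semidirs s t :=
  [&& sgmul (X s c1 l) (X a1 c1 l) == Neg, sgmul (X a1 s l) (X a1 c1 l) == Neg,
      sgmul (X t c1 l) (X a1 c1 l) != Neg & sgmul (X a1 t l) (X a1 c1 l) != Neg].

Lemma y_dirs : (sgmul (X y c1 l) (X a1 c1 l) == Pos) && (sgmul (X a1 y l) (X a1 c1 l) == Pos).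
Proof. by have := S_dirs S_y (co_y co); case/and3P=> -> ->. Qed.

Lemma yF' : y.1 \in F'.
Proof. by case/and5P: S_y => yl yx _ _ /andP[ya2 yc2]; rewrite !inE !negb_or yl yx ya2. Qed.

Lemma F'E (g : O) : g.1 \in F' -> (g.1 != l.1) * (g.1 != x.1).
Proof. by rewrite !inE !negb_or -!andbA => /and4P[]. Qed.

(** The points of [l] on [a1] and on [c1] are triple, and their third lines [a2], [c2] are not in
    [F']. *)
Lemma par_F' (g : O) : g.1 \in F' ->
  ((X a1 g l == Zer) ==> (X a1 c1 g == Zer)) && ((X g c1 l == Zer) ==> (X a1 c1 g == Zer)).
Proof.
rewrite !inE !negb_or -!andbA => /and4P[gl gx ga gc].
have [+ + _ _ _] := extE (co_ext1 co); rewrite !inE => a1l c1l.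
apply/andP; split; apply/implyP => z.
- have : X a1 g a2 == Zer.
    apply: (X_flat chiP a1l); have /and3P[h _ _] := baseA.
    by move: z h; signs [:: a1; l; g; a2].
  move=> h; have /(co_la co) : X a1 a2 g == Zer by move: h; signs [:: a1; g; a2].
  rewrite !inE (negPf gl) (negPf ga) !orbF => /eqP/same_line[]->; signs [:: a1; c1; l].
- have : X c1 g c2 == Zer.
    apply: (X_flat chiP c1l); have /and3P[h _ _] := baseC.
    by move: z h; signs [:: c1; l; g; c2].
  move=> h; have /(co_lc co) : X c1 c2 g == Zer by move: h; signs [:: c1; g; c2].
  rewrite !inE (negPf gl) (negPf gc) !orbF => /eqP/same_line[]->; signs [:: a1; c1; l].
Qed.

Lemma classify s t : ext' s t -> at_ s t y == Neg -> semidirs s t || semidirs t s.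
Proof.
move=> est Hy; have [Fs Ft nst rst [rts fst]] := extE est.
have [sl sx] := F'E Fs; have [tl tx] := F'E Ft.
have nV : (X s t a1 != Zer) || (X s t c1 != Zer).
  by move: Hy (co_y co); rewrite /vsign; signs [:: s; t; a1; c1; l; y].
move: (rayP rst a1F') (rayP rst c1F') (rayP rts a1F') (rayP rts c1F') nV nst.
move: (rayP rst yF') (rayP rts yF') (dirs sl sx) (dirs tl tx) (co_y co) y_dirs Hy.
have [_ _ nac rac [rca _]] := extE (co_ext1 co); have FF := subsetP F'_F.
move: nac (rayP rac (FF _ Fs)) (rayP rac (FF _ Ft)) (rayP rca (FF _ Fs)) (rayP rca (FF _ Ft)) (par_F' Fs) (par_F' Ft).
by rewrite /semidirs /vsign; signs [:: a1; c1; l; s; t; y].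
Qed.

Lemma semi_at (s t : O) : s.1 \in F' -> semidirs s t -> at_ a1 c1 s == Neg.
Proof.
move=> Fs sd; have [sl sx] := F'E Fs.
have [Fa Fc nac rac [rca fac]] := extE (co_ext1 co).
have FF := subsetP F'_F.
have n : X a1 c1 s != Zer.
  apply/negP => /(co_x1 co); rewrite !inE (negPf sx) orbF => /orP[] /eqP/same_line E;
  by move: sd; rewrite /semidirs => /and4P[h1 h2 _ _]; move: h1 h2; case: E => ->; signs [:: a1; c1; l].
move: (rayP rac (FF _ Fs)) n; case/and4P: sd => h1 h2 _ _; move: h1 h2 nac.
by rewrite /vsign; signs [:: a1; c1; l; s].
Qed.

Lemma F'_swap : ~: [set l.1; (flip x).1; c2.1; a2.1] = F'.
Proof. by apply/setP => g; rewrite !inE orbAC. Qed.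

End OneCorner.

Lemma others_swap l x a1 c1 a2 c2 g :
  others l x a1 c1 a2 c2 g -> others l (flip x) c1 a1 c2 a2 g.
Proof. by case/and5P=> h1 h2 h3 h4 /andP[h5 h6]; rewrite /others h1 h2 h3 h4 h5 h6. Qed.

(** Exchanging the roles of the [a]'s and the [c]'s by [corner_swap] reverses the relative direction
    of [s1] and [y], so [right_ext_N] applies in one of the two forms. *)
Lemma right_ext l x y a1 c1 a2 c2 s0 : corner l x y a1 c1 a2 c2 ->
  others l x a1 c1 a2 c2 s0 -> s0.1 != y.1 ->
  exists s t, extreme chi l (F' l x a2 c2) s t /\ vsign chi l s t y == Neg.
Proof.
move=> co S0 s0y; have [lF [Fx Fy xy] [ax ay] only none] := co_tz co.
have F0 : s0.1 \in ~: [set l.1] by apply: inF; case/andP: S0.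
have n0 : X s0 y l != Zer.
  apply: contraNneq s0y => /eqP E; apply: (implyP (implyP (forallP ay s0) F0)).
  by move: E; signs [:: s0; y; l].
have v0 : X a1 c1 s0 != Zer.
  apply/negP => /(co_x1 co); rewrite !inE.
  by case/and5P: S0 => _ /negPf-> /negPf-> /negPf-> _.
have nac : X a1 c1 l != Zer by have [] := extE (co_ext1 co).
have S0f : others l x a1 c1 a2 c2 (flip s0) by [].
have [s1 [S1 p1 n1]] : exists s1, [/\ others l x a1 c1 a2 c2 s1, vsign chi l a1 c1 s1 == Pos & X s1 y l != Zer].
  have : (vsign chi l a1 c1 s0 == Pos) || (vsign chi l a1 c1 (flip s0) == Pos).
    by move: v0 nac; rewrite /vsign; signs [:: a1; c1; l; s0].
  case/orP => ?; [exists s0 | exists (flip s0)]; split=> //.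
  by move: n0; signs [:: s0; y; l].
have : (sgmul (X s1 y l) (X a1 c1 l) == Pos) || (sgmul (X s1 y l) (X c1 a1 l) == Pos).
  by move: n1 nac; signs [:: s1; y; l; a1; c1].
case/orP=> H; first exact (right_ext_N co S1 p1 H).
have p2 : vsign chi l c1 a1 s1 == Pos.
  by move: p1; rewrite /vsign; signs [:: a1; c1; l; s1].
have [s [t [est Hy]]] := right_ext_N (corner_swap co) (others_swap S1) p2 H.
by exists s, t; split=> //; rewrite -F'_swap.
Qed.

(* The line [l], seen from the side of the point [a1 /\ c1]. *)
Lemma corner_sep l x y a1 c1 a2 c2 s0 g h : corner l x y a1 c1 a2 c2 ->
  others l x a1 c1 a2 c2 s0 -> s0.1 != y.1 ->
  others l x a1 c1 a2 c2 g -> others l x a1 c1 a2 c2 h ->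
  sgmul (vsign chi l c1 a2 g) (vsign chi l a1 c1 g) == Pos ->
  sgmul (vsign chi l a1 c2 h) (vsign chi l a1 c1 h) == Pos -> False.
Proof.
move=> co S0 s0y.
have nat_g u v w : sgmul (vsign chi l u v w) (vsign chi l a1 c1 w) == Pos ->
    exists2 w', w'.1 = w.1 & (vsign chi l u v w' == Pos) && (vsign chi l a1 c1 w' == Pos).
  move=> H; have : (vsign chi l u v w == Pos) && (vsign chi l a1 c1 w == Pos) ||
     (vsign chi l u v (flip w) == Pos) && (vsign chi l a1 c1 (flip w) == Pos).
    move: H; rewrite /vsign !Xf3; case: (X u v w); case: (X u v l); case: (X a1 c1 w); by case: (X a1 c1 l).
  by case/orP; [exists w | exists (flip w)].
move=> Sg Sh /nat_g[g' Eg /andP[g1 g2]] /nat_g[h' Eh /andP[h1 h2]].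
have {}Sg : others l x a1 c1 a2 c2 g' by rewrite /others Eg.
have {}Sh : others l x a1 c1 a2 c2 h' by rewrite /others Eh.
have [s [t [est Hy sd]]] : exists s t, [/\ extreme chi l (F' l x a2 c2) s t,
    vsign chi l s t y == Neg & semidirs l a1 c1 s t].
  have [s [t [est Hy]]] := right_ext co S0 s0y.
  case/orP: (classify co est Hy) => sd; first by exists s, t.
  exists t, s; split=> //; first exact: extC'.
  by move: Hy; rewrite /vsign; signs [:: s; t; l; y].
have [Fs Ft nst _ _] := extE est.
have sa := semi_at co Fs sd.
have nac : X a1 c1 l != Zer by have [] := extE (co_ext1 co).
have : (sgmul (X s t l) (X a1 c1 l) == Neg) || (sgmul (X s t l) (X c1 a1 l) == Neg).
  by move: nst nac; signs [:: s; t; l; a1; c1].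
case/orP=> H.
  apply: (no_top co est Hy _ Sg g2 g1).
  by case/and4P: sd => d1 d2 d3 d4; rewrite /topdirs d1 d2 d3 d4 H sa.
have cs := corner_swap co.
have est' : extreme chi l (F' l (flip x) c2 a2) s t by rewrite /F' F'_swap.
apply: (no_top cs est' Hy _ (others_swap Sh)).
- case/and4P: sd => d1 d2 d3 d4; rewrite /topdirs; move: H.
  by move: d1 d2 d3 d4 sa; rewrite /vsign; signs [:: a1; c1; l; s; t].
- by move: h2; rewrite /vsign; signs [:: a1; c1; l; h'].
- exact: h1.
Qed.

End Corner.

(** * Two such lines seen from each other *)

Section Corners.
Variables (T : finType) (chi : T -> T -> T -> sg).
Hypothesis chiP : chirotope chi.
Local Notation O := (oline T).
Local Notation X := (osign chi).
Local Notation F l := (~: [set l.1]).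

Lemma alone_par l A (x a : O) : lone chi l A x -> a.1 \in A -> a.1 != x.1 -> X a x l != Zer.
Proof.
move=> /forallP/(_ a)/implyP H /H/implyP {}H; apply: contraNneq => E; apply: H.
by move/eqP: E; signs [:: a; x; l].
Qed.

Lemma make_corner (l x y a1 c1 a2 c2 : O) : two_zero chi l (F l) x y ->
  extreme chi l (F l) a1 c1 -> inside chi (F l) a1 c1 x -> vsign chi l a1 c1 y == Pos ->
  extreme chi l (F l) a2 c2 -> inside chi (F l) a2 c2 x ->
  a1.1 != a2.1 -> c1.1 != c2.1 -> X a1 a2 l == Zer -> X c1 c2 l == Zer ->
  (forall g, X a1 a2 g == Zer -> g.1 \in [set a1.1; a2.1; l.1]) ->
  (forall g, X c1 c2 g == Zer -> g.1 \in [set c1.1; c2.1; l.1]) ->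
  exists x', x'.1 = x.1 /\ corner chi l x' y a1 c1 a2 c2.
Proof.
move=> tz e1 i1 y1 e2 i2 a12 c12 pa pc la lc.
have [Fa1 Fc1 n1 r1 [r1' f1]] := extE e1; have [Fa2 Fc2 n2 r2 [r2' f2]] := extE e2.
have [lF [Fx Fy xy] [ax ay] only none] := tz.
have [_ z1 xa1 xc1] := and4P i1; have [_ z2 xa2 xc2] := and4P i2.
have b : frame chi l a1 c1 a2 c2.
  have := X_flat chiP (x := c1) (y := l) a12; have := X_flat chiP (x := a1) (y := l) c12.
  move=> /implyP + /implyP; rewrite /frame.
  move: pa pc n1 n2 (rayP r1 Fa2) (rayP r1' Fa2) (rayP r1 Fc2) (rayP r1' Fc2).
  move: (rayP r2 Fa1) (rayP r2' Fa1) (rayP r2 Fc1) (rayP r2' Fc1).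
  by signs [:: a1; c1; a2; c2; l].
have ex (a c : O) : extreme chi l (F l) a c -> inside chi (F l) a c x ->
    forall g, X a c g == Zer -> g.1 \in [set a.1; c.1; x.1].
  move=> e i g z; rewrite !inE; case: eqVneq => //= ga; case: eqVneq => //= gc.
  have [_ _ n _ _] := extE e.
  have gF : g.1 \in F l.
    by rewrite !inE; apply: contraNneq n => /same_line[]E; move: z; rewrite E ?Xf3 //; case: (X a c l).
  by apply/eqP; apply: (inner_unique chiP tz e i); rewrite /inside gF z ga gc.
(* As [x] is parallel to neither side and enters the fan, it is [a1 - c1] up to orientation. *)
have : framex chi l x a1 c1 || framex chi l (flip x) a1 c1.
  have na := alone_par ax Fa1; have nc := alone_par ax Fc1.
  have {}na : X a1 x l != Zer by apply: na; rewrite eq_sym.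
  have {}nc : X c1 x l != Zer by apply: nc; rewrite eq_sym.
  have /implyP := fanP f1 Fx.
  by move: z1 na nc n1; rewrite /framex; signs [:: a1; c1; x; l].
case/orP => bx; [exists x | exists (flip x)]; split=> //; split=> //; try exact: ex.
- exact: two_zero_flip.
- by move: z2; signs [:: a2; c2; x].
Qed.

Lemma corner_mirror l x y a1 c1 a2 c2 : corner chi l x y a1 c1 a2 c2 ->
  corner chi l (flip x) (flip y) a2 c2 a1 c1.
Proof.
move=> co; have [tz e1 e2 b bx z2 x1 x2 la lc hy] := co; split=> //.
- apply: two_zero_flip; apply: two_zeroC; apply: two_zero_flip; exact: two_zeroC.
- by move: b; rewrite /frame; signs [:: a1; c1; a2; c2; l].
- by move: b bx z2; rewrite /frame /framex; signs [:: a1; c1; a2; c2; l; x].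
- by case/and3P: bx => z _ _; move: z; signs [:: a1; c1; x].
- move=> g h; rewrite [[set a2.1; a1.1]]setUC; apply: la.
  by move: h; signs [:: a1; a2; g].
- move=> g h; rewrite [[set c2.1; c1.1]]setUC; apply: lc.
  by move: h; signs [:: c1; c2; g].
- have := S_dirs chiP co (S_y chiP co) hy; case/and3P=> _ _.
  by rewrite /vsign; signs [:: a2; c2; y; l].
Qed.

Lemma inner_npar l x y a b : two_zero chi l (F l) x y -> extreme chi l (F l) a b ->
  inside chi (F l) a b x -> (X a x l != Zer) && (X b x l != Zer).
Proof.
move=> tz e i; have [_ _ [ax _] _ _] := tz.
have [Fa Fb _ _ _] := extE e; have [_ _ xa xb] := and4P i.
by rewrite (alone_par ax Fa) 1?eq_sym // (alone_par ax Fb) 1?eq_sym.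
Qed.

(** If [a2] passed through [a1 /\ c1], the two ends would be one point of [x], where [y] cannot take
    two signs. *)
Lemma ends_disjoint l x y a1 c1 a2 c2 : two_zero chi l (F l) x y ->
  extreme chi l (F l) a1 c1 -> inside chi (F l) a1 c1 x -> vsign chi l a1 c1 y == Pos ->
  extreme chi l (F l) a2 c2 -> inside chi (F l) a2 c2 x -> vsign chi l a2 c2 y == Neg ->
  X a1 c1 a2 != Zer.
Proof.
move=> tz e1 i1 y1 e2 i2 y2; have /andP[n1 n1'] := inner_npar tz e1 i1.
have /andP[n2 n2'] := inner_npar tz e2 i2.
have [_ _ n3 _ _] := extE e1; have [_ _ n4 _ _] := extE e2.
have [_ z1 _ _] := and4P i1; have [_ z2 _ _] := and4P i2.
apply/negP => z.
have z' : X a1 c1 c2 == Zer.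
  by move: z z1 z2 n1 n1' n2 n2' n3 n4; signs [:: a1; c1; a2; c2; x; l].
by move: z z' y1 y2 n3 n4; rewrite /vsign; signs [:: a1; c1; a2; c2; y; l].
Qed.

(** The outer lines at one end bound the directions of those at the other, and conversely; so both
    pairs have the same two directions. *)
Lemma ends_parallel l x y a1 c1 a2 c2 : two_zero chi l (F l) x y ->
  extreme chi l (F l) a1 c1 -> inside chi (F l) a1 c1 x -> vsign chi l a1 c1 y == Pos ->
  extreme chi l (F l) a2 c2 -> inside chi (F l) a2 c2 x -> vsign chi l a2 c2 y == Neg ->
  (X a1 a2 l == Zer) && (X c1 c2 l == Zer) || (X a1 c2 l == Zer) && (X c1 a2 l == Zer).
Proof.
move=> tz e1 i1 y1 e2 i2 y2; have /andP[n1 n1'] := inner_npar tz e1 i1.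
have /andP[n2 n2'] := inner_npar tz e2 i2.
have [Fa1 Fc1 n3 r1 [r1' f1]] := extE e1; have [Fa2 Fc2 n4 r2 [r2' f2]] := extE e2.
have [Fx z1 _ _] := and4P i1; have [_ z2 _ _] := and4P i2.
have d1 := ends_disjoint tz e1 i1 y1 e2 i2 y2.
have d2 : X a1 c1 c2 != Zer.
  have := ends_disjoint tz e1 i1 y1 (extC' chiP e2) (innerC chiP i2); apply.
  by move: y2; rewrite /vsign; signs [:: a2; c2; y; l].
have /implyP := fanP f1 Fx; have /implyP := fanP f2 Fx.
move: (rayP r1 Fa2) (rayP r1' Fa2) (rayP r1 Fc2) (rayP r1' Fc2).
move: (rayP r2 Fa1) (rayP r2' Fa1) (rayP r2 Fc1) (rayP r2' Fc1).
by move: z1 z2 n1 n1' n2 n2' n3 n4 d1 d2; signs [:: a1; c1; a2; c2; x; l].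
Qed.

Lemma two_ends l x y : two_zero chi l (F l) x y -> exists a1 c1 a2 c2,
  [/\ extreme chi l (F l) a1 c1, inside chi (F l) a1 c1 x & vsign chi l a1 c1 y == Pos] /\
  [/\ extreme chi l (F l) a2 c2, inside chi (F l) a2 c2 x, vsign chi l a2 c2 y == Neg,
    X a1 a2 l == Zer & X c1 c2 l == Zer].
Proof.
move=> tz.
have [a1 [c1 [e1 i1 y1]]] := two_zero_end chiP tz (isT : Pos != Zer).
have [a2 [c2 [e2 i2 y2]]] := two_zero_end chiP tz (isT : Neg != Zer).
case/orP: (ends_parallel tz e1 i1 y1 e2 i2 y2) => /andP[p1 p2].
  by exists a1, c1, a2, c2.
exists a1, c1, c2, a2; split=> //; split=> //; first exact: extC'.
- exact: innerC.
- by move: y2; rewrite /vsign; signs [:: a2; c2; y; l].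
Qed.

(** Together with [thru_pair] this shows that both views have the same four outer lines. *)
Lemma view_swap l x y z a c g h :
  two_zero chi l (F l) x y -> two_zero chi x (F x) l z ->
  extreme chi l (F l) a c -> inside chi (F l) a c x ->
  extreme chi x (F x) g h -> inside chi (F x) g h l ->
  (X g h a == Zer) || (X g h c == Zer).
Proof.
move=> tl tx el il ex ix; have /andP[n1 n1'] := inner_npar tl el il.
have /andP[n2 n2'] := inner_npar tx ex ix.
have [Fa Fc n3 r1 [r1' f1]] := extE el; have [Fg Fh n4 r2 [r2' f2]] := extE ex.
have [Fx z1 xa xc] := and4P il; have [Fl z2 lg lh] := and4P ix.
have Fg' : g.1 \in F l by rewrite !inE eq_sym.
have Fh' : h.1 \in F l by rewrite !inE eq_sym.
have Fa' : a.1 \in F x by rewrite !inE eq_sym.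
have Fc' : c.1 \in F x by rewrite !inE eq_sym.
have /implyP := fanP f1 Fx; have /implyP := fanP f2 Fl.
move: (rayP r1 Fg') (rayP r1' Fg') (rayP r1 Fh') (rayP r1' Fh').
move: (rayP r2 Fa') (rayP r2' Fa') (rayP r2 Fc') (rayP r2' Fc').
by move: z1 z2 n1 n1' n2 n2' n3 n4; signs [:: g; h; a; c; x; l].
Qed.

Lemma thru_outer l x y a b c : two_zero chi l (F l) x y -> extreme chi l (F l) a b ->
  inside chi (F l) a b x -> X a b c == Zer -> c.1 != x.1 -> (c.1 == a.1) || (c.1 == b.1).
Proof.
move=> tz e i z cx; case: eqVneq => //= ca; case: eqVneq => //= cb.
have [_ _ n _ _] := extE e.
have Fc : c.1 \in F l.
  rewrite !inE; apply: contraNneq n => /same_line E; move: z.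
  by case: E => ->; rewrite ?Xf3 //; case: (X a b l).
by case/eqP: cx; apply: (inner_unique chiP tz e i); rewrite /inside Fc z ca cb.
Qed.

(* Seen from [x], the point of [l] on [a] is extreme. *)
Lemma thru_pair l x y z a b g h : two_zero chi l (F l) x y -> two_zero chi x (F x) l z ->
  extreme chi x (F x) g h -> inside chi (F x) g h l ->
  a.1 != x.1 -> b.1 != x.1 -> a.1 != l.1 -> b.1 != l.1 -> a.1 != b.1 -> X a b l == Zer ->
  X g h a == Zer -> [set g.1; h.1] = [set a.1; b.1].
Proof.
move=> tl tx ex ix ax bx al bl ab pab gha.
have /andP[n2 n2'] := inner_npar tx ex ix.
have [_ _ n4 _ _] := extE ex; have [_ z2 _ _] := and4P ix.
have ghb : X g h b == Zer.
  have la : l.1 != a.1 by rewrite eq_sym.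
  have := X_flat chiP (x := b) (y := g) la; have := X_flat chiP (x := b) (y := h) la.
  have := X_flat chiP (x := g) (y := h) bl.
  move=> /implyP + /implyP + /implyP.
  move: gha z2 pab n2 n2' n4; signs [:: a; b; g; h; l; x].
have := thru_outer tx ex ix gha al; have := thru_outer tx ex ix ghb bl.
move=> /orP[]/eqP Eb /orP[]/eqP Ea; move: ab; rewrite Ea Eb ?eqxx // => _.
by rewrite setUC.
Qed.
End Corners.

(** * Exclusion of an eighth line *)

Section Final.
Variables (T : finType) (chi : T -> T -> T -> sg).
Hypothesis chiP : chirotope chi.
Local Notation O := (oline T).
Local Notation X := (osign chi).
Local Notation F l := (~: [set l.1]).

(** [S_dirs] without an orientation of [g], which occurs twice in each product. *)
Lemma S_inv l x y a1 c1 a2 c2 g : corner chi l x y a1 c1 a2 c2 -> others l x a1 c1 a2 c2 g ->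
  [&& sgmul (X g c1 l) (X a1 g l) == Pos, sgmul (X a1 c1 g) (X g c1 l) == Pos &
   sgmul (vsign chi l a1 c1 g) (vsign chi l a2 c2 g) == Neg].
Proof.
move=> co Sg; have [e1 e2] := (co_ext1 co, co_ext2 co).
have [_ _ n _ _] := extE e1; have [_ _ n' _ _] := extE e2.
have v0 : X a1 c1 g != Zer.
  apply/negP => /(co_x1 co); rewrite !inE.
  by case/and5P: Sg => _ /negPf-> /negPf-> /negPf-> _.
have H1 : (vsign chi l a1 c1 g == Pos) ==> [&& sgmul (X g c1 l) (X a1 c1 l) == Pos, sgmul (X a1 g l) (X a1 c1 l) == Pos &
      vsign chi l a2 c2 g == Neg].
  by apply/implyP => H; apply: (S_dirs chiP co Sg H).
have Sg' : others l x a1 c1 a2 c2 (flip g) by [].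
have H2 : (vsign chi l a1 c1 (flip g) == Pos) ==> [&& sgmul (X (flip g) c1 l) (X a1 c1 l) == Pos, sgmul (X a1 (flip g) l) (X a1 c1 l) == Pos &
      vsign chi l a2 c2 (flip g) == Neg].
  by apply/implyP => H; apply: (S_dirs chiP co Sg' H).
by move: H1 H2 v0 n n'; rewrite /vsign; signs [:: a1; c1; a2; c2; l; g].
Qed.

(** Carries the position tested by [corner_sep] in the view from [x] back to the view from [l]. *)
Lemma at_view l x y a1 c1 a2 c2 g : corner chi l x y a1 c1 a2 c2 -> others l x a1 c1 a2 c2 g ->
  sgmul (vsign chi x a2 c1 g) (vsign chi x a1 a2 g) == sgmul (vsign chi l c1 a2 g) (vsign chi l a1 c1 g).
Proof.
move=> co Sg; have /and3P[h1 h2 _] := S_inv co Sg.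
have bA := baseA co; have bx := co_framex co; have [_ _ n _ _] := extE (co_ext1 co).
by move: h1 h2 bA bx n; rewrite /vsign /framex; signs [:: a1; c1; a2; l; x; g].
Qed.

(** Being neither [x] nor [y], [s] is not lone. Its parallel [t] is also outside the six lines, and
    two distinct parallels cannot both pass through [c1 /\ a2]. *)
Lemma not_concurrent l x y a1 c1 a2 c2 s : corner chi l x y a1 c1 a2 c2 ->
  others l x a1 c1 a2 c2 s -> s.1 != y.1 ->
  (forall g, others l x a1 c1 a2 c2 g -> X c1 a2 g == Zer) -> False.
Proof.
move=> co Ss sy H; have [lF [Fx Fy xy] [ax ay] only none] := co_tz co.
have /and5P[sl sx sa1 sc1 /andP[sa2 sc2]] := Ss.
have Fs : s.1 \in F l by rewrite !inE.
have /and3P[d1 d2 _] := S_inv co Ss.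
have : ~~ lone chi l (F l) s by apply/negP => /(only _ Fs); rewrite (negPf sx) (negPf sy).
rewrite negb_forall => /existsP[t]; rewrite !negb_imply => /and3P[Ft st ts].
have tl : t.1 != l.1 by move: Ft; rewrite !inE.
have bA := baseA co; have bC := baseC co; have [_ _ n _ _] := extE (co_ext1 co).
have St : others l x a1 c1 a2 c2 t.
  rewrite /others tl /=; apply/and5P; split.
  - apply: contraTneq st => /same_line E; have := alone_par chiP ax Fs sx.
    by case: E => ->; signs [:: s; x; l].
  - by apply: contraTneq st => /same_line[]->; move: d1; signs [:: s; a1; c1; l].
  - by apply: contraTneq st => /same_line[]->; move: d1; signs [:: s; a1; c1; l].
  - by apply: contraTneq st => /same_line[]->; move: d1 bA; signs [:: s; a1; c1; l; a2].
  - by apply: contraTneq st => /same_line[]->; move: d1 bC; signs [:: s; a1; c1; l; c2].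
have Hs := H _ Ss; have Ht := H _ St.
have st' : s.1 != t.1 by rewrite eq_sym.
have := X_flat chiP (x := c1) (y := l) st'; move=> /implyP.
by move: st Hs Ht d1 d2 bA; signs [:: s; t; c1; a1; a2; l].
Qed.

Lemma orient_ext l A (x g h z : O) a b : extreme chi l A g h -> inside chi A g h x ->
  [set g.1; h.1] = [set a; b] -> a != b ->
  exists b1 b2, [/\ b1.1 = a, b2.1 = b, extreme chi l A b1 b2, inside chi A b1 b2 x &
    vsign chi l b1 b2 z = vsign chi l g h z].
Proof.
move=> e i E ab.
have Hg : g.1 \in [set a; b] by rewrite -E set21.
have Hh : h.1 \in [set a; b] by rewrite -E set22.
have Ha : a \in [set g.1; h.1] by rewrite E set21.
have Hb : b \in [set g.1; h.1] by rewrite E set22.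
have [ga|ga] := eqVneq g.1 a.
  exists g, h; split=> //; move: Hb; rewrite !inE ga => /orP[]/eqP // E'.
  by rewrite E' eqxx in ab.
exists h, g; split; [| |exact: extC'|exact: innerC|].
- by move: Ha; rewrite !inE eq_sym (negPf ga) => /eqP->.
- by move: Hg; rewrite !inE (negPf ga) => /eqP->.
- by apply: (at_pair chiP); rewrite setUC.
Qed.

(* Two lines of type (2,0) meet in an ordinary point only in the Kelly-Moser
   configuration of seven lines. *)
Lemma two_zero_card l x y z : two_zero chi l (F l) x y -> two_zero chi x (F x) l z ->
  #|T| <= 7.
Proof.
move=> tl tx.
have [a1 [c1 [a2 [c2 [[e1 i1 y1] [e2 i2 y2 pa pc]]]]]] := two_ends chiP tl.
have [g1 [h1 [g2 [h2 [[f1 j1 w1] [f2 j2 w2 _ _]]]]]] := two_ends chiP tx.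
have da := ends_disjoint chiP tl e1 i1 y1 e2 i2 y2.
have dc : X a1 c1 c2 != Zer.
  apply: (ends_disjoint chiP tl e1 i1 y1 (extC' chiP e2) (innerC chiP i2)).
  by move: y2; rewrite /vsign; signs [:: a2; c2; y; l].
have [Fa1 Fc1 n1 _ _] := extE e1; have [Fa2 Fc2 n2 _ _] := extE e2.
have a12 : a1.1 != a2.1.
  by apply: contraNneq da => /same_line[]->; signs [:: a2; c1; l].
have c12 : c1.1 != c2.1.
  by apply: contraNneq dc => /same_line[]->; signs [:: c2; a1; l].
have ac : a1.1 != c1.1 by apply: contraNneq n1 => /same_line[]->; signs [:: c1; a1; l].
have [_ _ xa1 xc1] := and4P i1; have [_ _ xa2 xc2] := and4P i2.
have [[a1l c1l] [a2l c2l]] : (a1.1 != l.1 /\ c1.1 != l.1) /\ (a2.1 != l.1 /\ c2.1 != l.1).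
  by move: Fa1 Fc1 Fa2 Fc2; rewrite !inE.
have pairs g h : extreme chi x (F x) g h -> inside chi (F x) g h l ->
    [set g.1; h.1] = [set a1.1; a2.1] \/ [set g.1; h.1] = [set c1.1; c2.1].
  move=> e i; case/orP: (view_swap chiP tl tx e1 i1 e i) => H; [left|right];
  by apply: (thru_pair chiP tl tx e i _ _ _ _ _ _ H) => //; rewrite eq_sym.
(* Seen from [x], the ends on [l] are [a1 /\ a2] and [c1 /\ c2], on different sides of [z]; [z] is
   flipped if necessary to be positive at the first. *)
have [b1 [b2 [d1 [d2 [z' [[tx' Eb1 Eb2 Ed1 Ed2] [fb jb wb fd jd]]]]]]] :
    exists b1 b2 d1 d2 z', [/\ two_zero chi x (F x) l z', b1.1 = a1.1, b2.1 = a2.1, d1.1 = c1.1 & d2.1 = c2.1] /\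
     [/\ extreme chi x (F x) b1 b2, inside chi (F x) b1 b2 l, vsign chi x b1 b2 z' == Pos,
      extreme chi x (F x) d1 d2 & inside chi (F x) d1 d2 l].
  have ne : [set g1.1; h1.1] != [set g2.1; h2.1].
    by apply: contraTneq w1 => E; rewrite (at_pair chiP x z E) (eqP w2).
  case: (pairs _ _ f1 j1) => E1; case: (pairs _ _ f2 j2) => E2.
  - by rewrite E1 E2 eqxx in ne.
  - have [b1 [b2 [? ? ? ? Hb]]] := orient_ext z f1 j1 E1 a12.
    have [d1 [d2 [? ? ? ? _]]] := orient_ext z f2 j2 E2 c12.
    by exists b1, b2, d1, d2, z; split=> //; split=> //; rewrite Hb.
  - have [b1 [b2 [? ? ? ? Hb]]] := orient_ext z f2 j2 E2 a12.
    have [d1 [d2 [? ? ? ? _]]] := orient_ext z f1 j1 E1 c12.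
    exists b1, b2, d1, d2, (flip z); split; split=> //.
      by apply: two_zeroC; apply: two_zero_flip; apply: two_zeroC.
    by rewrite /vsign Xf3 sgopp_mull; move: w2; rewrite -Hb /vsign => /eqP->.
  - by rewrite E1 E2 eqxx in ne.
(* As an extreme vertex in the view from [x], this point lies on no lines but its outer ones and
   [l]. *)
have la g : X a1 a2 g == Zer -> g.1 \in [set a1.1; a2.1; l.1].
  move=> H; rewrite !inE -Eb1 -Eb2; case: (eqVneq g.1 l.1) => [//|gl]; first by rewrite orbT.
  rewrite orbF; apply: (thru_outer chiP tx' fb jb _ gl).
  by move: H; case: (same_line Eb1) => ->; case: (same_line Eb2) => ->; signs [:: a1; a2; g].
have lc g : X c1 c2 g == Zer -> g.1 \in [set c1.1; c2.1; l.1].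
  move=> H; rewrite !inE -Ed1 -Ed2; case: (eqVneq g.1 l.1) => [//|gl]; first by rewrite orbT.
  rewrite orbF; apply: (thru_outer chiP tx' fd jd _ gl).
  by move: H; case: (same_line Ed1) => ->; case: (same_line Ed2) => ->; signs [:: c1; c2; g].
have [x' [Ex co]] := make_corner chiP tl e1 i1 y1 e2 i2 a12 c12 pa pc la lc.
have [_ zx1 _ _] := and4P i1; have [_ zx2 _ _] := and4P i2.
have [l' [El co']] : exists l', l'.1 = l.1 /\ corner chi x l' z' b1 b2 d1 d2.
  apply: (make_corner chiP tx' fb jb wb fd jd).
  - by rewrite Eb1 Ed1.
  - by rewrite Eb2 Ed2; apply: contraNneq n2 => /same_line[]->; signs [:: c2; a2; l].
  - by move: zx1; case: (same_line Eb1) => ->; case: (same_line Ed1) => ->; signs [:: a1; c1; x].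
  - by move: zx2; case: (same_line Eb2) => ->; case: (same_line Ed2) => ->; signs [:: a2; c2; x].
  - move=> g H; rewrite !inE Eb1 Ed1; case: (eqVneq g.1 x.1) => [//|gx]; first by rewrite orbT.
    rewrite orbF; apply: (thru_outer chiP tl e1 i1 _ gx).
    by move: H; case: (same_line Eb1) => ->; case: (same_line Ed1) => ->; signs [:: a1; c1; g].
  - move=> g H; rewrite !inE Eb2 Ed2; case: (eqVneq g.1 x.1) => [//|gx]; first by rewrite orbT.
    rewrite orbF; apply: (thru_outer chiP tl e2 i2 _ gx).
    by move: H; case: (same_line Eb2) => ->; case: (same_line Ed2) => ->; signs [:: a2; c2; g].
rewrite leqNgt; apply/negP => big.
pose six := [:: l.1; x.1; a1.1; c1.1; a2.1; c2.1].
(* More than seven lines leave one outside the six and different from a given [u]. *)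
have ex_other (u : T) : exists s : O, s.1 \notin six /\ s.1 != u.
  have : exists v, v \notin u :: six.
    apply/existsP; apply: contraTT big; rewrite negb_exists => /forallP H.
    rewrite -leqNgt cardE; apply: (@uniq_leq_size _ _ (u :: six) (enum_uniq _)) => v _.
    by have := H v; rewrite negbK.
  by case=> v; rewrite inE negb_or => /andP[vu v6]; exists (v, true).
have SE g : others l x' a1 c1 a2 c2 g = (g.1 \notin six).
  by rewrite /others Ex !inE !negb_or.
have SE' g : others x l' b1 b2 d1 d2 g = (g.1 \notin six).
  rewrite /others El Eb1 Eb2 Ed1 Ed2 !inE !negb_or.
  by case: (g.1 == l.1); case: (g.1 == x.1); case: (g.1 == a1.1); case: (g.1 == a2.1); case: (g.1 == c1.1); case: (g.1 == c2.1).
have [s [Ss sy]] := ex_other y.1; have [t [St tz]] := ex_other z'.1.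
have Ss1 : others l x' a1 c1 a2 c2 s by rewrite SE.
have St1 : others x l' b1 b2 d1 d2 t by rewrite SE'.
have com := corner_mirror chiP co; have com' := corner_mirror chiP co'.
have SEm g : others l (flip x') a2 c2 a1 c1 g = (g.1 \notin six).
  rewrite -SE /others; case/and5P: (isT : [&& true, true, true, true & true]) => _ _ _ _ _.
  by case: (g.1 == l.1); case: (g.1 == x'.1) => //=; case: (g.1 == a1.1); case: (g.1 == a2.1); case: (g.1 == c1.1); case: (g.1 == c2.1).
have SEm' g : others x (flip l') d1 d2 b1 b2 g = (g.1 \notin six).
  rewrite -SE' /others.
  by case: (g.1 == x.1); case: (g.1 == l'.1) => //=; case: (g.1 == b1.1); case: (g.1 == b2.1); case: (g.1 == d1.1); case: (g.1 == d2.1).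
have sep1 g h := corner_sep chiP (g := g) (h := h) co Ss1 sy.
have sep2 g h := corner_sep chiP (g := g) (h := h) com (etrans (SEm s) Ss) sy.
have sep3 g h := corner_sep chiP (g := g) (h := h) co' St1 tz.
have sep4 g h := corner_sep chiP (g := g) (h := h) com' (etrans (SEm' t) St) tz.
have atE p q p' q' g : p.1 = p'.1 -> q.1 = q'.1 -> vsign chi x p q g = vsign chi x p' q' g.
  by move=> Ep Eq; apply: (at_pair chiP); rewrite Ep Eq.
have atC m p q g : vsign chi m p q g = vsign chi m q p g.
  by apply: (at_pair chiP); rewrite setUC.
have conv g : g.1 \notin six -> [/\
    sgmul (vsign chi x a2 c1 g) (vsign chi x a1 a2 g) = sgmul (vsign chi l c1 a2 g) (vsign chi l a1 c1 g),
    sgmul (vsign chi x a1 c2 g) (vsign chi x a1 a2 g) = sgmul (vsign chi l a1 c2 g) (vsign chi l a2 c2 g),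
    sgmul (vsign chi l a1 c1 g) (vsign chi l a2 c2 g) = Neg &
    sgmul (vsign chi x a1 a2 g) (vsign chi x c1 c2 g) = Neg].
  move=> Sg; have S1 : others l x' a1 c1 a2 c2 g by rewrite SE.
  have S2 : others l (flip x') a2 c2 a1 c1 g by rewrite SEm.
  have S3 : others x l' b1 b2 d1 d2 g by rewrite SE'.
  have [/eqP V1 /eqP V2] := (at_view co S1, at_view com S2).
  have /and3P[_ _ /eqP I1] := S_inv co S1; have /and3P[_ _ /eqP I2] := S_inv co' S3.
  have flx p q p' q' : sgmul (vsign chi (flip x) p q g) (vsign chi (flip x) p' q' g) = sgmul (vsign chi x p q g) (vsign chi x p' q' g).
    by rewrite /vsign !Xf3 !sgopp_mulr sgopp_mull sgoppK.
  have {}V1 : sgmul (vsign chi x a2 c1 g) (vsign chi x a1 a2 g) = sgmul (vsign chi l c1 a2 g) (vsign chi l a1 c1 g).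
    by rewrite -V1; case: (same_line Ex) => ->; rewrite ?flx.
  have {}V2 : sgmul (vsign chi x a1 c2 g) (vsign chi x a1 a2 g) = sgmul (vsign chi l a1 c2 g) (vsign chi l a2 c2 g).
    rewrite [vsign chi l a1 c2 g]atC -V2 [vsign chi x a1 a2 g]atC.
    by case: (same_line Ex) => ->; rewrite ?flx ?flipK.
  split=> //.
  by rewrite -I2 (atE b1 b2 a1 a2) // (atE d1 d2 c1 c2).
(* At [c1 /\ a2] the line [g] has the same sign as at exactly one of the ends [a1 /\ c1],
   [a2 /\ c2], and likewise [h] at [a1 /\ c2]. Each of the four combinations is excluded by one of
   the four corners. *)
have no_sep g h : g.1 \notin six -> h.1 \notin six ->
    vsign chi l c1 a2 g != Zer -> vsign chi l a1 c2 h != Zer -> False.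
  move=> Sg Sh ng nh.
  have Sg1 : others l x' a1 c1 a2 c2 g by rewrite SE.
  have Sh1 : others l x' a1 c1 a2 c2 h by rewrite SE.
  have Sg2 : others l (flip x') a2 c2 a1 c1 g by rewrite SEm.
  have Sh2 : others l (flip x') a2 c2 a1 c1 h by rewrite SEm.
  have Sg3 : others x l' b1 b2 d1 d2 g by rewrite SE'.
  have Sh3 : others x l' b1 b2 d1 d2 h by rewrite SE'.
  have Sg4 : others x (flip l') d1 d2 b1 b2 g by rewrite SEm'.
  have Sh4 : others x (flip l') d1 d2 b1 b2 h by rewrite SEm'.
  have [q1 q2 q3 q4] := conv _ Sg; have [k1 k2 k3 k4] := conv _ Sh.
  move: (sep1 _ _ Sg1 Sh1) (sep2 _ _ Sh2 Sg2) (sep3 _ _ Sg3 Sh3) (sep4 _ _ Sh4 Sg4).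
  rewrite (atC l c2 a1) (atC l a2 c1) (atE b2 d1 a2 c1) // (atE b1 d2 a1 c2) //.
  rewrite (atE b1 b2 a1 a2) // (atE b1 b2 a1 a2) // (atE d2 b1 c2 a1) // (atE d1 d2 c1 c2) // (atE d1 b2 c1 a2) // (atE d1 d2 c1 c2) //.
  rewrite (atC x c2 a1) (atC x c1 a2).
  move: q1 q2 q3 q4 k1 k2 k3 k4 ng nh.
  case: (vsign chi l c1 a2 g) => //; case: (vsign chi l a1 c2 h) => //;
  case: (vsign chi l a1 c1 g) => //; case: (vsign chi l a1 c1 h) => //;
  case: (vsign chi l a2 c2 g) => //; case: (vsign chi l a2 c2 h) => //;
  case: (vsign chi x a1 a2 g) => //; case: (vsign chi x c1 c2 g) => //;
  case: (vsign chi x a1 a2 h) => //; case: (vsign chi x c1 c2 h) => //;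
  case: (vsign chi x a2 c1 g) => //; case: (vsign chi x a1 c2 h) => //=;
  by move=> *; auto.
(* So all remaining lines pass through [a1 /\ c2], or all pass through [c1 /\ a2]. *)
case: (boolP [exists g : O, (g.1 \notin six) && (vsign chi l c1 a2 g != Zer)]) => [/existsP[g /andP[Sg ng]]|].
  apply: (not_concurrent com (etrans (SEm s) Ss) sy) => h; rewrite SEm => Sh.
  apply/negPn/negP => nh; apply: (no_sep g h Sg Sh ng).
  by move: nh n1 (co_frame com); rewrite /vsign /frame; signs [:: a1; c1; a2; c2; l; h].
rewrite negb_exists => /forallP Hg.
apply: (not_concurrent co Ss1 sy) => h; rewrite SE => Sh.
have := Hg h; rewrite Sh /= negbK; move: (co_frame co).
by rewrite /vsign /frame; signs [:: a1; c1; a2; c2; l; h].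
Qed.

End Final.

(** * The Csima-Sawyer inequality *)

Section Counting.
Variables (T : finType) (chi : T -> T -> T -> sg).
Hypothesis chiP : chirotope chi.
Local Notation O := (oline T).
Local Notation X := (osign chi).

Definition ordinary (P : {set T}) : bool :=
  (#|P| == 2) && [forall a in P, forall b in P, forall c, (a != b) && (c \notin P) ==> (chi a b c != Zer)].

Definition ordinaries : {set {set T}} := [set P | ordinary P].

Definition pos (t : T) : O := (t, true).

(* With [l] at infinity, the ordinary point [P] is an extreme vertex. *)
Definition attached (l : T) (P : {set T}) : bool :=
  [exists a : O, exists b : O, (P == [set a.1; b.1]) && oextreme chi (pos l) (~: [set l]) a b].

Definition mu l := #|[set P in ordinaries | l \in P]|.
Definition nu l := #|[set P in ordinaries | attached l P]|.

Definition partners l : {set T} :=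
  [set x | (x != l) && lone chi (pos l) (~: [set l]) (pos x)].

Lemma chi_eq0 (a b c : O) : (X a b c == Zer) = (chi a.1 b.1 c.1 == Zer).
Proof.
have o0 u z : (orient u z == Zer) = (z == Zer) by case: u; case: z.
by rewrite /osign !o0.
Qed.

Lemma chi_perm0 a b c : (chi b a c == Zer) = (chi a b c == Zer).
Proof. by rewrite (chi12 chiP); case: (chi a b c). Qed.

Lemma chi_perm0' a b c : (chi a c b == Zer) = (chi a b c == Zer).
Proof. by rewrite (chi23 chiP); case: (chi a b c). Qed.

Lemma ordinary2 a b : a != b ->
  ordinary [set a; b] = [forall c, (c != a) && (c != b) ==> (chi a b c != Zer)].
Proof.
move=> ab; rewrite /ordinary cards2 ab /=.
apply/idP/idP => [/forall_inP/(_ a)|/forallP H].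
  rewrite set21 => /(_ isT)/forall_inP/(_ b); rewrite set22 => /(_ isT)/forallP H.
  by apply/forallP => c; have := H c; rewrite ab !inE negb_or.
apply/forall_inP => u uP; apply/forall_inP => v vP; apply/forallP => c; apply/implyP => /andP[uv].
rewrite !inE negb_or => cP; have := implyP (H c) cP.
move: uP vP uv; rewrite !inE => /orP[]/eqP-> /orP[]/eqP->; rewrite ?eqxx //.
by rewrite chi_perm0.
Qed.

Lemma ordinaryE l x : x != l -> ordinary [set l; x] = (x \in partners l).
Proof.
move=> xl; rewrite ordinary2 1?eq_sym // inE xl /=; apply/forallP/forallP => H d.
  apply/implyP => Fd; apply/implyP; rewrite chi_eq0 /= => z; apply/negPn/negP => dx.
  have := H d.1; rewrite dx; move: Fd; rewrite !inE => -> /=.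
  by rewrite chi_perm0' -chi_perm0 chi_perm0' -chi_perm0 z.
apply/implyP => /andP[dl dx]; have := H (pos d).
rewrite !inE dl (negPf dx) chi_eq0 implybF /= -chi_perm0 chi_perm0' -chi_perm0.
by rewrite chi_perm0' -chi_perm0.
Qed.

Lemma mu_partners l : mu l = #|partners l|.
Proof.
rewrite /mu -(card_in_imset (f := fun x => [set l; x]) (D := partners l)).
  congr #|pred_of_set _|; apply/setP => P; rewrite inE.
  apply/idP/imsetP => [/andP[oP lP]|[x xl ->]].
    have /andP[/cards2P[u [v [uv EP]]] _] : ordinary P by rewrite inE in oP.
    have [w wl Ew] : exists2 w, w != l & P = [set l; w].
      move: lP; rewrite EP !inE => /orP[]/eqP->; first by exists v; rewrite 1?eq_sym.
      by exists u => //; rewrite setUC.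
    exists w => //; rewrite -ordinaryE // -Ew; by rewrite inE in oP.
  by rewrite set21 andbT inE ordinaryE //; move: xl; rewrite inE => /andP[].
move=> x y; rewrite !inE => /andP[xl _] /andP[yl _] E.
have : x \in [set l; y] by rewrite -E set22.
by rewrite !inE (negPf xl) => /eqP.
Qed.

Lemma oext_ordinary l (a b : O) : oextreme chi (pos l) (~: [set l]) a b -> ordinary [set a.1; b.1].
Proof.
move=> /andP[e /forallP H]; have [Fa Fb n _ _] := extE e.
rewrite ordinary2.
  apply/forallP => c; apply/implyP => /andP[ca cb].
  have := H (pos c); rewrite !inE chi_eq0 /=.
  have [->|cl] := eqVneq c l; first by move: n; rewrite chi_eq0.
  by rewrite (negPf ca) (negPf cb) /= implybF.
apply: contraNneq n => /same_line[]->; signs [:: b; pos l; a].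
Qed.

Lemma oext_nu l (a b : O) : oextreme chi (pos l) (~: [set l]) a b ->
  [set a.1; b.1] \in [set P in ordinaries | attached l P].
Proof.
move=> o; rewrite !inE (oext_ordinary o); apply/existsP; exists a; apply/existsP; exists b.
by rewrite eqxx.
Qed.

Lemma partners_alone l (d : O) : d.1 \in ~: [set l] -> lone chi (pos l) (~: [set l]) d ->
  d.1 \in partners l.
Proof.
rewrite !inE => -> /=; by rewrite (@alone1 _ _ _ _ d (pos d.1)).
Qed.

Hypothesis big : 1 < #|T|.

Lemma ext_ex l : exists p q, extreme chi (pos l) (~: [set l]) p q.
Proof.
have [a al] : exists a, a != l.
  have /card_gt1P[u [v [_ _ uv]]] := big.
  by have [E|ne] := eqVneq u l; [exists v; rewrite -E eq_sym | exists u].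
have [c n] := chi_simple chiP al.
have n' : X (pos a) (pos c) (pos l) != Zer by rewrite chi_eq0 /= chi_perm0'.
apply: (ext_exists chiP _ _ n'); rewrite !inE //=.
by apply: contraNneq n => ->; have := chi23 chiP a l l; case: (chi a l l).
Qed.

Lemma nu_mu0 l : mu l = 0 -> 2 < nu l.
Proof.
rewrite mu_partners => /eqP; rewrite cards_eq0 => /eqP P0.
have lF : (pos l).1 \notin ~: [set l] by rewrite !inE eqxx.
have [p [q epq]] := ext_ex l.
have Hn d : d.1 \in ~: [set l] -> ~~ lone chi (pos l) (~: [set l]) d.
  by move=> Fd; apply/negP => /(partners_alone Fd); rewrite P0 inE.
have [p1 [q1 [p2 [q2 [o0 o1 o2 [n1 n2 n3]]]]]] := three_oext chiP lF Hn epq.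
have := oext_nu o2; have := oext_nu o1; have := oext_nu o0.
set A := [set p.1; _]; set B := [set p1.1; _]; set C := [set p2.1; _] => HA HB HC.
apply: (leq_trans _ (subset_leq_card (_ : [set A; B; C] \subset _))).
  by rewrite setUC cardsU1 cards2 n1 !inE negb_or ![C == _]eq_sym n2 n3.
by apply/subsetP => P; rewrite !inE => /orP[/orP[]|] /eqP->; move: HA HB HC; rewrite !inE.
Qed.

Lemma nu_mu1 l : mu l = 1 -> 1 < nu l.
Proof.
rewrite mu_partners => /eqP/cards1P[x Px].
have lF : (pos l).1 \notin ~: [set l] by rewrite !inE eqxx.
have [p [q epq]] := ext_ex l.
have Hn d : d.1 \in ~: [set l] -> lone chi (pos l) (~: [set l]) d -> d.1 = x.
  by move=> Fd /(partners_alone Fd); rewrite Px inE => /eqP.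
have [p1 [q1 [p2 [q2 [o1 o2 n]]]]] := two_oext chiP lF Hn epq.
have := oext_nu o2; have := oext_nu o1.
set B := [set p1.1; _]; set C := [set p2.1; _] => HB HC.
apply: (leq_trans _ (subset_leq_card (_ : [set B; C] \subset _))).
  by rewrite cards2 n.
by apply/subsetP => P; rewrite !inE => /orP[] /eqP->; move: HB HC; rewrite !inE.
Qed.

Lemma mu2_two_zero l : mu l = 2 -> nu l = 0 -> forall x, x \in partners l ->
  exists y, two_zero chi (pos l) (~: [set l]) (pos x) (pos y).
Proof.
move=> Hmu Hnu x xl.
have [y Ey] : exists y, partners l = [set x; y] /\ x != y.
  move: Hmu; rewrite mu_partners => /eqP/cards2P[u [v [uv E]]].
  move: xl; rewrite E !inE => /orP[]/eqP->; first by exists v.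
  by exists u; rewrite setUC eq_sym.
exists y; have [E xy] := Ey.
have yl : y \in partners l by rewrite E set22.
move: xl yl; rewrite !inE => /andP[xl ax] /andP[yl ay]; split=> //=.
- by rewrite !inE eqxx.
- by rewrite !inE.
- by move=> d Fd /(partners_alone Fd); rewrite E !inE.
- move=> a b; apply/negP => /oext_nu H.
  by move: Hnu => /eqP; rewrite cards_eq0 => /eqP N; rewrite N inE in H.
Qed.

Lemma attached_le4 P : P \in ordinaries -> #|[set l | attached l P]| <= 4.
Proof.
rewrite inE => /andP[/cards2P[u [v [uv EP]]] _].
(* Reversing [l] amounts to reversing both [u] and [v]. This normalisation makes the sectors found
   for different lines at infinity comparable. *)
pose side l := X (pos u) (pos v) (pos l) == Pos.
pose turn (b : bool) (c : O) := if b then c else flip c.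
pose dir l (s t : bool) := (turn (s == side l) (pos u), turn (t == side l) (pos v)).
pose R l (i : bool * bool) := oextreme chi (pos l) (~: [set l]) (dir l i.1 i.2).1 (dir l i.1 i.2).2.
have exR l : attached l P -> exists i, R l i.
  move=> /existsP[a /existsP[b /andP[/eqP Eab o]]].
  have [e _] := andP o; have [Fa Fb n _ _] := extE e.
  have [a' [b' [ua vb o']]] : exists a' b', [/\ a'.1 = u, b'.1 = v & oextreme chi (pos l) (~: [set l]) a' b'].
    have oC : oextreme chi (pos l) (~: [set l]) b a.
      rewrite /oextreme (extC' chiP e) /=; have /andP[_ /forallP H] := o.
      apply/forallP => c; have := H c; rewrite orbC; case: (c.1 \in _) => //=.
      by rewrite !chi_eq0 chi_perm0.
    have ne : a.1 != b.1 by apply: contraNneq n => /same_line[]->; signs [:: b; pos l; a].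
    have : a.1 \in [set u; v] by rewrite -EP Eab set21.
    have : b.1 \in [set u; v] by rewrite -EP Eab set22.
    rewrite !inE => /orP[]/eqP Eb /orP[]/eqP Ea; try by [exists a, b | exists b, a].
      by rewrite Ea Eb eqxx in ne.
    by rewrite Ea Eb eqxx in ne.
  case: a' b' ua vb o' => [a' s] [b' t] /= -> -> o'.
  exists (s == side l, t == side l); rewrite /R /dir /=.
  by move: o'; case: (side l); case: s; case: t.
(* In a common sector [l'] may not come before [l], nor [l] before [l']. *)
have injR l l' i : R l i -> R l' i -> l = l'.
  case: i => s t; rewrite /R /dir /= => /andP[e _] /andP[e' _].
  apply/eqP/negPn/negP => ll'.
  have [Fa Fb n r1 [r2 _]] := extE e; have [Fa' Fb' n' r1' [r2' _]] := extE e'.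
  have Fl : (pos l').1 \in ~: [set l] by rewrite !inE eq_sym.
  have Fl' : (pos l).1 \in ~: [set l'] by rewrite !inE.
  have pll : (pos l).1 != (pos l').1 by [].
  have := X_flat chiP (x := pos u) (y := pos v) pll; move=> /implyP.
  move: n n' (rayP r1 Fl) (rayP r2 Fl) (rayP r1' Fl') (rayP r2' Fl').
  have [h1|h1] := boolP (side l); have [h2|h2] := boolP (side l');
  rewrite /side in h1 h2; move: h1 h2; case: s {e e' Fa Fb Fa' Fb' r1 r2 r1' r2'};
  case: t; rewrite /turn /=; signs [:: pos u; pos v; pos l; pos l'].
(* The default is never taken on attached lines. *)
pose f l := if [pick i | R l i] is Some i then i else (true, true).
have fP l : attached l P -> R l (f l).
  by move=> /exR[i Ri]; rewrite /f; case: pickP => [//|/(_ i)]; rewrite Ri.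
rewrite -(card_in_imset (f := f)); first by rewrite (leq_trans (max_card _)) // card_prod card_bool.
move=> l l'; rewrite !inE => /fP Rl /fP Rl' E; apply: injR Rl _; by rewrite E.
Qed.

Lemma sum_incidence (A : {set T}) (R : T -> {set T} -> bool) :
  \sum_(l in A) #|[set P in ordinaries | R l P]| =
  \sum_(P in ordinaries) #|[set l in A | R l P]|.
Proof.
transitivity (\sum_(l in A) \sum_(P in ordinaries) R l P).
  by apply: eq_bigr => l _; rewrite -sum1dep_card big_mkcondr; apply: eq_bigr => P _; case: (R l P).
rewrite exchange_big; apply: eq_bigr => P _.
by rewrite -sum1dep_card [RHS]big_mkcondr; apply: eq_bigr => l _; case: (R l P).
Qed.

Theorem six_thirteenths : 7 < #|T| -> 6 * #|T| <= 13 * #|ordinaries|.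
Proof.
move=> T8; pose K := [set l | (mu l == 2) && (nu l == 0)].
have allT f : \sum_l f l = \sum_(l in [set: T]) f l by apply: eq_bigl => l; rewrite inE.
have Hmu : \sum_l mu l = 2 * #|ordinaries|.
  rewrite allT /mu (sum_incidence setT (fun l P => l \in P)) mulnC -sum_nat_const.
  apply: eq_bigr => P; rewrite inE => /andP[/eqP <- _]; congr #|pred_of_set _|.
  by apply/setP => l; rewrite !inE.
have Hnu : \sum_l nu l <= 4 * #|ordinaries|.
  rewrite allT /nu (sum_incidence setT attached) mulnC -sum_nat_const.
  apply: leq_sum => P /attached_le4; congr (_ <= _); congr #|pred_of_set _|.
  by apply/setP => l; rewrite !inE.
have HK : 2 * #|K| <= #|ordinaries|.
  rewrite mulnC -sum_nat_const.
  have -> : \sum_(l in K) 2 = \sum_(l in K) mu l.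
    by apply: eq_bigr => l; rewrite inE => /andP[/eqP->].
  rewrite /mu (sum_incidence K (fun l P => l \in P)) -sum1_card.
  apply: leq_sum => P oP; rewrite leqNgt; apply/negP => /card_gt1P[l [x []]].
  rewrite !inE => /andP[/andP[/eqP ml /eqP nl] lP] /andP[/andP[/eqP mx /eqP nx] xP] lx.
  have EP : P = [set l; x].
    apply/esym/eqP; rewrite eqEcard cards2 lx; move: oP; rewrite inE => /andP[/eqP-> _].
    by rewrite leqnn andbT; apply/subsetP => u; rewrite !inE => /orP[]/eqP->.
  have xl : x \in partners l by rewrite -ordinaryE 1?eq_sym // -EP; rewrite inE in oP.
  have lx' : l \in partners x by rewrite -ordinaryE // setUC -EP; rewrite inE in oP.
  have [y ty] := mu2_two_zero ml nl xl; have [z tz] := mu2_two_zero mx nx lx'.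
  by have := two_zero_card chiP ty tz; rewrite leqNgt T8.
have H3 : 3 * #|T| <= \sum_l (mu l + nu l) + #|K|.
  have -> : 3 * #|T| = \sum_(l : T) 3 by rewrite sum_nat_const mulnC.
  have -> : #|K| = \sum_l (if (mu l == 2) && (nu l == 0) then 1 else 0).
    by rewrite -big_mkcond sum1dep_card.
  rewrite -big_split /=.
  apply: leq_sum => l _.
  have := @nu_mu0 l; have := @nu_mu1 l; case: (mu l) => [|[|[|m]]] H1 H0.
  - by have := H0 erefl; lia.
  - by have := H1 erefl; lia.
  - by rewrite eqxx; case: eqP => /=; lia.
  - by lia.
move: H3 Hnu HK; rewrite big_split /= Hmu.
by move: (\sum_l nu l) #|ordinaries| #|K| #|T| => s m k t; lia.
Qed.

End Counting.

(** * Circuits and signed circuits *)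

Section Matroid.
Variables (E : finType) (M : matroid E).
Implicit Types (I J A : {set E}).

Lemma indepP I : reflect (forall C, C \in circuits M -> ~~ (C \subset I)) (indep M I).
Proof. exact: forall_inP. Qed.

Lemma depP I : reflect (exists2 C, C \in circuits M & C \subset I) (~~ indep M I).
Proof.
rewrite /indep negb_forall_in; apply: (iffP exists_inP) => -[C CM H]; exists C => //.
  by rewrite negbK in H.
by rewrite negbK.
Qed.

Lemma indepS I J : I \subset J -> indep M J -> indep M I.
Proof.
by move=> sIJ /indepP iJ; apply/indepP => C CM; apply: contra (iJ C CM) => /subset_trans; apply.
Qed.

Lemma indep0 : indep M set0.
Proof.
apply/indepP => C CM; rewrite subset0; apply: contraNneq (circuit_neq0 M) => <-.
exact: CM.
Qed.

Lemma circuit_unique I e C D : indep M I -> C \in circuits M -> D \in circuits M ->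
  C \subset e |: I -> D \subset e |: I -> C = D.
Proof.
move=> /indepP iI CM DM sC sD; apply/eqP/negPn/negP => /eqP ne.
have mem (B : {set E}) : B \in circuits M -> B \subset e |: I -> e \in B.
  move=> BM sB; apply: contraR (iI B BM) => eB; apply/subsetP => u uB.
  by move: (subsetP sB u uB); rewrite !inE => /predU1P[E'|//]; rewrite -E' uB in eB.
have eCD : e \in C :&: D by rewrite inE !mem.
have [Z ZM sZ] := circuit_elimination CM DM ne eCD.
move/negP: (iI Z ZM); apply; apply: subset_trans sZ _.
apply/subsetP => u; rewrite !inE => /andP[ue]; rewrite -in_setU => uCD.
have sCD : C :|: D \subset e |: I by rewrite subUset sC.
by have := subsetP sCD u uCD; rewrite !inE (negPf ue).
Qed.

(** Among the independent subsets of the union larger than [I], take [K] with [I :\: K] smallest. If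
    [e] in [I] is missing from [K], exchanging any [f] of [K :\: I] for [e] must create a circuit
    avoiding [f]. All these circuits lie in [e |: K], so they coincide and avoid [K :\: I], which
    puts a circuit inside [I]. *)
Lemma augment I J : indep M I -> indep M J -> #|I| < #|J| ->
  exists2 e, e \in J :\: I & indep M (e |: I).
Proof.
move=> iI iJ ltIJ.
case: (boolP [exists e in J :\: I, indep M (e |: I)]) => [/exists_inP[e]|]; first by exists e.
rewrite negb_exists_in => /forall_inP noaug.
pose P (K : {set E}) := [&& indep M K, K \subset I :|: J & #|I| < #|K|].
have PJ : P J by rewrite /P iJ ltIJ subsetUr.
case: (arg_minnP (fun K : {set E} => #|I :\: K|) PJ) => K /and3P[iK sK ltIK] Kmin.
have [e eIK] : exists e, e \in I :\: K.
  apply/set0Pn; apply/negP; rewrite setD_eq0 => sIK.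
  have [f fKI] : exists f, f \in K :\: I.
    by apply/set0Pn; rewrite setD_eq0; apply: contraL ltIK => /subset_leq_card; rewrite -leqNgt.
  have fJ : f \in J :\: I.
    move: fKI; rewrite !inE => /andP[fI fK]; rewrite fI /=.
    by move: (subsetP sK f fK); rewrite inE (negPf fI).
  move/negP: (noaug f fJ); apply; apply: indepS iK.
  by rewrite subUset sub1set sIK andbT; move: fKI; rewrite inE => /andP[].
have [eI eK] : e \in I /\ e \notin K by move: eIK; rewrite inE => /andP[].
have exC f : f \in K :\: I -> exists2 C, C \in circuits M & [&& C \subset e |: K, f \notin C & e \in C].
  rewrite inE => /andP[fI fK].
  have /depP[C CM sC] : ~~ indep M ((e |: K) :\ f).
    apply/negP => iT; have := Kmin ((e |: K) :\ f).
    have -> : P ((e |: K) :\ f).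
      rewrite /P iT /=; apply/andP; split.
        apply/subsetP => u; rewrite !inE => /andP[_ /predU1P[->|uK]]; first by rewrite eI.
        by move: (subsetP sK u uK); rewrite inE.
      have -> : #|(e |: K) :\ f| = #|K|; last by [].
      apply: succn_inj; rewrite -add1n.
      have -> : 1 + #|(e |: K) :\ f| = #|e |: K| by rewrite [RHS](cardsD1 f) !inE fK orbT.
      by rewrite cardsU1 eK.
    move/(_ isT); rewrite leqNgt => /negP; apply; apply: proper_card; apply/properP; split.
      apply/subsetP => u; rewrite !inE => /andP[H uI]; rewrite uI andbT.
      apply: contra H => uK; rewrite uK orbT andbT; by apply: contraNneq fI => <-.
    exists e; first by rewrite !inE eI eK.
    by rewrite !inE eqxx eI /= !andbT negbK; apply: contraNneq fI => <-.
  exists C => //; apply/and3P; split.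
  - by apply: subset_trans sC _; apply: subD1set.
  - by apply/negP => /(subsetP sC); rewrite !inE eqxx.
  - apply: contraT => eC; move/indepP: iK => /(_ C CM)/negP[].
    apply/subsetP => u uC; move: (subsetP sC u uC); rewrite !inE => /andP[_ /predU1P[E'|//]].
    by rewrite -E' uC in eC.
have [g gKI] : exists g, g \in K :\: I.
  by apply/set0Pn; rewrite setD_eq0; apply: contraL ltIK => /subset_leq_card; rewrite -leqNgt.
have [C CM /and3P[sC gC eC]] := exC g gKI.
have [h hC hKI] : exists2 h, h \in C & h \in K :\: I.
  have := indepP _ iI C CM; rewrite subsetE => /pred0Pn[h /andP[hI hC]].
  exists h => //; rewrite inE hI /=; move: (subsetP sC h hC); rewrite !inE.
  by case/predU1P=> // E'; rewrite E' eI in hI.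
have [D DM /and3P[sD hD eD]] := exC h hKI.
have := circuit_unique iK CM DM sC sD => E'.
by rewrite -E' hC in hD.
Qed.

Lemma rk_indep I A : I \subset A -> indep M I -> #|I| <= rk M A.
Proof. by move=> sIA iI; apply: (leq_bigmax_cond (F := fun I : {set E} => #|I|)); rewrite sIA. Qed.

Lemma rkP A : exists I, [/\ I \subset A, indep M I & rk M A = #|I|].
Proof.
have H : 0 < #|[pred I : {set E} | (I \subset A) && indep M I]|.
  by apply/card_gt0P; exists set0; rewrite inE sub0set indep0.
have [I /andP[sI iI] E'] := eq_bigmax_cond (fun I : {set E} => #|I|) H.
by exists I; split=> //; rewrite -E'; apply: eq_bigl => J; rewrite inE.
Qed.

Lemma indep_card I : indep M I -> #|I| <= mrank M.
Proof. by apply: rk_indep; apply: subsetT. Qed.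

Lemma indep_extend I : indep M I -> exists2 B : {set E}, I \subset B & indep M B && (#|B| == mrank M).
Proof.
move: {2}(mrank M - #|I|) (leqnn (mrank M - #|I|)) => n.
elim: n I => [|n IH] I Hn iI.
  by exists I => //; rewrite iI eqn_leq indep_card //= -subn_eq0 -leqn0.
have [E'|ne] := eqVneq #|I| (mrank M); first by exists I => //; rewrite iI E' /=.
have lt : #|I| < mrank M by rewrite ltn_neqAle ne indep_card.
have [J [_ iJ EJ]] := rkP [set: E].
have [|e eJ ie] := augment iI iJ; first by rewrite -EJ.
have [|B sB HB] := IH _ _ ie.
  move: eJ; rewrite inE => /andP[eI _]; rewrite cardsU1 eI.
  by lia.
by exists B => //; apply: subset_trans sB; apply: subsetUr.
Qed.

End Matroid.

Section Signs.
Variable E : finType.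
Implicit Types (X Y Z : signed_set E) (I W : {set E}) (e u v : E).

Definition sgn (X : signed_set E) (u : E) : sg :=
  if u \in X.1 then Pos else if u \in X.2 then Neg else Zer.

Lemma sgn_eq0 X u : (sgn X u == Zer) = (u \notin support X).
Proof. by rewrite /sgn inE; case: (u \in X.1); case: (u \in X.2). Qed.

Lemma sgn_sopp X u : [disjoint X.1 & X.2] -> sgn (sopp X) u = sgopp (sgn X u).
Proof.
move=> dX; rewrite /sgn /=; case X1: (u \in X.1); last by case: (u \in X.2).
by rewrite (disjointFr dX X1).
Qed.

Variable M : oriented_matroid E.

Lemma dependent_circuit (I : {set E}) : ~~ indep (underlying M) I ->
  exists2 X, X \in scircuits M & support X \subset I.
Proof. by move=> /depP[C /imsetP[X XM ->] sX]; exists X. Qed.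

Lemma indep_circuit (I : {set E}) X : indep (underlying M) I ->
  X \in scircuits M -> ~~ (support X \subset I).
Proof. by move=> /indepP iI XM; apply: iI; apply: imset_f. Qed.

(** The signed circuit is unique up to a global sign, which cancels in a product of two entries. *)
Lemma scircuit_unique (I : {set E}) e X Y u v : indep (underlying M) I ->
  X \in scircuits M -> Y \in scircuits M ->
  support X \subset e |: I -> support Y \subset e |: I ->
  sgmul (sgn X u) (sgn X v) = sgmul (sgn Y u) (sgn Y v).
Proof.
move=> iI XM YM sX sY.
have := circuit_unique iI (imset_f (@support E) XM) (imset_f (@support E) YM) sX sY.
move=> EXY; have := scircuit_incomparable XM YM; rewrite EXY => /(_ (subxx _))[->//|->].
rewrite !sgn_sopp ?(scircuit_disjoint YM) //.
by case: (sgn Y u); case: (sgn Y v).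
Qed.

Lemma eliminate X Y e : X \in scircuits M -> Y \in scircuits M ->
  support X != support Y -> sgn X e != Zer -> sgn Y e = sgopp (sgn X e) ->
  exists Z, [/\ Z \in scircuits M, sgn Z e = Zer &
    forall u, sgn Z u != Zer -> sgn Z u = sgn X u \/ sgn Z u = sgn Y u].
Proof.
move=> XM YM ne Xe Ye.
have opp (X' Y' : signed_set E) : X' = sopp Y' -> support X' = support Y'.
  by move=> ->; rewrite support_sopp.
have neXY : X <> sopp Y by move/opp/eqP; rewrite (negPf ne).
have neYX : Y <> sopp X by move/opp/esym/eqP; rewrite (negPf ne).
have conclude (U V Z : signed_set E) : U \in scircuits M -> V \in scircuits M -> Z \in scircuits M ->
    Z.1 \subset (U.1 :|: V.1) :\ e -> Z.2 \subset (U.2 :|: V.2) :\ e ->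
    sgn Z e = Zer /\ forall u, sgn Z u != Zer -> sgn Z u = sgn U u \/ sgn Z u = sgn V u.
  move=> UM VM ZM sZ1 sZ2; split.
    apply/eqP; rewrite sgn_eq0 /support; apply/negP => /setUP[/(subsetP sZ1)|/(subsetP sZ2)];
      by rewrite !inE eqxx.
  have pos (W : signed_set E) u : u \in W.1 -> sgn W u = Pos by rewrite /sgn => ->.
  have neg (W : signed_set E) u : W \in scircuits M -> u \in W.2 -> sgn W u = Neg.
    by move=> WM W2; rewrite /sgn W2 (disjointFl (scircuit_disjoint WM) W2).
  move=> u; rewrite sgn_eq0 negbK => /setUP[] uZ; [move/(subsetP sZ1): (uZ)|move/(subsetP sZ2): (uZ)];
    rewrite !inE => /andP[_ /orP[]] u12.
  - by left; rewrite !pos.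
  - by right; rewrite !pos.
  - by left; rewrite !neg.
  - by right; rewrite !neg.
move: Xe Ye; rewrite {1 3}/sgn; case: ifP => [X1 _|_].
  move=> Ye; have Y2 : e \in Y.2 by move: Ye; rewrite /sgn; case: ifP => //; case: ifP.
  have [|Z ZM /andP[sZ1 sZ2]] := scircuit_elimination (e := e) XM YM neXY; first by rewrite inE X1.
  by have [] := conclude X Y Z XM YM ZM sZ1 sZ2; exists Z.
case: ifP => // X2 _ Ye; have Y1 : e \in Y.1 by move: Ye; rewrite /sgn; case: ifP => //; case: ifP.
have [|Z ZM /andP[sZ1 sZ2]] := scircuit_elimination (e := e) YM XM neYX; first by rewrite inE Y1.
have [Ze Zu] := conclude Y X Z YM XM ZM sZ1 sZ2; exists Z; split=> // u uZ.
by have [] := Zu u uZ; [right|left].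
Qed.

(** The sign [c] rescales [Y] so that it is opposite to [X] at [e]. *)
Lemma eliminate_sign X Y e : X \in scircuits M -> Y \in scircuits M ->
  support X != support Y -> sgn X e != Zer -> sgn Y e != Zer ->
  exists Z c, [/\ Z \in scircuits M, support Z \subset (support X :|: support Y) :\ e, c != Zer,
    sgmul c (sgn Y e) = sgopp (sgn X e) &
    forall u, sgn Z u != Zer -> sgn Z u = sgn X u \/ sgn Z u = sgmul c (sgn Y u)].
Proof.
move=> XM YM ne Xe Ye.
have sub Z c : sgn Z e = Zer ->
    (forall u, sgn Z u != Zer -> sgn Z u = sgn X u \/ sgn Z u = sgmul c (sgn Y u)) ->
    support Z \subset (support X :|: support Y) :\ e.
  move=> Ze ZP; apply/subsetP => u uZ; rewrite in_setD1 in_setU; apply/andP; split.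
    by apply: contraTneq uZ => ->; rewrite -sgn_eq0 Ze.
  have Zu : sgn Z u != Zer by rewrite sgn_eq0 negbK.
  rewrite -[_ \in support X]negbK -[_ \in support Y]negbK -!sgn_eq0 -negb_and.
  apply: contra Zu => /andP[/eqP X0 /eqP Y0].
  have c0 : sgmul c Zer = Zer by case: (c).
  by have := ZP u; rewrite X0 Y0 c0; case: (sgn Z u) => // /(_ isT)[].
have [E'|NE] := eqVneq (sgn Y e) (sgn X e).
  have Y'M := scircuit_sym YM.
  have [||Z [ZM Ze ZP]] := eliminate XM Y'M _ Xe.
  - by rewrite support_sopp.
  - by rewrite sgn_sopp ?(scircuit_disjoint YM) // E'.
  have {}ZP u : sgn Z u != Zer -> sgn Z u = sgn X u \/ sgn Z u = sgmul Neg (sgn Y u).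
    by move=> /ZP; rewrite sgn_sopp ?(scircuit_disjoint YM).
  by exists Z, Neg; split=> //; [apply: sub ZP | rewrite E'].
have E' : sgn Y e = sgopp (sgn X e) by move: Xe Ye NE; case: (sgn X e); case: (sgn Y e).
have [Z [ZM Ze ZP]] := eliminate XM YM ne Xe E'.
by exists Z, Pos; split=> //; apply: (sub Z Pos).
Qed.

End Signs.

(** * The chirotope of a contraction *)

Section Bases.
Variables (E : finType) (M : oriented_matroid E).
Implicit Types (X Y Z : signed_set E) (A B I W : {set E}) (e f g u v x y z : E) (s t w : seq E).
Local Notation N := (underlying M).
Local Notation r := (mrank N).

Definition base B := indep N B && (#|B| == r).

Lemma circuit_exists W f g : base (f |: W) -> base (g |: W) ->
  f != g -> f \notin W -> g \notin W ->
  exists2 X, X \in scircuits M & support X \subset f |: (g |: W).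
Proof.
move=> _ /andP[_ /eqP cW] fg fW gW; apply: dependent_circuit.
apply/negP => /indep_card; rewrite cardsU1 cW !inE negb_or fg fW /=; lia.
Qed.

Lemma circuit_mem W f g X : base (g |: W) -> X \in scircuits M ->
  support X \subset f |: (g |: W) -> sgn X f != Zer.
Proof.
move=> /andP[iW _] XM sX; rewrite sgn_eq0 negbK; apply: contraR (indep_circuit iW XM) => fX.
apply/subsetP => u uX; move: (subsetP sX u uX); rewrite in_setU1 => /predU1P[E'|//].
by rewrite -E' uX in fX.
Qed.

Lemma circuit_mem2 W f g X : base (f |: W) -> X \in scircuits M ->
  support X \subset f |: (g |: W) -> sgn X g != Zer.
Proof. by move=> bW XM; rewrite setUCA; apply: circuit_mem. Qed.

Lemma base_exchange W f g X : base (g |: W) -> g \notin W ->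
  X \in scircuits M -> support X \subset f |: (g |: W) ->
  sgn X g != Zer -> base (f |: W).
Proof.
move=> /andP[iW cW] gW XM sX; rewrite sgn_eq0 negbK => gX.
have fgW : f \notin g |: W.
  apply: contra (indep_circuit iW XM) => fgW; apply: subset_trans sX _.
  by rewrite subUset sub1set fgW subxx.
have [fg fW] : f != g /\ f \notin W by move: fgW; rewrite !inE negb_or => /andP[].
rewrite /base cardsU1 fW -(eqP cW) cardsU1 gW eqxx andbT.
apply: contraT => /dependent_circuit[Y YM sY].
have sY' : support Y \subset f |: (g |: W) by apply: subset_trans sY (setUS _ (subsetUr _ _)).
have EXY := circuit_unique iW (imset_f (@support E) XM) (imset_f (@support E) YM) sX sY'.
by move: (subsetP sY g); rewrite -EXY gX !inE eq_sym (negPf fg) (negPf gW) => /(_ isT).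
Qed.

Definition adj A w : {set E} := A :|: [set x in w].

Lemma adj_nil A : adj A [::] = A.
Proof. by apply/setP => u; rewrite !inE orbF. Qed.

Lemma adj_cons A x w : adj A (x :: w) = x |: adj A w.
Proof. by apply/setP => u; rewrite !inE orbCA. Qed.

Lemma adj_mid A s x t : adj A (s ++ x :: t) = x |: adj A (s ++ t).
Proof. by apply/setP => u; rewrite !inE !mem_cat !inE; do ! case: (_ \in _); rewrite ?orbT ?orbF. Qed.

Lemma adjU A e w : adj (e |: A) w = e |: adj A w.
Proof. by rewrite /adj setUA. Qed.

(** Given [base], the length condition also forces [w] to be free of repetitions and disjoint from
    [A]. *)
Definition spans A w := base (adj A w) && (#|A| + size w == r).

Lemma spans_base A w : spans A w -> base (adj A w). Proof. by case/andP. Qed.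

Lemma card_adj A w : #|adj A w| <= #|A| + size w.
Proof.
apply: leq_trans (leq_card_setU _ _) _.
by rewrite leq_add2l cardsE; apply: card_size.
Qed.

Lemma spans_notin A x w : spans A (x :: w) -> x \notin adj A w.
Proof.
rewrite /spans adj_cons => /andP[/andP[_ /eqP cB] /eqP cA].
by apply/negP => xA; move: cB (card_adj A w); rewrite cardsU1 xA -cA /=; lia.
Qed.

Lemma spans_mid A s x t : spans A (s ++ x :: t) = spans A (x :: s ++ t).
Proof. by rewrite /spans adj_mid adj_cons /= !size_cat /= addnS. Qed.

Lemma spansU A e w : e \notin A -> spans (e |: A) w = spans A (e :: w).
Proof. by move=> eA; rewrite /spans adjU adj_cons cardsU1 eA /= addnS. Qed.

(* [chi w] is the orientation of the list [w] as a basis of the contraction of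
   [A]; it vanishes on all other lists. *)
Record is_chi A (chi : seq E -> sg) : Prop := IsChi {
  chi_swap : forall s x y t, chi (s ++ x :: y :: t) = sgopp (chi (s ++ y :: x :: t));
  chi_neq0 : forall w, (chi w != Zer) = spans A w;
  chi_pivot : forall X f g w, X \in scircuits M -> spans A (f :: w) -> spans A (g :: w) ->
    support X \subset f |: (g |: adj A w) ->
    chi (g :: w) = sgopp (sgmul (sgmul (sgn X f) (sgn X g)) (chi (f :: w)))
}.

Definition sgp n := if odd n then Neg else Pos.

Lemma sgpS n : sgp n.+1 = sgopp (sgp n). Proof. by rewrite /sgp /=; case: (odd n). Qed.

Lemma chi_front A chi s x t : is_chi A chi ->
  chi (s ++ x :: t) = sgmul (sgp (size s)) (chi (x :: s ++ t)).
Proof.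
move=> chiP; elim/last_ind: s t => [//|s y IH] t.
rewrite -cats1 -!catA /= (chi_swap chiP) IH size_cat addn1 sgpS.
by rewrite sgopp_mull.
Qed.

Section Extend.
Variables (A : {set E}) (e0 : E) (chi1 : seq E -> sg).
Hypotheses (e0A : e0 \notin A) (iA1 : indep N (e0 |: A)) (chi1P : is_chi (e0 |: A) chi1).

(** Sign of the coordinate of [z] along [e0] modulo [W], read off from the dependency among [e0],
    [z] and [W]. *)
Definition pivot W z : sg :=
  if z == e0 then Pos else
  if [pick X in scircuits M | support X \subset e0 |: (z |: W)] is Some X
  then sgopp (sgmul (sgn X e0) (sgn X z)) else Zer.

(* Laplace expansion: the coordinate of [z] along [e0] modulo the other elements
   of [w], times the chirotope of the contraction of [e0 |: A]. *)
Definition expand w z : sg :=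
  sgmul (sgp (index z w)) (sgmul (pivot (adj A (rem z w)) z) (chi1 (rem z w))).

(** [expand_unique] makes the choice of [z] immaterial, and [chi0_valid] shows that one exists. *)
Definition chi0 w : sg :=
  if ~~ spans A w then Zer else
  if [pick z | (z \in w) && spans A (e0 :: rem z w)] is Some z then expand w z else Zer.

Lemma rem_mid s z t : z \notin s -> rem z (s ++ z :: t) = s ++ t.
Proof.
elim: s => [|x s IH] /=; first by rewrite eqxx.
by rewrite inE negb_or => /andP[zx zs]; rewrite eq_sym (negPf zx) IH.
Qed.

Lemma spans_mid_notin s z t : spans A (s ++ z :: t) -> z \notin s.
Proof.
rewrite spans_mid => /spans_notin; apply: contra.
by rewrite !inE mem_cat => ->; rewrite orbT.
Qed.

Lemma expand_mid s z t : spans A (s ++ z :: t) ->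
  expand (s ++ z :: t) z =
  sgmul (sgp (size s)) (sgmul (pivot (adj A (s ++ t)) z) (chi1 (s ++ t))).
Proof.
move=> /spans_mid_notin zs; rewrite /expand rem_mid // index_cat (negPf zs) /= eqxx addn0.
by [].
Qed.

Lemma pivot_circuit X z w : spans A (e0 :: w) -> spans A (z :: w) ->
  X \in scircuits M -> support X \subset e0 |: (z |: adj A w) ->
  pivot (adj A w) z = sgopp (sgmul (sgn X e0) (sgn X z)).
Proof.
move=> /spans_base; rewrite adj_cons => be /spans_base; rewrite adj_cons => bz XM sX.
rewrite /pivot; case: eqP => [E'|_].
  have := indep_circuit (proj1 (andP bz)) XM.
  by rewrite E' in sX *; rewrite setUA setUid in sX; rewrite sX.
case: pickP => [Y /andP[YM sY]|/(_ X)]; last by rewrite XM sX.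
by rewrite (scircuit_unique e0 z (proj1 (andP bz)) XM YM sX sY).
Qed.

Lemma pivot_neq0 z w : spans A (e0 :: w) -> spans A (z :: w) -> pivot (adj A w) z != Zer.
Proof.
move=> se sz; have [E'|ne] := eqVneq z e0; first by rewrite /pivot E' eqxx.
move/spans_base: (se); rewrite adj_cons => be; move/spans_base: (sz); rewrite adj_cons => bz.
have := circuit_exists be bz; rewrite !spans_notin // eq_sym ne => /(_ isT isT isT)[X XM sX].
rewrite (pivot_circuit se sz XM sX); move: (circuit_mem bz XM sX) (circuit_mem2 be XM sX).
by case: (sgn X e0); case: (sgn X z).
Qed.

(** One circuit in [e0], [x], [y] and the rest gives both coordinates and, by [chi_pivot], the ratio
    of the two values of [chi1]; the signs of the transpositions account for the remainder. *)
Lemma expand_unique2 s1 x s2 y s3 : spans A (s1 ++ x :: s2 ++ y :: s3) ->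
  spans A (e0 :: s1 ++ s2 ++ y :: s3) -> spans A (e0 :: s1 ++ x :: s2 ++ s3) ->
  expand (s1 ++ x :: s2 ++ y :: s3) x = expand (s1 ++ x :: s2 ++ y :: s3) y.
Proof.
move=> sp sx sy; rewrite expand_mid //.
have -> : s1 ++ x :: s2 ++ y :: s3 = (s1 ++ x :: s2) ++ y :: s3 by rewrite -catA.
rewrite expand_mid -?catA // cat_cons.
pose w := s1 ++ s2 ++ s3.
have aE : adj A (s1 ++ s2 ++ y :: s3) = adj A (y :: w).
  by rewrite catA adj_mid -catA adj_cons.
have bE : adj A (s1 ++ x :: s2 ++ s3) = adj A (x :: w) by rewrite adj_mid adj_cons.
have sxy : spans A (x :: y :: w).
  by move: sp; rewrite spans_mid catA -cat_cons spans_mid /= -catA /spans !adj_cons setUCA.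
have syx : spans A (y :: x :: w) by move: sxy; rewrite /spans !adj_cons setUCA.
have sey : spans A (e0 :: y :: w).
  by move: sx; rewrite catA -cat_cons spans_mid /= -catA /spans !adj_cons setUCA.
have sex : spans A (e0 :: x :: w).
  by move: sy; rewrite -cat_cons spans_mid /= /spans !adj_cons setUCA.
have xe : x != e0 by apply: contraTneq (spans_notin sex) => ->; rewrite adj_cons negbK setU11.
have ye : y != e0 by apply: contraTneq (spans_notin sey) => ->; rewrite adj_cons negbK setU11.
rewrite aE bE.
have [|||||C CM sC] := circuit_exists (W := adj A (y :: w)) (f := e0) (g := x).
- by rewrite -adj_cons; apply: spans_base.
- by rewrite -adj_cons; apply: spans_base.
- by rewrite eq_sym.
- exact: spans_notin.
- exact: spans_notin.
have sC2 : support C \subset e0 |: (y |: adj A (x :: w)).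
  by move: sC; rewrite !adj_cons (setUCA [set x]).
have sC3 : support C \subset x |: (y |: adj (e0 |: A) w).
  by move: sC; rewrite adjU !adj_cons (setUCA [set e0]) (setUCA [set e0]).
rewrite (pivot_circuit sey sxy CM sC) (pivot_circuit sex syx CM sC2).
have -> : s1 ++ s2 ++ y :: s3 = (s1 ++ s2) ++ y :: s3 by rewrite catA.
rewrite (chi_front _ _ _ chi1P) (chi_front s1 x (s2 ++ s3) chi1P) -catA -/w.
have s1x : spans (e0 |: A) (x :: w) by rewrite spansU.
have s1y : spans (e0 |: A) (y :: w) by rewrite spansU.
rewrite (chi_pivot chi1P CM s1x s1y sC3) !size_cat /sgp /= !addnS /= !oddD.
have : sgn C x != Zer by apply: circuit_mem2 CM sC; rewrite -adj_cons; apply: spans_base.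
case: (sgn C x) (sgn C e0) (sgn C y) (chi1 (x :: w)) (odd (size s1)) (odd (size s2)) => //.
  by case; case; case; case; case.
by case; case; case; case; case.
Qed.

Lemma expand_unique w x y : spans A w -> x \in w -> y \in w ->
  spans A (e0 :: rem x w) -> spans A (e0 :: rem y w) -> expand w x = expand w y.
Proof.
have [->//|ne sw xw] := eqVneq x y; case/splitPr: xw sw => p1 p2 sw.
rewrite mem_cat inE eq_sym (negPf ne) rem_mid ?(spans_mid_notin sw) //= => /orP[] yp sx sy.
  case/splitPr: yp sw sx sy => q1 q2 sw sx sy.
  rewrite -!catA /= in sw sx sy *; symmetry; apply: expand_unique2 => //.
  by rewrite rem_mid ?(spans_mid_notin sw) in sy.
case/splitPr: yp sw sx sy => q1 q2 sw sx sy; apply: expand_unique2 => //.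
have E' : p1 ++ x :: q1 ++ y :: q2 = (p1 ++ x :: q1) ++ y :: q2 by rewrite -catA.
rewrite E' in sw sy.
by rewrite rem_mid ?(spans_mid_notin sw) // -catA in sy.
Qed.

Lemma chi0_mid s z t : spans A (s ++ z :: t) -> spans A (e0 :: s ++ t) ->
  chi0 (s ++ z :: t) = sgmul (sgp (size s)) (sgmul (pivot (adj A (s ++ t)) z) (chi1 (s ++ t))).
Proof.
move=> sw se; rewrite /chi0 sw -expand_mid //.
have zin : z \in s ++ z :: t by rewrite mem_cat mem_head orbT.
have se' : spans A (e0 :: rem z (s ++ z :: t)) by rewrite rem_mid ?(spans_mid_notin sw).
case: pickP => [x /andP[xw sx]|/(_ z)]; first exact: expand_unique.
by rewrite zin se'.
Qed.

(** If [e0] is not in [w], adding it creates a circuit that leaves the independent set [e0 |: A]; an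
    element of it in [w] can be exchanged for [e0]. *)
Lemma chi0_valid w : spans A w -> exists2 z, z \in w & spans A (e0 :: rem z w).
Proof.
move=> sw; have [ew|ew] := boolP (e0 \in w).
  exists e0 => //; case/splitPr: ew sw => s t sw.
  by rewrite rem_mid ?(spans_mid_notin sw) // -spans_mid.
have /andP[bw /eqP cw] := sw.
have ew' : e0 \notin adj A w by rewrite !inE negb_or e0A.
have : ~~ indep N (e0 |: adj A w).
  apply/negP => /indep_card; rewrite cardsU1 ew'.
  by case/andP: bw => _ /eqP->; rewrite add1n ltnn.
case/dependent_circuit => C CM sC.
have [z zC zA] : exists2 z, z \in support C & z \notin e0 |: A.
  by apply/subsetPn; apply: indep_circuit iA1 CM.
have zw : z \in w.
  move: zA (subsetP sC z zC); rewrite /adj !inE negb_or => /andP[/negPf-> /negPf->].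
  by [].
exists z => //; case/splitPr: zw sw bw sC {ew ew' cw} => s t sw bw sC.
rewrite rem_mid ?(spans_mid_notin sw) //.
rewrite adj_mid in bw sC; have zn : z \notin adj A (s ++ t) by apply: spans_notin; rewrite -spans_mid.
have zN : sgn C z != Zer by rewrite sgn_eq0 negbK.
rewrite /spans adj_cons (base_exchange bw zn CM sC zN) /=.
by case/andP: sw => _; rewrite !size_cat /= addnS.
Qed.

Lemma spans_swap s x y t : spans A (s ++ x :: y :: t) = spans A (s ++ y :: x :: t).
Proof.
rewrite !(spans_mid A s) /= /spans !adj_cons !adj_mid (setUCA [set x]) /=.
by rewrite !size_cat.
Qed.

Lemma chi0_swap_head s x y t : spans A (s ++ x :: y :: t) -> spans A (e0 :: s ++ y :: t) ->
  chi0 (s ++ x :: y :: t) = sgopp (chi0 (s ++ y :: x :: t)).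
Proof.
move=> sw se; rewrite chi0_mid //; rewrite spans_swap in sw.
have E' : s ++ y :: x :: t = (s ++ [:: y]) ++ x :: t by rewrite -catA.
rewrite E' in sw *; rewrite chi0_mid // -?catA //= size_cat addn1 sgpS.
by case: (sgp _) => //; rewrite sgoppK.
Qed.

Lemma chi0_swap s x y t : chi0 (s ++ x :: y :: t) = sgopp (chi0 (s ++ y :: x :: t)).
Proof.
have [sw|nsw] := boolP (spans A (s ++ x :: y :: t)); last first.
  by move: (nsw); rewrite spans_swap /chi0 nsw => ->.
have sw' : spans A (s ++ y :: x :: t) by rewrite -spans_swap.
have adjC p q : adj A (p ++ x :: y :: q) = adj A (p ++ y :: x :: q).
  by rewrite !adj_mid setUCA.
have [z zw se] := chi0_valid sw.
move: zw; rewrite mem_cat 2!inE => /or4P[zs|/eqP Ezx|/eqP Ezy|zt].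
- case/splitPr: zs sw sw' se => p1 p2 sw sw'; rewrite -!catA /= in sw sw' *.
  rewrite rem_mid ?(spans_mid_notin sw) // => se.
  have se' : spans A (e0 :: p1 ++ p2 ++ y :: x :: t).
    by move: se; rewrite -!cat_cons !catA spans_swap.
  rewrite !chi0_mid // !catA -adjC (chi_swap chi1P).
  by case: (sgp _) => //; case: (pivot _ _) => //; case: (chi1 _).
- rewrite Ezx rem_mid ?(spans_mid_notin sw) // in se.
  exact: chi0_swap_head.
- rewrite Ezy in se; rewrite [in RHS]chi0_swap_head ?sgoppK //.
  have E' : s ++ x :: y :: t = (s ++ [:: x]) ++ y :: t by rewrite -catA.
  by move: se sw; rewrite E' => se sw; rewrite rem_mid ?(spans_mid_notin sw) // -catA in se.
- case/splitPr: zt sw sw' se => p1 p2.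
  have E' p q : s ++ p :: q :: p1 ++ z :: p2 = (s ++ p :: q :: p1) ++ z :: p2 by rewrite -catA.
  rewrite !E' => sw sw'; rewrite rem_mid ?(spans_mid_notin sw) // => se.
  have se' : spans A (e0 :: (s ++ y :: x :: p1) ++ p2).
    by move: se; rewrite -catA -cat_cons spans_swap /= -catA.
  rewrite !chi0_mid // !size_cat -!catA /= adjC (chi_swap chi1P).
  by case: (sgp _) => //; case: (pivot _ _) => //; case: (chi1 _).
Qed.

Lemma chi0_neq0 w : (chi0 w != Zer) = spans A w.
Proof.
have [sw|nsw] := boolP (spans A w); last by rewrite /chi0 nsw.
have [z zw] := chi0_valid sw; case/splitPr: zw sw => s t sw.
rewrite rem_mid ?(spans_mid_notin sw) // => se.
rewrite chi0_mid //.
have : pivot (adj A (s ++ t)) z != Zer by apply: pivot_neq0; rewrite // -spans_mid.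
have : chi1 (s ++ t) != Zer by rewrite (chi_neq0 chi1P) spansU.
by case: (chi1 _) => // _; case: (pivot _ _) => // _; rewrite /sgp; case: (odd _).
Qed.

(** Eliminating [f] between [X] and the circuit through [e0] and [f] gives the circuit through [e0]
    and [g]. *)
Lemma pivot_mul f g w X : X \in scircuits M -> spans A (f :: w) -> spans A (g :: w) ->
  spans A (e0 :: w) -> support X \subset f |: (g |: adj A w) ->
  pivot (adj A w) g = sgopp (sgmul (sgmul (sgn X f) (sgn X g)) (pivot (adj A w) f)).
Proof.
move=> XM sf sg0 se sX.
have [[Ef Eg] Ee] := (spans_base sf, spans_base sg0, spans_base se); rewrite !adj_cons in Ef Eg Ee.
have Xf := circuit_mem Eg XM sX; have Xg := circuit_mem2 Ef XM sX.
have [Ege|ge] := eqVneq g e0.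
  have sX' : support X \subset e0 |: (f |: adj A w) by rewrite -Ege setUCA.
  rewrite (pivot_circuit se sf XM sX') /pivot Ege eqxx -Ege.
  by case: (sgn X f) Xf => //; case: (sgn X g) Xg.
have [Efe|fe] := eqVneq f e0.
  have sX' : support X \subset e0 |: (g |: adj A w) by rewrite -Efe.
  rewrite (pivot_circuit se sg0 XM sX') /pivot Efe eqxx -Efe.
  by case: (sgn X f) Xf => //; case: (sgn X g) Xg.
have := circuit_exists Ee Ef; rewrite !spans_notin // eq_sym fe => /(_ isT isT isT)[Y YM sY].
have := circuit_exists Ee Eg; rewrite !spans_notin // eq_sym ge => /(_ isT isT isT)[Z ZM sZ].
have Ye := circuit_mem Ef YM sY; have Yf := circuit_mem2 Ee YM sY.
have Ze := circuit_mem Eg ZM sZ; have Zg := circuit_mem2 Ee ZM sZ.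
have Xe : sgn X e0 = Zer.
  apply/eqP; rewrite sgn_eq0; apply: contra (spans_notin se) => /(subsetP sX).
  by rewrite !in_setU1 !(eq_sym e0) (negPf ge) (negPf fe).
have neXY : support X != support Y.
  by apply/eqP => EXY; move: Ye; rewrite sgn_eq0 -EXY -sgn_eq0 Xe.
have [U [c [UM Us c0 cY UP]]] := eliminate_sign XM YM neXY Xf Yf.
have sU : support U \subset e0 |: (g |: adj A w).
  apply: subset_trans Us _; apply/subsetP => u; rewrite in_setD1 in_setU => /andP[/negPf uf].
  case/orP => [/(subsetP sX)|/(subsetP sY)]; rewrite !in_setU1 uf /=.
    by move=> ->; rewrite orbT.
  by case/orP => ->; rewrite ?orbT.
rewrite (pivot_circuit se sg0 UM sU) (pivot_circuit se sf YM sY).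
have Ue := circuit_mem Eg UM sU; have Ug := circuit_mem2 Ee UM sU.
have Yg : sgn Y g = Zer.
  apply/eqP; rewrite sgn_eq0; apply/negP => /(subsetP sY).
  rewrite !in_setU1 (negPf ge) (negPf (spans_notin sg0)) orbF /=.
  move=> /eqP Egf; rewrite Egf setUA setUid in sX.
  by move: (indep_circuit (proj1 (andP Ef)) XM); rewrite sX.
have {}Ue : sgn U e0 = sgmul c (sgn Y e0).
  by case: (UP e0 Ue) => // E'; rewrite E' Xe in Ue.
have {}Ug : sgn U g = sgn X g.
  by case: (UP g Ug) => // E'; rewrite E' Yg in Ug; case: c Ug {c0 cY UP Ue E'}.
rewrite Ue Ug; move: c0 cY; case: c {UP Ue}; case: (sgn Y f) Yf; case: (sgn X f) Xf => //;
 by case: (sgn Y e0); case: (sgn X g).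
Qed.

(** As [C] avoids [f] and [g], using it to eliminate [e0] in favour of [z] leaves the signs at [f]
    and [g] unchanged. *)
Lemma circuit_transfer W f g z X C :
  base (f |: (z |: W)) -> base (g |: (z |: W)) -> base (f |: (e0 |: W)) -> base (g |: (e0 |: W)) ->
  f != g -> f \notin e0 |: (z |: W) -> g \notin e0 |: (z |: W) ->
  X \in scircuits M -> support X \subset f |: (g |: (z |: W)) ->
  C \in scircuits M -> support C \subset e0 |: (z |: W) -> sgn C e0 != Zer ->
  exists X', [/\ X' \in scircuits M, support X' \subset f |: (g |: (e0 |: W)) &
    sgmul (sgn X' f) (sgn X' g) = sgmul (sgn X f) (sgn X g)].
Proof.
move=> bfz bgz bfe bge fg fN gN XM sX CM sC Ce.
have notC u : u \notin e0 |: (z |: W) -> sgn C u = Zer.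
  by move=> uN; apply/eqP; rewrite sgn_eq0; apply: contra uN; apply: subsetP.
have outW u : u \notin e0 |: (z |: W) -> u \notin e0 |: W.
  by rewrite !inE !negb_or => /and3P[-> _ ->].
have [X' X'M sX'] := circuit_exists bfe bge fg (outW f fN) (outW g gN).
exists X'; split=> //.
have X'f := circuit_mem bge X'M sX'.
have same Z : Z \in scircuits M -> support Z \subset f |: (g |: (z |: W)) ->
    sgmul (sgn Z f) (sgn Z g) = sgmul (sgn X f) (sgn X g).
  by move=> ZM sZ; apply: scircuit_unique (proj1 (andP bgz)) ZM XM sZ sX.
have [X'e|X'e] := eqVneq (sgn X' e0) Zer.
  apply: same => //; apply/subsetP => u uX.
  have ue : u != e0 by apply: contraTneq uX => ->; rewrite -sgn_eq0 X'e.
  by move: (subsetP sX' u uX); rewrite !in_setU1 (negPf ue) /= => /or3P[] ->; rewrite ?orbT.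
have ne : support X' != support C.
  by apply/eqP => E'; move: X'f; rewrite sgn_eq0 E' -sgn_eq0 notC.
have [Z [c [ZM sZ c0 _ ZP]]] := eliminate_sign X'M CM ne X'e Ce.
have sZ' : support Z \subset f |: (g |: (z |: W)).
  apply: subset_trans sZ _; apply/subsetP => u; rewrite in_setD1 in_setU => /andP[/negPf ue].
  case/orP => [/(subsetP sX')|/(subsetP sC)]; rewrite !in_setU1 ue /=.
    by case/or3P => ->; rewrite ?orbT.
  by case/orP => ->; rewrite ?orbT.
have EZ u : u \notin e0 |: (z |: W) -> sgn Z u != Zer -> sgn Z u = sgn X' u.
  move=> uN uZ; case: (ZP u uZ) => // E'.
  by move: uZ; rewrite E' (notC u uN); case: (c).
rewrite -(same Z ZM sZ').
have Zf : sgn Z f != Zer := circuit_mem bgz ZM sZ'.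
have Zg : sgn Z g != Zer := circuit_mem2 bfz ZM sZ'.
by rewrite (EZ f fN Zf) (EZ g gN Zg).
Qed.

(** If [e0] completes [w], expand at the first entry; if [e0] is in [w], the claim is that of
    [chi1]. Otherwise [e0] depends on [adj A w], and a suitable [z] in [w] is replaced by [e0]
    without affecting [f] and [g]. *)
Lemma chi0_pivot X f g w : X \in scircuits M -> spans A (f :: w) -> spans A (g :: w) ->
  support X \subset f |: (g |: adj A w) ->
  chi0 (g :: w) = sgopp (sgmul (sgmul (sgn X f) (sgn X g)) (chi0 (f :: w))).
Proof.
move=> XM sf sg0 sX.
have bf := spans_base sf; have bg := spans_base sg0; rewrite !adj_cons in bf bg.
have [se|nse] := boolP (spans A (e0 :: w)).
  rewrite (chi0_mid (s := [::]) sf se) (chi0_mid (s := [::]) sg0 se) /=.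
  rewrite (pivot_mul XM sf sg0 se sX).
  by case: (sgmul (sgn X f) _); case: (pivot _ _); case: (chi1 _).
have [ew|ew] := boolP (e0 \in w).
  case/splitPr: ew nse sf sg0 sX bf bg => s t _ sf sg0 sX bf bg.
  rewrite -!cat_cons in sf sg0 *.
  have sf' : spans A (e0 :: (f :: s) ++ t) by rewrite -spans_mid.
  have sg' : spans A (e0 :: (g :: s) ++ t) by rewrite -spans_mid.
  rewrite !chi0_mid // /pivot eqxx /=.
  rewrite (chi_pivot chi1P (X := X) (f := f) (g := g)) ?spansU //; last first.
    by rewrite adjU -adj_mid.
  by case: (sgp _); case: (sgmul (sgn X f) _); case: (chi1 _).
have eN : e0 \notin adj A w by rewrite !inE negb_or e0A.
have cw : #|e0 |: adj A w| = r.
  have /andP[_ /eqP <-] := bf; rewrite !cardsU1 eN.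
  by rewrite (spans_notin sf).
have : ~~ indep N (e0 |: adj A w).
  apply: contra nse => ie; rewrite /spans adj_cons /base ie cw eqxx /=.
  by case/andP: sf.
case/dependent_circuit => C CM sC.
have iW : indep N (adj A w) by apply: indepS (proj1 (andP bf)); apply: subsetUr.
have Ce : sgn C e0 != Zer.
  rewrite sgn_eq0 negbK; apply: contraR (indep_circuit iW CM) => eC.
  apply/subsetP => u uC; move: (subsetP sC u uC); rewrite in_setU1 => /predU1P[E'|//].
  by rewrite -E' uC in eC.
have [z zC zA] : exists2 z, z \in support C & z \notin e0 |: A.
  by apply/subsetPn; apply: indep_circuit iA1 CM.
have zw : z \in w.
  by move: zA (subsetP sC z zC); rewrite /adj !inE negb_or => /andP[/negPf-> /negPf->].
have Cz : sgn C z != Zer by rewrite sgn_eq0 negbK.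
have fe : f != e0 by apply: contraNneq nse => <-.
have ge : g != e0 by apply: contraNneq nse => <-.
have fg : f != g.
  apply: contraTneq sX => ->; rewrite setUA setUid.
  exact: indep_circuit (proj1 (andP bg)) XM.
have fN : f \notin e0 |: adj A w by rewrite in_setU1 negb_or fe spans_notin.
have gN : g \notin e0 |: adj A w by rewrite in_setU1 negb_or ge spans_notin.
case/splitPr: zw sf sg0 sX bf bg fN gN sC {nse ew eN cw iW} => s t sf sg0 sX bf bg fN gN sC.
rewrite adj_mid in sX bf bg fN gN sC.
set W := adj A (s ++ t) in sX bf bg fN gN sC.
have outz u : spans A (u :: s ++ z :: t) -> z \notin u |: W.
  rewrite -cat_cons => su; rewrite -adj_cons -cat_cons; apply: spans_notin.
  by rewrite -spans_mid.
have change u : spans A (u :: s ++ z :: t) -> base (u |: (z |: W)) -> base (u |: (e0 |: W)).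
  move=> su bu; rewrite setUCA; apply: (base_exchange (g := z) (X := C)) => //.
  - by rewrite setUCA.
  - exact: outz.
  - by apply: subset_trans sC _; do 2!apply: setUS; apply: subsetUr.
have bfe := change f sf bf; have bge := change g sg0 bg.
have [X' [X'M sX' <-]] := circuit_transfer bf bg bfe bge fg fN gN XM sX CM sC Ce.
have spe u : spans A (u :: s ++ z :: t) -> base (u |: (e0 |: W)) -> spans A (e0 :: (u :: s) ++ t).
  move=> su bu; rewrite /spans adj_cons /= adj_cons setUCA bu /=.
  by move: (proj2 (andP su)); rewrite /= !size_cat /= !addnS.
have sfe := spe f sf bfe; have sge := spe g sg0 bge.
rewrite -!cat_cons in sf sg0 *; rewrite !chi0_mid //.
rewrite (@pivot_circuit C) //; first last.
- by rewrite /= adj_cons -/W; apply: subset_trans sC _; do 2!apply: setUS; apply: subsetUr.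
- by rewrite -spans_mid.
rewrite (@pivot_circuit C) //; first last.
- by rewrite /= adj_cons -/W; apply: subset_trans sC _; do 2!apply: setUS; apply: subsetUr.
- by rewrite -spans_mid.
rewrite /= (chi_pivot chi1P (X := X') (f := f) (g := g)) ?spansU //; last by rewrite adjU.
case: (sgp _) (sgmul (sgn X' f) _) (sgmul (sgn C e0) _) (chi1 _) => // [] [] // [] // [] //.
Qed.

End Extend.

Theorem chi_exists A : indep N A -> exists chi, is_chi A chi.
Proof.
move: {2}(r - #|A|) (erefl (r - #|A|)) => n.
elim: n A => [|n IH] A En iA.
  have cA : #|A| = r by have := indep_card iA; lia.
  exists (fun w => if w is [::] then Pos else Zer); split.
  - by case=> [|? ?].
  - case=> [|x w] /=; rewrite /spans cA.
      by rewrite addn0 eqxx andbT adj_nil /base iA cA eqxx.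
    by rewrite -{2}[r]addn0 eqn_add2l andbF.
  - by move=> X f g w XM; rewrite /spans cA -{2}[r]addn0 eqn_add2l andbF.
have [B sAB /andP[iB /eqP cB]] := indep_extend iA.
have [e eB eA] : exists2 e, e \in B & e \notin A.
  apply/subsetPn; apply/negP => sBA.
  by have := subset_leq_card sBA; rewrite cB; lia.
have iA1 : indep N (e |: A) by apply: indepS iB; rewrite subUset sub1set eB.
have [|chi1 chi1P] := IH _ _ iA1; first by rewrite cardsU1 eA; lia.
exists (chi0 A e chi1); split.
- exact: chi0_swap.
- exact: chi0_neq0.
- exact: chi0_pivot.
Qed.

End Bases.

(** * Grassmann-Plucker relations *)

Section GrassmannPlucker.
Variables (E : finType) (M : oriented_matroid E) (A : {set E}) (chi : seq E -> sg).
Local Notation N := (underlying M).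
Local Notation r := (mrank N).
Hypotheses (cA : #|A| + 3 = r) (chiP : is_chi M A chi).
Variable a : E.
Implicit Types (b c d q u v w x y : E).
Let W := a |: A.
(** Contracting [a] as well leaves a chirotope of rank two. *)
Let s u v := chi [:: a; u; v].

Let s_anti u v : s v u = sgopp (s u v).
Proof. exact: (chi_swap chiP [:: a]). Qed.

Let s_base u v : (s u v != Zer) = base M (u |: (v |: W)).
Proof.
rewrite (chi_neq0 chiP) /spans cA eqxx andbT !adj_cons adj_nil /W.
by rewrite (setUCA [set a]) (setUCA [set a]).
Qed.

Let s_notin u v : s u v != Zer -> [/\ u \notin W, v \notin W, u != v & #|W| + 2 = r].
Proof.
have cW : #|W| <= #|A| + 1 by rewrite cardsU1 addnC leq_add2l; case: (_ \notin _).
rewrite s_base => /andP[_ /eqP]; rewrite 2!cardsU1.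
case uN: (u \notin v |: W); case vN: (v \notin W) => /= c2; try by lia.
by move: uN; rewrite in_setU1 negb_or => /andP[-> ->]; split=> //; lia.
Qed.

Let s_pivot C b c x : C \in scircuits M -> support C \subset b |: (c |: (x |: W)) ->
  s b x != Zer -> s c x != Zer ->
  s c x = sgopp (sgmul (sgmul (sgn C b) (sgn C c)) (s b x)).
Proof.
move=> CM sC; rewrite /s !(chi_swap chiP [::] a) /=.
have o0 z : (sgopp z != Zer) = (z != Zer) by case: z.
rewrite !o0 !(chi_neq0 chiP) => sb sc.
rewrite (chi_pivot chiP CM sb sc); last first.
  by rewrite !adj_cons adj_nil (setUCA [set a]).
by case: (sgmul _ (sgn C c)); case: (chi _).
Qed.

Let s_exchange C b c x : C \in scircuits M -> support C \subset c |: (b |: W) ->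
  sgn C b != Zer -> s b x != Zer -> s c x != Zer.
Proof.
move=> CM sC Cb sbx; have [bW xW bx _] := s_notin sbx.
move: sbx; rewrite !s_base => sbx; apply: (base_exchange sbx _ CM _ Cb).
  by rewrite in_setU1 negb_or bx.
by apply: subset_trans sC _; do 2!apply: setUS; apply: subsetUr.
Qed.

(** In rank two [u] and [v] are then proportional, with ratio given by the circuit through both. *)
Let s_parallel u v x y : s u v = Zer -> sgmul (s u x) (s v y) = sgmul (s v x) (s u y).
Proof.
move=> suv; have [->|uv] := eqVneq u v; first by [].
have [/existsP[x0 ux]|/existsPn u0] := boolP [exists z, s u z != Zer]; last first.
  by move: (u0 x) (u0 y); rewrite !negbK => /eqP-> /eqP->; case: (s v x).
have [/existsP[y0 vy]|/existsPn v0] := boolP [exists z, s v z != Zer]; last first.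
  by move: (v0 x) (v0 y); rewrite !negbK => /eqP-> /eqP->; case: (s u x).
have [uW _ _ cW] := s_notin ux; have [vW _ _ _] := s_notin vy.
have ind z z' : s z z' != Zer -> indep N (z |: W).
  rewrite s_base => /andP[iB _]; apply: indepS iB.
  by rewrite setUCA; apply: subsetUr.
have : ~~ indep N (u |: (v |: W)).
  move/eqP: suv; apply: contraL => iB; rewrite s_base /base iB 2!cardsU1 in_setU1 negb_or uv.
  by rewrite uW vW -cW !add1n addn2 eqxx.
case/dependent_circuit => C CM sC.
have sC' : support C \subset v |: (u |: W) by rewrite setUCA.
have mem z z' : indep N (z' |: W) -> support C \subset z |: (z' |: W) -> sgn C z != Zer.
  move=> iz sz; rewrite sgn_eq0 negbK; apply: contraR (indep_circuit iz CM) => zC.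
  apply/subsetP => t tC; move: (subsetP sz t tC); rewrite in_setU1 => /predU1P[E'|//].
  by rewrite -E' tC in zC.
have Cu := mem u v (ind _ _ vy) sC; have Cv := mem v u (ind _ _ ux) sC'.
have prop z : s v z = sgopp (sgmul (sgmul (sgn C u) (sgn C v)) (s u z)).
  have [uz|uz] := eqVneq (s u z) Zer.
    have [->|vz] := eqVneq (s v z) Zer; first by rewrite uz; rewrite sgmulC.
    by have := s_exchange CM sC Cv vz; rewrite uz.
  apply: (s_pivot CM) => //; last exact: s_exchange CM sC' Cu uz.
  by apply: subset_trans sC _; do 2!apply: setUS; apply: subsetUr.
by rewrite !prop; case: (sgmul (sgn C u) _); case: (s u x); case: (s u y).
Qed.

Let s_circuit u v w : s u v != Zer -> s u w != Zer -> s v w != Zer ->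
  exists2 C, C \in scircuits M & support C \subset u |: (v |: (w |: W)).
Proof.
move=> uv uw vw; have [uW vW nuv _] := s_notin uv; have [_ wW nuw _] := s_notin uw.
have [_ _ nvw _] := s_notin vw.
apply: circuit_exists; rewrite -?s_base // in_setU1 negb_or; first by rewrite nuw.
by rewrite nvw.
Qed.

Let s_signs C u v w : s u v != Zer -> s u w != Zer -> s v w != Zer ->
  C \in scircuits M -> support C \subset u |: (v |: (w |: W)) ->
  [/\ sgn C u != Zer, sgmul (sgn C u) (sgn C v) = sgopp (sgmul (s u w) (s v w)) &
      sgmul (sgn C u) (sgn C w) = sgmul (s u v) (s v w)].
Proof.
move=> uv uw vw CM sC.
have o0 x y : (s x y != Zer) = (s y x != Zer) by rewrite (s_anti y x); case: (s y x).
have sC' : support C \subset u |: (w |: (v |: W)) by rewrite (setUCA [set w]).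
have Cu : sgn C u != Zer by apply: circuit_mem CM sC; rewrite -s_base.
split=> //.
  have := s_pivot CM sC uw vw.
  by case: (s u w) uw => //; case: (s v w) vw => //; case: (sgn C u) Cu => //; case: (sgn C v).
rewrite o0 in vw; have := s_pivot CM sC' uv vw; rewrite [s v w]s_anti.
by case: (s u v) uv => //; case: (s w v) vw => //; case: (sgn C u) Cu => //; case: (sgn C w).
Qed.

(** If some value vanishes, [s_parallel] suffices. Otherwise eliminate [c] between the circuits on
    [b], [c], [d] and on [b], [c], [q]. The result is the circuit on [b], [d], [q], whose sign at
    [b] comes from one of the two; the ratios computed in [s_signs] turn this into the relation. *)
Lemma s_plucker q b c d : balanced false false
  [:: sgmul (s c d) (sgopp (s q b)); sgmul (s b d) (s q c); sgmul (s b c) (sgopp (s q d))].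
Proof.
have [E0|bc] := eqVneq (s b c) Zer.
  have := s_parallel d q E0; rewrite E0 (s_anti q b) (s_anti q c).
  by case: (s b d); case: (s c d); case: (s q b); case: (s q c).
have [E0|bd] := eqVneq (s b d) Zer.
  have := s_parallel c q E0; rewrite E0 (s_anti c d) (s_anti q b) (s_anti q d).
  by case: (s b c); case: (s c d); case: (s q b); case: (s q d).
have [E0|cd] := eqVneq (s c d) Zer.
  have := s_parallel b q E0; rewrite E0 (s_anti b c) (s_anti b d) (s_anti q c) (s_anti q d).
  by case: (s b c); case: (s b d); case: (s q c); case: (s q d).
have [E0|qb] := eqVneq (s q b) Zer.
  have := s_parallel c d E0; rewrite E0.
  by case: (s c d); case: (s b c); case: (s b d); case: (s q c); case: (s q d).
have [E0|qc] := eqVneq (s q c) Zer.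
  have := s_parallel b d E0; rewrite E0 (s_anti b c).
  by case: (s b d); case: (s b c); case: (s c d); case: (s q b); case: (s q d).
have [E0|qd] := eqVneq (s q d) Zer.
  have := s_parallel b c E0; rewrite E0 (s_anti b d) (s_anti c d).
  by case: (s b c); case: (s b d); case: (s c d); case: (s q b); case: (s q c).
have [D DM sD] := s_circuit bc bd cd.
have [Db DbDc DbDd] := s_signs bc bd cd DM sD.
have o0 x y : (s x y != Zer) = (s y x != Zer) by rewrite (s_anti y x); case: (s y x).
have cq : s c q != Zer by rewrite o0.
have bq : s b q != Zer by rewrite o0.
have dq : s d q != Zer by rewrite o0.
have [G GM sG] := s_circuit bc bq cq.
have [Gb GbGc GbGq] := s_signs bc bq cq GM sG.
have Dc : sgn D c != Zer.
  by move: DbDc bd cd; case: (sgn D c); case: (s b d); case: (s c d); case: (sgn D b).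
have Gc : sgn G c != Zer.
  by move: GbGc bq cq; case: (sgn G c); case: (s b q); case: (s c q); case: (sgn G b).
clearbody W.
have [bW cW nbc _] := s_notin bc; have [_ dW ncd _] := s_notin cd.
have [_ qW ndq _] := s_notin dq; have [_ _ nbd _] := s_notin bd; have [_ _ ncq _] := s_notin cq.
have [_ _ nbq _] := s_notin bq.
have Gd : sgn G d = Zer.
  apply/eqP; rewrite sgn_eq0; apply/negP => /(subsetP sG).
  by rewrite !in_setU1 (negPf dW) (eq_sym d) (negPf nbd) (eq_sym d) (negPf ncd) (negPf ndq).
have Dd : sgn D d != Zer.
  by move: DbDd bc cd; case: (sgn D d); case: (s b c); case: (s c d); case: (sgn D b).
have neDG : support D != support G.
  by apply/eqP => E'; move: Dd; rewrite sgn_eq0 E' -sgn_eq0 Gd.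
have [Z [k [ZM sZ k0 kE ZP]]] := eliminate_sign DM GM neDG Dc Gc.
have sZ' : support Z \subset b |: (d |: (q |: W)).
  apply: subset_trans sZ _; apply/subsetP => u; rewrite in_setD1 in_setU => /andP[/negPf uc].
  case/orP => [/(subsetP sD)|/(subsetP sG)]; rewrite !in_setU1 uc /=.
    by case/or3P => ->; rewrite ?orbT.
  by case/or3P => ->; rewrite ?orbT.
have [Zb ZbZd _] := s_signs bd bq dq ZM sZ'.
have {}Zd : sgn Z d = sgn D d.
  have Zd : sgn Z d != Zer.
    by move: ZbZd bq dq; case: (sgn Z d); case: (s b q); case: (s d q); case: (sgn Z b).
  by case: (ZP d Zd) => // E'; move: Zd; rewrite E' Gd; case: (k).
have ZbE := ZP b Zb.
move: DbDc DbDd GbGc ZbZd kE; rewrite Zd (s_anti q b) (s_anti q c) (s_anti q d).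
case: (s b c) bc => // _; case: (s b d) bd => // _; case: (s c d) cd => // _;
case: (s q b) qb => // _; case: (s q c) qc => // _; case: (s q d) qd => // _;
case: (sgn D b) ZbE Db => // ZbE _;  case: (sgn D c) Dc => // _; case: (sgn D d) Dd => // _;
case: (sgn G b) ZbE Gb => // ZbE _; case: (sgn G c) Gc => // _;
case: (k) ZbE k0 => // ZbE _;
by case: (sgn Z b) ZbE Zb => // -[].
Qed.

End GrassmannPlucker.

(** * Counting independent hyperplanes *)

Section Paving.
Variables (E : finType) (M : oriented_matroid E).
Local Notation N := (underlying M).
Local Notation r := (mrank N).
Hypothesis pav : paving N.
Implicit Types A H I : {set E}.

Lemma paving_indep I : #|I| < r -> indep N I.
Proof.
move=> ltI; apply/indepP => C CM; apply: contraL ltI => /subset_leq_card; rewrite -leqNgt.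
by case: (pav CM) => -> //; apply: leq_trans.
Qed.

Lemma independent_hyperplane H : #|H|.+1 = r ->
  (forall e, e \notin H -> base M (e |: H)) -> H \in independent_hyperplanes N.
Proof.
move=> cH bH; have iH : indep N H by apply: paving_indep; rewrite -cH.
have rkH : rk N H = #|H|.
  apply/eqP; rewrite eqn_leq rk_indep // andbT.
  by have [I [sI _ ->]] := rkP N H; apply: subset_leq_card.
rewrite inE /hyperplane rkH cH eqxx !andbT; apply/forallP => e; apply/implyP => eH.
have /andP[iB /eqP cB] := bH e eH.
by rewrite rkH cH -cB; apply: rk_indep.
Qed.

Section Contraction.
Variable A : {set E}.
Hypothesis cA : #|A| + 3 = r.
Let T : finType := {x | x \notin A}.
Variable chi : seq E -> sg.
Hypothesis chiP : is_chi M A chi.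
Let chi3 (a b c : T) := chi [:: val a; val b; val c].

Let card_line (a b : T) : a != b -> #|val a |: (val b |: A)|.+1 = r.
Proof.
move=> ab; have ab' : val a != val b by [].
rewrite !cardsU1 in_setU1 negb_or ab' (valP a) (valP b) -cA; lia.
Qed.

Let spans3 (a b c : T) : (chi3 a b c != Zer) = base M (val c |: (val a |: (val b |: A))).
Proof.
rewrite (chi_neq0 chiP) /spans cA eqxx andbT !adj_cons adj_nil.
by rewrite (setUCA [set val c]) (setUCA [set val c]).
Qed.

Lemma contraction_chirotope : chirotope chi3.
Proof.
have c12 a b c : chi3 b a c = sgopp (chi3 a b c) by apply: (chi_swap chiP [::]).
have c23 a b c : chi3 a c b = sgopp (chi3 a b c) by apply: (chi_swap chiP [:: _]).
split=> // [a q b c d|a b ab].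
  have := s_plucker cA chiP (val a) (val q) (val b) (val c) (val d).
  by rewrite (c12 a q b) (c12 a q d).
(* Paving makes the contraction simple: these [r - 1] elements are independent. *)
have iab : indep N (val a |: (val b |: A)) by apply: paving_indep; rewrite -(card_line ab).
have [B sB /andP[iB /eqP cB]] := indep_extend iab.
have [c cB' cN] : exists2 c, c \in B & c \notin val a |: (val b |: A).
  apply/subsetPn; apply/negP => /subset_leq_card.
  by rewrite cB -(card_line ab) ltnn.
have cA' : c \notin A by apply: contra cN => ?; rewrite !in_setU1 orbA; apply/orP; right.
exists (Sub c cA'); rewrite spans3 SubK /base.
have sB' : c |: (val a |: (val b |: A)) \subset B by rewrite subUset sub1set cB'.
by rewrite (indepS sB' iB) cardsU1 cN add1n card_line // eqxx.
Qed.

Lemma ordinary_hyperplane P : ordinary chi3 P ->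
  A :|: val @: P \in independent_hyperplanes N.
Proof.
move=> oP; have /andP[/cards2P[a [b [ab EP]]] _] := oP.
move: oP; rewrite EP ordinary2 //; last exact: contraction_chirotope.
move=> /forallP Hc.
have -> : A :|: val @: [set a; b] = val a |: (val b |: A).
  by rewrite imsetU1 imset_set1 setUC setUA.
apply: independent_hyperplane; first exact: card_line.
move=> e; rewrite !in_setU1 !negb_or => /and3P[ea eb eA].
have := implyP (Hc (Sub e eA)); rewrite spans3 SubK; apply.
by rewrite -!val_eqE SubK ea.
Qed.

End Contraction.

Lemma hyperplanes_through A : #|A| + 3 = r -> 7 + #|A| < #|E| ->
  6 * (#|E| - #|A|) <= 13 * #|[set H in independent_hyperplanes N | A \subset H]|.
Proof.
move=> cA big; have iA : indep N A by apply: paving_indep; lia.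
have [chi chiP] := chi_exists iA; have chi3P := contraction_chirotope cA chiP.
have cT : #|{: {x | x \notin A}}| = #|E| - #|A|.
  by rewrite card_sig -(cardC (mem A)) addKn; apply: eq_card => e; rewrite !inE.
have T8 : 7 < #|{: {x | x \notin A}}| by rewrite cT; lia.
rewrite -cT; apply: leq_trans (six_thirteenths chi3P _ T8) _; first by apply: leq_trans T8.
rewrite leq_mul2l /=; pose F (P : {set {x | x \notin A}}) := A :|: val @: P.
have injF : injective F.
  apply: (can_inj (g := fun H => [set t | val t \in H])) => P; apply/setP => t.
  by rewrite !inE mem_imset ?(negPf (valP t)) //; apply: val_inj.
rewrite -(card_imset _ injF); apply: subset_leq_card; apply/subsetP => _ /imsetP[P oP ->].
rewrite inE subsetUl andbT; apply: (ordinary_hyperplane cA chiP).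
by move: oP; rewrite inE.
Qed.

Lemma hyperplanes_lower_bound : 3 <= r -> 5 + r <= #|E| ->
  'C(#|E|, r - 3) * (6 * (#|E| - (r - 3))) <=
  13 * 'C(r.-1, 2) * #|independent_hyperplanes N|.
Proof.
move=> r3 big; set IH := independent_hyperplanes N.
pose P A H := (#|A| == r - 3) && (A \subset H).
have E1 : \sum_(A : {set E} | #|A| == r - 3) #|[set H in IH | A \subset H]| =
    'C(r.-1, 2) * #|IH|.
  transitivity (\sum_(A : {set E} | #|A| == r - 3) \sum_(H in IH | A \subset H) 1).
    by apply: eq_bigr => A _; rewrite sum1_card; apply: eq_card => H; rewrite in_set.
  rewrite (exchange_big_dep (fun H => H \in IH)) //=; last by move=> A H _ /andP[].
  rewrite mulnC -sum_nat_const; apply: eq_bigr => H HI; rewrite HI /= sum1_card.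
  have cH : #|H| = r.-1 by move: HI; rewrite inE => /andP[_ /eqP <-].
  have -> : 'C(r.-1, 2) = 'C(#|H|, r - 3) by rewrite cH -bin_sub; [congr 'C(_, _)|]; lia.
  by rewrite -cards_draws; apply: eq_card => A; rewrite !inE andbC.
rewrite -mulnA -E1 big_distrr /=.
have <- : \sum_(A : {set E} | #|A| == r - 3) 6 * (#|E| - (r - 3)) =
    'C(#|E|, r - 3) * (6 * (#|E| - (r - 3))).
  by rewrite sum_nat_const -card_draws; congr (_ * _); apply: eq_card => A; rewrite !inE.
apply: leq_sum => A /eqP cA; rewrite -cA; apply: hyperplanes_through; lia.
Qed.

End Paving.

(** * The binomial estimate and the final bound *)

Import Order.TTheory GRing.Theory Num.Theory.

(** After multiplication by [k + 1], this follows from [(k+1) C(n,k+1) = (n-k) C(n,k)] and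
    [2 C(k+2,2) = (k+2)(k+1)]. *)
Lemma hyperplane_count (k n m : nat) :
  ('C(n, k) * (6 * (n - k)) <= 13 * 'C(k.+2, 2) * m -> 12 * 'C(n, k.+1) <= 13 * k.+2 * m)%N.
Proof.
move=> H; rewrite -(leq_pmul2l (ltn0Sn k)).
have E1 := mul_bin_left n k; have := mul_bin_diag k.+2 1; rewrite /= bin1 => E2.
move: E1 E2 H; move: 'C(n, k) 'C(n, k.+1) 'C(k.+2, 2) => a b c E1 E2 H; nia.
Qed.

Local Open Scope ring_scope.

Theorem theorem2 (r n : nat) (hr : (3 <= r)%N) (hn : (5 + r <= n)%N)
    (E : finType) (M : oriented_matroid E) (hE : #|E| = n)
    (hrank : mrank (underlying M) = r) (hpav : paving (underlying M)) :
  f n r <= #|independent_hyperplanes (underlying M)|%:R.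
Proof.
have := hyperplanes_lower_bound hpav; rewrite hrank hE => /(_ hr hn).
have [k Er] : exists k, r = k.+3 by exists (r - 3)%N; lia.
have -> : (r - 3)%N = k by lia.
have -> : r.-1 = k.+2 by rewrite Er.
move=> /hyperplane_count.
set m := #|_| => H; rewrite /f.
have -> : (r%:R - 1 : rat) = k.+2%:R by rewrite Er -(addn1 k.+2) natrD addrK.
have -> : (r - 2)%N = k.+1 by lia.
rewrite mulrAC ler_pdivrMr; last by rewrite -natrM ltr0n.
by rewrite -!natrM ler_nat [leqRHS]mulnC.
Qed.
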